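(* Let $G=G_1\ast\cdots\ast G_k\ast F_p$ be a free product decomposition of a finitely generated group with associated free factor system $\mathcal{G}$. Let $[\phi]\in\mathrm{Out}(G,\mathcal{G})$ be an outer automorphism of exponential growth, and let $\Lambda^+\in\mathcal{L}([\phi])$ and $\Lambda^-\in\mathcal{L}([\phi]^{-1})$ be two paired and $[\phi]$-invariant attracting laminations. Suppose that $H$ is a subgroup of $\mathrm{Out}(G,\mathcal{G})$ containing $[\phi]$ and that there is an element $[\psi]\in H$ of exponential growth such that generic lines of the four laminations $[\psi]^{\pm1}(\Lambda^{\pm})$ are weakly attracted to $\Lambda^+$ under the action of $[\phi]$ and to $\Lambda^-$ under the action of $[\phi]^{-1}$. Then $H$ contains a free subgroup of rank two.
   Context: Setting. $\mathcal{G}=(\{[G_1],\dots,[G_k]\},p)$, where $[G_i]$ is the conjugacy class of $G_i$ and $F_p$ is free of rank $p$. $\mathrm{Aut}(G,\mathcal{G})$ is the group of automorphisms of $G$ sending each $[G_i]$ to some $[G_j]$, and $\mathrm{Out}(G,\mathcal{G})=\mathrm{Aut}(G,\mathcal{G})/\mathrm{Inn}(G)$. A $\mathcal{G}$-tree is a simplicial $G$-tree with trivial edge stabilisers, exactly one orbit of vertices with stabiliser conjugate to $G_i$ for each $i$, and all other vertex stabilisers trivial. $\mathcal{O}=\mathcal{O}(\mathcal{G})$ is the set of minimal simplicial metric $\mathcal{G}$-trees without redundant vertices, up to $G$-equivariant isometry. An element of $G$ is peripheral if it fixes a vertex of some (any) $T\in\mathcal{O}$. A topological representative of $[\phi]$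 is a Lipschitz map $\tilde f:T\to T$, $T\in\mathcal{O}$, with $\tilde f(gx)=\phi'(g)\tilde f(x)$ for some $\phi'\in[\phi]$. Exponential growth. $[\phi]$ has exponential growth if for some $T\in\mathcal{O}$ and some $g\in G$ the translation length of $\phi^n(g)$ on $T$ grows exponentially in $n$ (equivalently, a relative train track representative has an exponentially growing stratum). Lines. For $T\in\mathcal{O}$, $\partial T=\partial_\infty T\cup V_\infty(T)$, where $\partial_\infty T$ is the Gromov boundary and $V_\infty(T)$ the set of vertices of infinite valence. $T\cup\partial_\infty T$ has the observers' topology, generated by half-trees (a half-tree is a component of $T\setminus\{x\}$ together with the boundary points of rays that eventually lie in it). $\partial^2(G,\mathcal{G})$ is the set of unordered pairs of distinct points of $\partial T$ (independent of $T$), whose elements are called lines and are identified with tight paths in $T$ joining the two points; a line is bi-infinite if both endpoints are in $\partial_\infty T$. For a finite tight path $\gamma$, let $N(\gamma)$ be the set of lines containing $\gamma$; these sets form a neighbourhood basis at bi-infinite lines. A topological representative $\tilde f$ induces a homeomorphism $\tilde f_\#$ of $\partial^2(G,\mathcal{G})$; modulo the $G$-action it depends only on $[\phi]$ and is written $[\phi]_\#$. Convergence of lines is understood modulo $G$: bi-infinite lines $\ell_n$ converge to $\ell$ if for every finite segment $P\subseteq\ell$ there are $g_n\in G$ and segments $Q_n\subseteq\ell_n$ with $g_nQ_n\supseteq P$ for all large $n$. A line $\ell'$ is weakly attracted to $\ell$ under $[\phi]$ if $[\phi]^n_\#(\ell')\to\ell$ as $n\to\infty$. It is weakly attracted to an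 attracting lamination $\Lambda$ if it is weakly attracted to a generic line of $\Lambda$. Attracting laminations. A set $U$ of lines (modulo $G$) is an attracting neighbourhood of $\ell$ for $[\phi]$ if $[\phi]_\#(U)\subseteq U$ and $\{[\phi]_\#^n(U):n\ge 0\}$ is a neighbourhood basis of $\ell$. A line is birecurrent if it is bi-infinite and every finite subpath occurs (up to $G$-translation) infinitely often in each end. A nonperipheral $g$ determines the periodic line $(g^{-\infty},g^{+\infty})$. A line is carried by the conjugacy class of a free factor $A$ (a free factor of the form $A=G_{i_1}\ast\cdots\ast G_{i_\nu}\ast F_\lambda$, with factors up to conjugacy) if it is in the closure of the periodic lines determined by conjugates of nonperipheral elements of $A$. An attracting lamination for $[\phi]$ is a closed $G$-invariant set $\Lambda^+\subseteq\partial^2(G,\mathcal{G})$ that is the closure (of the $G$-orbit) of a single line $\ell$ such that: $\ell$ is birecurrent; $\ell$ has an attracting neighbourhood for some iterate of $[\phi]$; $\ell$ is not carried by any $[\phi]$-periodic $\mathbb{Z}$ or $\mathbb{Z}_2\ast\mathbb{Z}_2$ free factor. Such a line $\ell$ is called generic for $\Lambda^+$. $\mathcal{L}([\phi])$ is the (finite, $[\phi]$-invariant) set of attracting laminations for $[\phi]$. Pairing. For an attracting lamination $\Lambda$ there is a unique conjugacy class $F(\Lambda)$ of free factors of minimal (Kurosh) rank carrying every line of $\Lambda$. $\Lambda^+\in\mathcal{L}([\phi])$ and $\Lambda^-\in\mathcal{L}([\phi]^{-1})$ are paired if $F(\Lambda^+)=F(\Lambda^-)$. $[\psi]^{\pm1}(\Lambda^\pm)$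 is the image of $\Lambda^{\pm}$ under $[\psi]^{\pm1}_\#$; its generic lines are the images of generic lines of $\Lambda^\pm$. *)

(* Defs.v *)
From HB Require Import structures.
From mathcomp Require Import all_boot all_order all_algebra.
From mathcomp Require Import all_classical reals topology normedtype.

Set Implicit Arguments.
Unset Strict Implicit.
Unset Printing Implicit Defensive.

Import Order.TTheory GRing.Theory Num.Theory.

Local Open Scope classical_set_scope.
Local Open Scope card_scope.
Local Open Scope ring_scope.

Section Groups.
Variable G : groupType.
Implicit Types A B S : set G.

Definition subgroup A := A 1%g /\ forall x y, A x -> A y -> A (x / y)%g.

Definition generated S : set G :=
  [set x | forall A, subgroup A -> S `<=` A -> A x].

Definition finitely_generated := exists s : seq G, generated [set` s] = setT.

Definition conjugate A B := exists g : G, B = [set (g * a / g)%g | a in A].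

(* B is the internal free product of the subgroups A i: it is generated by them
   and no nonempty reduced word in them is trivial. *)
Definition is_free_product (I : eqType) (A : I -> set G) B :=
  [/\ forall i, subgroup (A i),
      B = generated (\bigcup_i A i) &
      forall w : seq (I * G), w != [::] ->
        (forall u, u \in w -> A u.1 u.2 /\ u.2 != 1%g) ->
        sorted (fun u v => u.1 != v.1) w ->
        (\prod_(u <- w) u.2)%g != 1%g].

Definition free_of_rank (n : nat) B := exists x : 'I_n -> G,
  (forall i m, (0 < m)%N -> (x i ^+ m)%g != 1%g) /\
  is_free_product (fun i => generated [set x i]) B.

(* B is isomorphic to Z_2 * Z_2. *)
Definition infinite_dihedral B := exists x : bool -> G,
  (forall i, x i != 1%g /\ (x i ^+ 2)%g = 1%g) /\
  is_free_product (fun i => generated [set x i]) B.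

End Groups.

Section Automorphisms.
Variable G : groupType.

Record aut := Aut {
  aut_fun :> G -> G;
  aut_mul : {morph aut_fun : x y / (x * y)%g};
  aut_bij : bijective aut_fun }.

Lemma aut_ext (a b : aut) : a =1 b -> a = b.
Proof.
case: a b => [f fM fb] [g gM gb] /= /funext fg; subst g.
by rewrite (Prop_irrelevance fM gM) (Prop_irrelevance fb gb).
Qed.

HB.instance Definition _ := gen_eqMixin aut.
HB.instance Definition _ := gen_choiceMixin aut.

Definition aut1 : aut :=
  @Aut idfun (fun _ _ => erefl) (Bijective (fun _ => erefl) (fun _ => erefl)).

Lemma aut_comp_mul (a b : aut) : {morph (a \o b) : x y / (x * y)%g}.
Proof. by move=> x y /=; rewrite !aut_mul. Qed.

Definition aut_comp (a b : aut) : aut :=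
  Aut (aut_comp_mul a b) (bij_comp (aut_bij a) (aut_bij b)).

Lemma aut_inv_subproof (a : aut) :
  exists b : aut, cancel a b /\ cancel b a.
Proof.
case: (aut_bij a) => g ag ga.
have gM : {morph g : x y / (x * y)%g}.
  by move=> x y; apply: (can_inj ag); rewrite aut_mul !ga.
by exists (Aut gM (Bijective ga ag)).
Qed.

Definition aut_inv (a : aut) : aut := projT1 (cid (aut_inv_subproof a)).

Lemma aut_invK (a : aut) : cancel a (aut_inv a) /\ cancel (aut_inv a) a.
Proof. by rewrite /aut_inv; case: cid. Qed.

Lemma aut_compA : associative aut_comp.
Proof. by move=> a b c; apply: aut_ext. Qed.

Lemma aut_comp1 : left_id aut1 aut_comp.
Proof. by move=> a; apply: aut_ext. Qed.

Lemma aut_comp2 : right_id aut1 aut_comp.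
Proof. by move=> a; apply: aut_ext. Qed.

Lemma aut_compV : left_inverse aut1 aut_inv aut_comp.
Proof. by move=> a; apply: aut_ext => x /=; case: (aut_invK a) => ->. Qed.

Lemma aut_compV2 : right_inverse aut1 aut_inv aut_comp.
Proof. by move=> a; apply: aut_ext => x /=; case: (aut_invK a) => _ ->. Qed.

(* The product of automorphisms is composition: (a * b) x = a (b x). *)
HB.instance Definition _ :=
  isGroup.Build aut aut_compA aut_comp1 aut_comp2 aut_compV aut_compV2.

Lemma inn_mul (g : G) : {morph (fun x => g * x / g)%g : x y / (x * y)%g}.
Proof. by move=> x y /=; rewrite !mulgA mulgVK. Qed.

Lemma inn_bij (g : G) : bijective (fun x => g * x / g)%g.
Proof.
exists (fun x => g^-1 * x * g)%g => x /=.
  by rewrite !mulgA mulVg mul1g mulgVK.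
by rewrite !mulgA mulgV mul1g mulgK.
Qed.

Definition inn (g : G) : aut := Aut (@inn_mul g) (@inn_bij g).

Lemma innM g h : inn (g * h)%g = (inn g * inn h)%g.
Proof. by apply: aut_ext => x /=; rewrite invgM !mulgA. Qed.

Lemma inn1 : inn 1%g = 1%g.
Proof. by apply: aut_ext => x /=; rewrite mul1g divg1. Qed.

Lemma aut_inn (a : aut) g : (inn (a g) * a = a * inn g)%g.
Proof.
apply: aut_ext => x /=; rewrite !aut_mul; congr (_ * _)%g.
apply: (@mulgI _ (a g)); rewrite mulgV -aut_mul mulgV.
by apply: (@mulgI _ (a 1%g)); rewrite -aut_mul !mulg1.
Qed.

(* Elements of Out(G) are the cosets of Inn(G) in Aut(G), as sets. *)
Definition inn_coset (a : aut) : set aut := [set (a * inn g)%g | g in setT].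

Record out := Out {
  out_set : set aut;
  out_coset : exists a, out_set = inn_coset a }.

Lemma out_ext (A B : out) : out_set A = out_set B -> A = B.
Proof.
by case: A B => [A hA] [B hB] /= E; subst B; rewrite (Prop_irrelevance hA hB).
Qed.

HB.instance Definition _ := gen_eqMixin out.
HB.instance Definition _ := gen_choiceMixin out.

Definition out_of (a : aut) : out := Out (ex_intro _ a erefl).

Lemma out_ofP (A : out) : exists a, A = out_of a.
Proof. by case: A => A [a E]; exists a; apply: out_ext. Qed.

Lemma inn_cosetM a b :
  [set (x * y)%g | x in inn_coset a & y in inn_coset b] =
  inn_coset (a * b)%g.
Proof.
apply/seteqP; split=> [_ [_ [g _ <-]] [_ [h _ <-]] <- | _ [g _ <-]].
  exists (aut_inv b g * h)%g => //; rewrite innM !mulgA; congr (_ * _)%g.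
  rewrite -!mulgA; congr (_ * _)%g; rewrite -aut_inn.
  by case: (aut_invK b) => _ ->.
exists a; first by exists 1%g; rewrite ?inn1 ?mulg1.
by exists (b * inn g)%g; [exists g | rewrite mulgA].
Qed.

Lemma inn_cosetV a : [set x^-1%g | x in inn_coset a] = inn_coset a^-1%g.
Proof.
have innV g : (inn g)^-1%g = inn g^-1%g.
  by apply: (@mulgI _ (inn g)); rewrite mulgV -innM mulgV inn1.
apply/seteqP; split=> [_ [_ [g _ <-] <-] | _ [g _ <-]].
  exists (a g^-1)%g => //; rewrite invgM innV -(aut_inn a^-1%g).
  by congr (inn _ * _)%g; case: (aut_invK a) => ->.
exists (a * inn (a^-1%g g)^-1)%g; first by exists (a^-1%g g)^-1%g.
by rewrite invgM innV invgK aut_inn.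
Qed.

Lemma out_mul_subproof (A B : out) :
  exists a, [set (x * y)%g | x in out_set A & y in out_set B] = inn_coset a.
Proof.
case: A B => [A [a Aa]] [B [b Bb]] /=; exists (a * b)%g; subst A B.
exact: inn_cosetM.
Qed.

Lemma out_inv_subproof (A : out) :
  exists a, [set x^-1%g | x in out_set A] = inn_coset a.
Proof. by case: A => [A [a Aa]] /=; exists a^-1%g; subst A; exact: inn_cosetV. Qed.

Definition out_mul (A B : out) : out := Out (out_mul_subproof A B).
Definition out_inv (A : out) : out := Out (out_inv_subproof A).
Definition out1 : out := out_of 1%g.

Lemma out_mulE a b : out_mul (out_of a) (out_of b) = out_of (a * b)%g.
Proof. by apply: out_ext; exact: inn_cosetM. Qed.

Lemma out_invE a : out_inv (out_of a) = out_of a^-1%g.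
Proof. by apply: out_ext; exact: inn_cosetV. Qed.

Lemma out_mulA : associative out_mul.
Proof.
move=> A B C; case: (out_ofP A) (out_ofP B) (out_ofP C) => a -> [b ->] [c ->].
by rewrite !out_mulE mulgA.
Qed.

Lemma out_mul1 : left_id out1 out_mul.
Proof. by move=> A; case: (out_ofP A) => a ->; rewrite out_mulE mul1g. Qed.

Lemma out_mul2 : right_id out1 out_mul.
Proof. by move=> A; case: (out_ofP A) => a ->; rewrite out_mulE mulg1. Qed.

Lemma out_mulV : left_inverse out1 out_inv out_mul.
Proof.
by move=> A; case: (out_ofP A) => a ->; rewrite out_invE out_mulE mulVg.
Qed.

Lemma out_mulV2 : right_inverse out1 out_inv out_mul.
Proof.
by move=> A; case: (out_ofP A) => a ->; rewrite out_invE out_mulE mulgV.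
Qed.

HB.instance Definition _ :=
  isGroup.Build out out_mulA out_mul1 out_mul2 out_mulV out_mulV2.

End Automorphisms.

Section FreeFactorSystem.
Variables (G : groupType) (k : nat) (Gs : 'I_k -> set G) (p : nat).

(* G = G_1 * ... * G_k * F_p, where None indexes the free factor F_p. *)
Definition free_product_decomposition :=
  (forall i, Gs i <> [set 1%g]) /\
  exists F : set G, free_of_rank p F /\
    is_free_product (fun i : option 'I_k => if i is Some j then Gs j else F) setT.

Definition autG : set (aut G) :=
  [set a | forall i, exists j, conjugate (Gs j) (a @` Gs i)].

Definition outG : set (out G) := [set Phi : out G | exists2 a, autG a & out_set Phi a].

(* A is a free factor G_{i_1} * ... * G_{i_v} * F_l of G relative to the free
   factor system, and n = v + l is its Kurosh rank. The G_i are replaced by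
   conjugates Gs' i, and the complementary factors G_j and F_m, l + m = p, are
   part of the decomposition. *)
Definition free_factor (A : set G) (n : nat) :=
  exists (Gs' : 'I_k -> set G) (I : {set 'I_k}) (l m : nat) (F1 F2 : set G),
  [/\ forall i, conjugate (Gs i) (Gs' i),
      [/\ (l + m = p)%N, free_of_rank l F1 & free_of_rank m F2],
      is_free_product (fun i : 'I_k + bool =>
        match i with inl j => Gs' j | inr b => if b then F1 else F2 end) setT,
      A = generated (F1 `|` \bigcup_(i in [set` I]) Gs' i) &
      n = (#|I| + l)%N].

(* The conjugacy class [A] is invariant under a positive power of Phi. *)
Definition out_periodic (Phi : out G) (A : set G) :=
  exists2 m, (0 < m)%N & exists2 a, out_set (Phi ^+ m)%g a & conjugate A (a @` A).

End FreeFactorSystem.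

Section Trees.
Variables (R : realType) (T : metricType R).

Definition segment (x y : T) : set T :=
  [set z | mdist x z + mdist z y = mdist x y].

(* Nonempty geodesic 0-hyperbolic (four-point condition) metric spaces. *)
Definition real_tree :=
  [/\ [set: T] !=set0,
      forall x y : T, exists c : R -> T, [/\ c 0 = x, c (mdist x y) = y &
        forall s t : R, 0 <= s <= mdist x y -> 0 <= t <= mdist x y ->
          mdist (c s) (c t) = `|s - t|] &
      forall x y z t : T, mdist x y + mdist z t <=
        Num.max (mdist x z + mdist y t) (mdist x t + mdist y z)].

Definition edge (V : set T) (u v : T) :=
  [/\ u != v, V u, V v & segment u v `&` V = [set u; v]].

(* The metric realisation of a simplicial tree with vertex set V. *)
Definition simplicial_tree (V : set T) :=
  [/\ real_tree,
      forall x y, finite_set (segment x y `&` V) &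
      forall x, ~ V x -> exists u v, [/\ edge V u v, segment u v x &
        \forall y \near x, segment u v y]].

Definition direction (x y : T) : set T := connected_component (~` [set x]) y.

Definition directions (x : T) : set (set T) := [set direction x y | y in ~` [set x]].

(* Rays are parametrised by [0, +oo[; their values on negative reals are
   irrelevant. *)
Definition is_ray (r : R -> T) :=
  forall s t, 0 <= s -> 0 <= t -> mdist (r s) (r t) = `|s - t|.

Definition asymptotic (r r' : R -> T) :=
  exists C : R, forall t, 0 <= t -> mdist (r t) (r' t) <= C.

(* The Gromov boundary: classes of rays at bounded distance. *)
Record bdry := Bdry {
  bdry_set : set (R -> T);
  bdry_class : exists2 r, is_ray r &
    bdry_set = [set r' | is_ray r' /\ asymptotic r r'] }.

HB.instance Definition _ := gen_eqMixin bdry.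
HB.instance Definition _ := gen_choiceMixin bdry.

(* The union of T and its Gromov boundary, with the observers' topology. *)
Definition obs : Type := (T + bdry)%type.

HB.instance Definition _ := Choice.on obs.

Definition half_tree (x y : T) : set obs := [set a | match a with
  | inl z => direction x y z
  | inr e => forall r, bdry_set e r -> \forall t \near +oo, direction x y (r t)
  end].

Definition half_trees : set (set obs) :=
  [set A | exists x y : T, y != x /\ A = half_tree x y].

HB.instance Definition _ := isSubBaseTopological.Build obs half_trees idfun.

Definition tight (a b : obs) : set T := match a, b with
  | inl u, inl v => segment u v
  | inl u, inr e | inr e, inl u =>
      [set x | exists r : R -> T, [/\ bdry_set e r, r 0 = u & exists2 t : R, 0 <= t & x = r t]]
  | inr e, inr e' =>
      [set x | exists c : R -> T,
        [/\ forall s t, mdist (c s) (c t) = `|s - t|,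
            bdry_set e (fun t => c (- t)), bdry_set e' c & exists t, x = c t]]
  end.

(* The value at a point of obs of the continuous extension of a map T -> T,
   as a relation. *)
Definition extends (f : T -> T) (a b : obs) : Prop := match a with
  | inl x => b = inl (f x)
  | inr e => forall r, bdry_set e r -> (inl (f (r t)) : obs) @[t --> +oo] --> b
  end.

Definition is_lipschitz (f : T -> T) :=
  exists K : R, forall x y, mdist (f x) (f y) <= K * mdist x y.

End Trees.

Section GTrees.
Variables (R : realType) (G : groupType).

Record gtree := GTree {
  gtree_pt :> metricType R;
  vertex : set gtree_pt;
  act : G -> gtree_pt -> gtree_pt;
  gtree_simplicial : simplicial_tree vertex;
  act1 : forall x, act 1%g x = x;
  actM : forall g h x, act (g * h)%g x = act g (act h x);
  act_isom : forall g x y, mdist (act g x) (act g y) = mdist x y;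
  act_vertex : forall g x, vertex x -> vertex (act g x) }.

Variable T : gtree.

Definition stab (x : T) : set G := [set g | act g x = x].

(* Membership in O, for a representative of the equivariant isometry class. *)
Definition outer_space (k : nat) (Gs : 'I_k -> set G) :=
  [/\ [/\ forall (g : G) (u v : T), edge (@vertex T) u v ->
            act g @` [set u; v] = [set u; v] -> g = 1%g,
          forall i, exists2 v : T, vertex v & conjugate (Gs i) (stab v),
          forall i (v w : T), vertex v -> vertex w ->
            conjugate (Gs i) (stab v) -> conjugate (Gs i) (stab w) ->
            exists g, w = act g v &
          forall v : T, vertex v -> (forall i, ~ conjugate (Gs i) (stab v)) ->
            stab v = [set 1%g]],
      forall S : set T, S !=set0 ->
        (forall x y, S x -> S y -> segment x y `<=` S) ->
        (forall g x, S x -> S (act g x)) -> S = setT &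
      forall v : T, vertex v -> stab v = [set 1%g] -> ~ (directions v #= `I_2)].

Definition translation_length (g : G) : R :=
  inf [set mdist x (act g x) | x in [set: T]].

Definition peripheral (g : G) := exists2 v : T, vertex v & act g v = v.

Definition infinite_valence (v : T) := infinite_set (directions v).

(* The subset of obs denoted \partial T. *)
Definition bd : set (obs T) :=
  [set a | if a is inl v then vertex v /\ infinite_valence v else True].

(* Unordered pairs of distinct points of \partial T. *)
Record line := Line {
  ends : set (obs T);
  endsP : exists a b, [/\ bd a, bd b, a <> b & ends = [set a; b]] }.

HB.instance Definition _ := gen_eqMixin line.
HB.instance Definition _ := gen_choiceMixin line.

(* The quotient of the topology of (\partial T)^2 minus the diagonal. *)
Definition line_open (U : set line) := forall (l : line) a b, U l ->
  ends l = [set a; b] ->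
  \forall q \near (a, b), forall l' : line, ends l' = [set q.1; q.2] -> U l'.

Lemma line_openT : line_open setT.
Proof. by move=> l a b _ _; apply: filterE => q l1 _; exact: I. Qed.

Lemma line_openI : setI_closed line_open.
Proof.
move=> U V oU oV l a b [Ul Vl] e.
apply: filterS (filterI (oU _ _ _ Ul e) (oV _ _ _ Vl e)) => q [hU hV] l' e'.
by split; [exact: hU | exact: hV].
Qed.

Lemma line_open_bigU (I : Type) (f : I -> set line) :
  (forall i, line_open (f i)) -> line_open (\bigcup_i f i).
Proof.
move=> of_ l a b [i _ fl] e; apply: filterS (of_ i _ _ _ fl e) => q h l' e'.
by exists i => //; exact: h.
Qed.

HB.instance Definition _ :=
  isOpenTopological.Build line line_openT line_openI line_open_bigU.

Definition biinfinite (l : line) :=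
  forall a, ends l a -> exists e : bdry T, a = inr e.

Definition tight_path (l : line) : set T :=
  [set x | exists a b, ends l = [set a; b] /\ tight a b x].

Definition line_map (f : T -> T) (l l' : line) := exists a b a' b',
  [/\ ends l = [set a; b], ends l' = [set a'; b'],
      extends f a a' & extends f b b'].

Definition line_orbit (l : line) : set line :=
  [set l' | exists g, line_map (act g) l l'].

Definition line_invariant (U : set line) :=
  forall l, U l -> line_orbit l `<=` U.

Definition topological_representative (Phi : out G) (f : T -> T) :=
  is_lipschitz f /\
  exists2 a, out_set Phi a & forall g x, f (act g x) = act (a g) (f x).

(* The graph of [phi]_#, as a G-invariant relation: out_map Phi l l' holds if
   the G-orbit of l' is the image of the G-orbit of l. *)
Definition out_map (Phi : out G) (l l' : line) :=
  exists2 f, topological_representative Phi f & line_map f l l'.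

Definition out_image (Phi : out G) (U : set line) : set line :=
  [set l' | exists2 l, U l & out_map Phi l l'].

Definition line_cvg (u : nat -> line) (l : line) :=
  forall x y : T, segment x y `<=` tight_path l ->
  \forall n \near \oo, exists g (x' y' : T),
    segment x' y' `<=` tight_path (u n) /\ segment x y `<=` act g @` segment x' y'.

Definition weakly_attracted (Phi : out G) (l' l : line) :=
  exists2 u : nat -> line,
    forall n, out_map (Phi ^+ n)%g l' (u n) & line_cvg u l.

(* Neighbourhoods of l modulo G are the G-invariant neighbourhoods of l. *)
Definition attracting_neighbourhood (Phi : out G) (l : line) (U : set line) :=
  [/\ line_invariant U, out_image Phi U `<=` U,
      forall n, nbhs l (out_image (Phi ^+ n)%g U) &
      forall W, line_invariant W -> nbhs l W ->
        exists n, out_image (Phi ^+ n)%g U `<=` W].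

Definition birecurrent (l : line) := biinfinite l /\
  forall x y : T, segment x y `<=` tight_path l ->
  forall (e : bdry T) (r : R -> T), ends l (inr e) -> bdry_set e r ->
    r @` [set t | 0 <= t] `<=` tight_path l ->
    infinite_set [set Q | (exists g, Q = act g @` segment x y) /\
                          Q `<=` r @` [set t | 0 <= t]].

Definition periodic_line (g : G) (l : line) := exists a b : bdry T,
  ends l = [set inr a; inr b] /\
  forall x : T,
    (inl (act (g ^- n)%g x) : obs T) @[n --> \oo] --> (inr a : obs T) /\
    (inl (act (g ^+ n)%g x) : obs T) @[n --> \oo] --> (inr b : obs T).

Definition carried (A : set G) (l : line) :=
  closure [set l' | exists g h, [/\ A g, ~ peripheral g &
                                    periodic_line (h * g / h)%g l']] l.

Variables (k : nat) (Gs : 'I_k -> set G) (p : nat).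

Definition generic (Phi : out G) (L : set line) (l : line) :=
  [/\ L = closure (line_orbit l),
      birecurrent l,
      exists m, (0 < m)%N /\
        exists U, attracting_neighbourhood (Phi ^+ m)%g l U &
      forall A n, free_factor Gs p A n -> free_of_rank 1 A \/ infinite_dihedral A ->
        out_periodic Phi A -> ~ carried A l].

Definition attracting_lamination (Phi : out G) (L : set line) :=
  exists l, generic Phi L l.

Definition carries (A : set G) (L : set line) := forall l, L l -> carried A l.

(* The conjugacy class F(L), as the set of its members. *)
Definition lam_support (L : set line) : set (set G) :=
  [set A | exists n, [/\ free_factor Gs p A n, carries A L &
    forall B m, free_factor Gs p B m -> carries B L -> (n <= m)%N]].

Definition paired (L L' : set line) := lam_support L = lam_support L'.

Definition weakly_attracted_lam (Phi : out G) (l : line) (L : set line) :=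
  exists2 l', generic Phi L l' & weakly_attracted Phi l l'.

(* l is a generic line of [psi]_#(L), for L an attracting lamination of Phi. *)
Definition generic_image (Psi Phi : out G) (L : set line) (l : line) :=
  exists2 l', generic Phi L l' & out_map Psi l' l.

End GTrees.

Definition exponential_growth (R : realType) (G : groupType) (k : nat)
    (Gs : 'I_k -> set G) (Phi : out G) :=
  exists T : gtree R G, outer_space T Gs /\ exists (g : G) (a : aut G), out_set Phi a /\
    exists c lambda : R, [/\ 0 < c, 1 < lambda &
      \forall n \near \oo, c * lambda ^+ n <= translation_length T (iter n a g)].

(* Main.v *)
Require Import Defs.
From mathcomp Require Import all_boot all_order all_algebra.
From mathcomp Require Import all_classical reals topology normedtype.
From mathcomp Require Import lra.

(** The proof is a ping-pong argument for the action of outer automorphisms on the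
    bi-infinite lines of [T] modulo [G].

    Let [l] be a generic line of one of the two laminations, [U] an attracting
    neighbourhood of it, and [P] a common power of [Phi] that works for both
    laminations.  The hypothesis of weak attraction says that [Phi ^+ n * Psi]
    takes [l] into the attracting neighbourhood of either lamination for large
    [n]; by continuity ([out_map_continuous]) it takes a whole image of [U] under a
    power of [P] there.  Hence large powers of [P] and of [Psi * P / Psi] exchange
    small attracting sets and their translates by [Psi] ([hit_neighbourhood],
    [ping_pong]).  Lines modulo [G] do not form a Hausdorff space and the attracting
    sets of [P] and of its inverse may meet, so a trivial word is not excluded by
    disjointness.  Instead a reduced word that starts and ends with different
    letters would map an attracting set [V] into its image under [P], and the
    inclusion of this image in [V] is strict ([attracting_strict]).

    Strictness is where exponential growth enters ([not_determined]).  If [U] were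
    its own image, it would be contained in every neighbourhood of [l], and so
    every line that crosses a certain segment of [l] would cross translates of all
    segments of [l].  By minimality some line through that segment follows
    translates of the axis of a given loxodromic element at both ends
    ([connecting_line]); so long segments of [l] lie on translates of the axis of
    any loxodromic element.  Two loxodromic elements then have conjugates whose axes
    overlap in a long segment, and these commute because edge stabilisers are
    trivial ([determined_commute]).  As centralisers of loxodromic elements are
    cyclic ([centralizer_cyclic]), every loxodromic element is conjugate to a power
    of one element [c] or to the inverse of such a power.  An automorphism in [Phi]
    sends [c] to a conjugate of [c] or of its inverse, and the translation lengths
    of the iterates of an element stay bounded, against exponential growth.

    The action on lines rests on a coarse description of it.  Representatives exist
    ([representative_exists]): vertices are mapped equivariantly, and edges
    linearly, with finitely many edge orbits to bound the stretch.  Since the action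
    is cobounded, two representatives of the same outer automorphism are at bounded
    distance up to translation ([representative_close]); comparing a composite with
    the identity, every representative is a quasi-isometry, which yields bounded
    cancellation ([bounded_cancellation]).  So the image of a geodesic line follows
    a unique geodesic line ([quasi_line_shadow], [image_shadow]), and this is its
    image for the action.  Composition, inverses and continuity are then estimates
    on distances.  The topology only enters through the fact that the neighbourhoods
    of a bi-infinite line are those of the lines that contain a long segment of it
    ([nbhs_line_sub], [line_nbhs]), and through the uniqueness of limits at the
    boundary ([end_limit_uniq]). *)

Set Implicit Arguments.
Unset Strict Implicit.
Unset Printing Implicit Defensive.

Import Order.TTheory GRing.Theory Num.Theory.
Import numFieldNormedType.Exports.

Local Open Scope classical_set_scope.
Local Open Scope ring_scope.

(** * Subgroups and automorphisms *)

Section GroupLemmas.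
Variable G : groupType.
Implicit Types (x y g h : G) (a : aut G) (A S : set G) (n : nat).

Lemma subgroupV A x : subgroup A -> A x -> A x^-1%g.
Proof. by move=> [A1 AV] /(AV _ _ A1); rewrite mul1g. Qed.

Lemma subgroupM A x y : subgroup A -> A x -> A y -> A (x * y)%g.
Proof.
move=> sA Ax /(subgroupV sA) Ay; have [_ AV] := sA.
by have := AV _ _ Ax Ay; rewrite invgK.
Qed.

Lemma subgroupX A x n : subgroup A -> A x -> A (x ^+ n)%g.
Proof.
by move=> sA Ax; elim: n => [|n IH]; [case: sA|rewrite expgS; exact: subgroupM].
Qed.

Lemma generated_subgroup S : subgroup (generated S).
Proof.
split=> [A [A1 _]|x y hx hy A sA SA]; first by [].
by have [_ h] := sA; apply: h; [exact: hx|exact: hy].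
Qed.

Lemma generated_incl S : S `<=` generated S.
Proof. by move=> x Sx A _; exact. Qed.

Lemma generated_cyclic x g : generated [set x] g ->
  exists n, g = (x ^+ n)%g \/ g = (x ^- n)%g.
Proof.
move=> /(_ [set g | exists n, g = (x ^+ n)%g \/ g = (x ^- n)%g]); apply; last first.
  by move=> _ ->; exists 1%N; left.
split=> [|g1 g2 [n hn] [m hm]]; first by exists 0%N; left.
have sub i j : exists r, (x ^+ i / x ^+ j)%g = (x ^+ r)%g \/
    (x ^+ i / x ^+ j)%g = (x ^- r)%g.
  have [ji|/ltnW ij] := leqP j i; first by exists (i - j)%N; left; rewrite expgnFr.
  by exists (j - i)%N; right; rewrite expgnFr// invgM invgK.
have cm i j : commute (x ^+ i)%g (x ^- j)%g.
  by apply: commuteV; apply: commuteX2.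
case: hn => ->; case: hm => ->.
- exact: sub.
- by exists (n + m)%N; left; rewrite invgK expgnDr.
- by exists (m + n)%N; right; rewrite expgnDr invgM.
- by rewrite invgK -cm; have [r hr] := sub m n; exists r.
Qed.

Lemma conjXgn h g n : ((h * g / h) ^+ n)%g = (h * g ^+ n / h)%g.
Proof.
elim: n => [|n IH]; first by rewrite !expg0 mulg1 mulgV.
by rewrite expgS IH expgS !mulgA mulgVK.
Qed.

Lemma aut_one a : a 1%g = 1%g.
Proof. by apply: (@mulgI _ (a 1%g)); rewrite -aut_mul !mulg1. Qed.

Lemma aut_inverse a g : a g^-1%g = (a g)^-1%g.
Proof. by apply: (@mulgI _ (a g)); rewrite -aut_mul !mulgV aut_one. Qed.

Lemma aut_exp (a : aut G) g n : a (g ^+ n)%g = (a g ^+ n)%g.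
Proof. by elim: n => [|n IH]; rewrite ?expg0 ?aut_one// !expgS aut_mul IH. Qed.

End GroupLemmas.

(** * Geometry of real trees *)

(** Most statements on trees below reduce to linear inequalities between
    distances.  [mlra] puts the two arguments of each distance in a fixed order,
    after discarding the hypotheses that are not such inequalities. *)
Ltac revert_mdist := repeat match goal with
  H : ?P |- _ => lazymatch P with
    | forall x, _ => clear H
    | context [mdist] => revert H
    end end.

Ltac mdist_normal :=
  rewrite ?mdistxx; repeat match goal with |- context [mdist ?x ?y] =>
    match goal with |- context [mdist y x] =>
      tryif constr_eq x y then fail else rewrite (metric_sym y x) end end.

Ltac clear_points := repeat match goal with
  | H : @eq (Metric.sort _) _ _ |- _ => clear H
  | H : @eq (set _) _ _ |- _ => clear H
  | H : @eq (_ -> _) _ _ |- _ => clear H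
  | H : _ \/ _ |- _ => clear H end.

Ltac mlra := clear_points; unfold segment, mkset in *; revert_mdist; mdist_normal; intros; lra.

Section Tree.
Variables (R : realType) (T : metricType R).
Hypothesis treeT : real_tree T.
Implicit Types (x y z w a b : T) (t M : R).

Lemma segment_sym x y z : segment x y z -> segment y x z.
Proof. mlra. Qed.

Lemma segment_left x y : segment x y x.
Proof. rewrite /segment/= mdistxx; lra. Qed.

Lemma segment_right x y : segment x y y.
Proof. rewrite /segment/= mdistxx; lra. Qed.

Lemma segment_eq x z : segment x x z -> z = x.
Proof.
rewrite /segment/= => h; apply: mdist_positivity.
have := mdist_ge0 x z; mlra.
Qed.

Lemma four_point x y z w : mdist x y + mdist z w <= mdist x z + mdist y w \/
  mdist x y + mdist z w <= mdist x w + mdist y z.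
Proof.
case: treeT => _ _ /(_ x y z w); rewrite le_max => /orP[]; by [left|right].
Qed.

Lemma point_at x y (s : R) : 0 <= s <= mdist x y ->
  exists z, segment x y z /\ mdist x z = s.
Proof.
move=> /andP[s0 s1]; case: treeT => _ /(_ x y)[c [c0 c1 cd]] _.
have h0 : 0 <= (0:R) <= mdist x y by rewrite lexx mdist_ge0.
have h1 : 0 <= mdist x y <= mdist x y by rewrite lexx mdist_ge0.
have hs : 0 <= s <= mdist x y by rewrite s0 s1.
have e0 := cd _ _ h0 hs; have e1 := cd _ _ hs h1.
rewrite c0 sub0r normrN ger0_norm// in e0.
rewrite c1 distrC ger0_norm ?subr_ge0// in e1.
exists (c s); split => //; mlra.
Qed.


Lemma mdist_segment x y z w : segment x y z -> segment x y w ->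
  mdist z w = `|mdist x z - mdist x w|.
Proof.
move=> hz hw; have := four_point x y z w.
have := metric_triangle x z w; have := metric_triangle x w z.
by have [h|h] := ger0P (mdist x z - mdist x w) => t1 t2 [] h'; mlra.
Qed.

Lemma segment_uniq x y z w : segment x y z -> segment x y w ->
  mdist x z = mdist x w -> z = w.
Proof.
move=> hz hw e; apply: mdist_positivity.
by rewrite (mdist_segment hz hw) e subrr normr0.
Qed.

Lemma median x y z :
  exists m, [/\ segment x y m, segment x z m & segment y z m].
Proof.
have t1 := metric_triangle x y z; have t2 := metric_triangle y x z.
have t3 := metric_triangle x z y.
have [m [m1 m2]] := @point_at x y ((mdist x y + mdist x z - mdist y z) / 2)
  ltac:(apply/andP; split; mlra).
exists m; have := metric_triangle x m z; have := metric_triangle y m z.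
by move=> t4 t5; case: (four_point x y z m) => h; split; mlra.
Qed.

Lemma segment_trans x y z w : segment x y z -> segment x z w ->
  segment x y w /\ segment w y z.
Proof.
have := metric_triangle x w y; have := metric_triangle w z y.
by move=> *; split; mlra.
Qed.

(** Two segments that overlap in a nontrivial segment form a segment: in a tree a
    local geodesic is a geodesic. *)
Lemma segment_concat x z y w : z != y -> segment x y z -> segment z w y ->
  segment x w z /\ segment x w y.
Proof.
rewrite -mdist_gt0 => h; have := metric_triangle x y w.
have := metric_triangle x z w; have := metric_triangle z y w.
by case: (four_point x y z w); split; mlra.
Qed.

(** Triangles are tripods. *)
Lemma segment_union u w z p : segment u w z -> segment u p z \/ segment p w z.
Proof.
have := metric_triangle u z p; have := metric_triangle p z w.
by case: (four_point u w z p) => *; [right|left]; mlra.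
Qed.

Lemma segment_order x y z w : segment x y z -> segment x y w ->
  mdist x z <= mdist x w -> segment x w z /\ segment z y w.
Proof.
move=> hz hw h; have := mdist_segment hz hw.
by rewrite ler0_norm ?subr_le0// => e; split; mlra.
Qed.

(** The complement of a closed half-tree is convex. *)
Lemma segment_avoid x y p q s : segment p q s ->
  ~ segment x p y -> ~ segment x q y -> ~ segment x s y.
Proof.
move=> hs hp hq hy.
case: (segment_union p hy) => // h1; case: (segment_union q hy) => // h2.
have ys : y = s.
  apply: mdist_positivity; have := metric_triangle p y q; have := mdist_ge0 y s; mlra.
by subst y; case: (segment_union x hs) => // /segment_sym.
Qed.

(** Moving the ends of a segment does not affect the points that are further away
    from the ends than these move. *)
Lemma segment_stable x y x' y' z : segment x y z ->
  mdist x x' < mdist x z -> mdist y y' < mdist y z -> segment x' y' z.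
Proof.
move=> hz hx hy; case: (segment_union x' hz) => h1.
  by have := mdist_ge0 z x'; mlra.
case: (segment_union y' h1) => // h2.
by have := mdist_ge0 z y'; mlra.
Qed.

Lemma open_not_segment u p : open [set w : T | ~ segment u w p].
Proof.
rewrite openE => w /= h; rewrite /interior -nbhs_ballE.
exists (mdist w p).
  by rewrite /= mdist_gt0; apply/eqP => e; subst; case: h; exact: segment_right.
rewrite ballEmdist => w' /= h1 h2.
case: (segment_union w h2) => // h3.
by have := mdist_ge0 p w'; mlra.
Qed.

Lemma open_beyond u p : open [set w : T | segment u w p /\ w != p].
Proof.
rewrite openE => w /= [h hp]; rewrite /interior -nbhs_ballE.
exists (mdist w p); first by rewrite /= mdist_gt0.
rewrite ballEmdist => w' /= h1; split.
  case: (segment_union w' h) => // h2.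
  by have := mdist_ge0 p w'; mlra.
by apply/eqP => e; subst w'; rewrite ltxx in h1.
Qed.

(** Away from [p], the points beyond [p] as seen from [u] form an open set, and so do
    the others. *)
Lemma connected_cut (C : set T) u v p :
  connected C -> C u -> C v -> segment u v p -> C p.
Proof.
move=> cC Cu Cv hp; apply: contrapT => nCp.
suff e : C `&` [set w | ~ segment u w p] = C by move: Cv; rewrite -e => -[].
apply: cC.
- by exists u; split => // /segment_eq e; apply: nCp; rewrite e.
- by exists [set w | ~ segment u w p] => //; exact: open_not_segment.
- exists (~` [set w | segment u w p /\ w != p]).
    by apply: open_closedC; exact: open_beyond.
  apply/seteqP; split => w [Cw /= h]; split => //; first by case.
  move=> h1; apply: h; split => //.
  by apply/eqP => e; apply: nCp; rewrite -e.
Qed.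

Lemma continuous_nonexpanding (c : R -> T) :
  (forall s t, mdist (c s) (c t) <= `|s - t|) -> continuous c.
Proof.
move=> h s; apply/metricType_numDomainType.cvgrPdist_lt => e e0.
near=> t; apply: le_lt_trans (h _ _) _.
by near: t; exact: cvgr_dist_lt.
Unshelve. all: by end_near. Qed.

Lemma connected_segment x y : connected (segment x y).
Proof.
case: treeT => _ /(_ x y)[c [c0 c1 cd]] _.
have d0 := mdist_ge0 x y.
(* Clamping the parameter extends the geodesic continuously to the real line. *)
pose k t := Num.max 0 (Num.min t (mdist x y)).
have kI t : 0 <= k t <= mdist x y.
  by rewrite /k le_max lexx/= ge_max d0 ge_min lexx orbT.
have kid t : 0 <= t <= mdist x y -> k t = t.
  by move=> /andP[t0 t1]; rewrite /k min_l// max_r.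
have -> : segment x y = (c \o k) @` `[0, mdist x y].
  apply/seteqP; split => [z hz|_ [t /= + <-]].
    have zI : 0 <= mdist x z <= mdist x y.
      by rewrite mdist_ge0/=; have := mdist_ge0 z y; mlra.
    exists (mdist x z); first by rewrite /= in_itv.
    have cz : mdist x (c (mdist x z)) = mdist x z.
      by rewrite -{1}c0 cd// ?lexx ?d0// sub0r normrN ger0_norm ?mdist_ge0.
    have cy : mdist (c (mdist x z)) y = mdist x y - mdist x z.
      rewrite -{1}c1 cd// ?lexx ?d0//.
      by rewrite distrC ger0_norm// subr_ge0; case/andP: zI.
    by rewrite /= kid//; apply: (@segment_uniq x y) => //; mlra.
  rewrite in_itv /= => tI; rewrite kid//.
  have e1 := cd 0 t; have e2 := cd t (mdist x y).
  rewrite c0 lexx d0 sub0r normrN in e1; rewrite c1 lexx d0 in e2.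
  rewrite /segment/= e1// e2//.
  case/andP: tI => t0 t1; rewrite ger0_norm// distrC ger0_norm ?subr_ge0//.
  by rewrite addrC subrK.
apply: connected_continuous_connected; first exact: segment_connected.
apply: continuous_subspaceT; apply: continuous_nonexpanding => s t /=.
rewrite cd ?kI// /k.
case: (leP s (mdist x y)) => ?; case: (leP t (mdist x y)) => ?;
  rewrite ?(max_r d0); try (case: (leP 0 s) => ?); try (case: (leP 0 t) => ?);
  rewrite ler_norml; have [?|?] := ger0P (s - t); apply/andP; split; lra.
Qed.

Lemma directionP x y z : y != x -> direction x y z <-> ~ segment y z x.
Proof.
move=> yx; split.
  move=> [C [Cy CX cC] Cz] h.
  by have /CX := connected_cut cC Cy Cz h; exact.
move=> h; exists (segment y z); last exact: segment_right.
by split; [exact: segment_left | move=> w hw /= e; subst w |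
  exact: connected_segment].
Qed.

(** The image of a segment is connected, and every point between the images of its
    ends separates these. *)
Lemma lipschitz_cross (f : T -> T) x y p : is_lipschitz f ->
  segment (f x) (f y) p -> exists2 z, segment x y z & f z = p.
Proof.
move=> [K fK] hp.
have fc : continuous f.
  move=> z; apply/metricType_numDomainType.cvgrPdist_lt => e e0.
  have K1 : 0 < `|K| + 1 by rewrite ltr_wpDl.
  near=> w; apply: le_lt_trans (fK _ _) _.
  apply: (@le_lt_trans _ _ ((`|K| + 1) * mdist z w)).
    by rewrite ler_wpM2r ?mdist_ge0// (le_trans (ler_norm K))// lerDl.
  rewrite mulrC -ltr_pdivlMr//; near: w.
  apply: metricType_numDomainType.cvgr_dist_lt; first exact: cvg_id.
  exact: divr_gt0.
have cC : connected (f @` segment x y).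
  apply: connected_continuous_connected; first exact: connected_segment.
  exact: continuous_subspaceT.
have [||z] := connected_cut cC _ _ hp.
- by exists x => //; exact: segment_left.
- by exists y => //; exact: segment_right.
- by move=> hz e; exists z.
Unshelve. all: by end_near. Qed.

End Tree.

(** * Rays and geodesic lines *)

Section Rays.
Variables (R : realType) (T : metricType R).
Hypothesis treeT : real_tree T.
Implicit Types (x y z w o : T) (p r c : R -> T) (s t u M : R).

Definition geodesic_line c := forall s t, mdist (c s) (c t) = `|s - t|.

(** The hypothesis says that the Gromov products of the points [q n] at [o] tend to
    infinity, so that the initial parts of the segments from [o] to [q n]
    stabilise. *)
Lemma limit_ray o (q : nat -> T) :
  (forall M : R, exists N, forall n m, (N <= n)%N -> (N <= m)%N ->
    M <= mdist o (q n) + mdist o (q m) - mdist (q n) (q m)) ->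
  exists r, [/\ is_ray r, r 0 = o &
    forall s, 0 <= s -> \forall n \near \oo, segment o (q n) (r s)].
Proof.
move=> hq.
have /choice[r hr] : forall s : R, exists x, 0 <= s -> mdist o x = s /\
    \forall n \near \oo, segment o (q n) x.
  move=> s; case: (leP 0 s) => s0; last by exists o => h; exfalso; lra.
  have [N hN] := hq (2 * s).
  have [x [x1 x2]] := @point_at _ _ treeT o (q N) s ltac:(apply/andP; split;
    [exact: s0 | have := hN N N (leqnn _) (leqnn _); mlra]).
  exists x => _; split => //; near=> n.
  have Nn : (N <= n)%N by near: n; exact: nbhs_infty_ge.
  have [m [m1 m2 m3]] := median treeT o (q N) (q n).
  have h : mdist o x <= mdist o m by have := hN N n (leqnn _) Nn; mlra.
  have [h1 h2] := segment_order treeT x1 m1 h.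
  by have [] := segment_trans m2 h1.
have r0 : r 0 = o.
  by apply/esym/mdist_positivity; have [] := hr _ (lexx 0).
exists r; split => // [s t s0 t0|s s0]; last by case: (hr _ s0).
have [es hs] := hr _ s0; have [et ht] := hr _ t0.
have [n [hn1 hn2]] := filter_ex (filterI hs ht).
by rewrite (mdist_segment treeT hn1 hn2) es et.
Unshelve. all: by end_near. Qed.

Lemma geodesic_dist c s t : geodesic_line c -> s <= t ->
  mdist (c s) (c t) = t - s.
Proof. by move=> hc st; rewrite hc distrC ger0_norm ?subr_ge0. Qed.

Lemma ray_dist r s t : is_ray r -> 0 <= s -> s <= t -> mdist (r s) (r t) = t - s.
Proof.
move=> hr s0 st; rewrite hr//; last exact: le_trans st.
by rewrite distrC ger0_norm ?subr_ge0.
Qed.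

Lemma segment_geodesic c s t u : geodesic_line c -> s <= t <= u ->
  segment (c s) (c u) (c t).
Proof.
move=> hc /andP[st tu]; rewrite /segment/= !hc.
by rewrite !ler0_norm ?subr_le0//; [lra | exact: le_trans tu].
Qed.

Lemma segment_ray r s t u : is_ray r -> 0 <= s <= t -> t <= u ->
  segment (r s) (r u) (r t).
Proof.
move=> hr /andP[s0 st] tu; have t0 := le_trans s0 st.
have u0 := le_trans t0 tu; rewrite /segment/= !hr//.
by rewrite !ler0_norm ?subr_le0//; [lra | exact: le_trans tu].
Qed.

Lemma geodesic_on_segment c s u z : geodesic_line c -> s <= u ->
  segment (c s) (c u) z -> exists t, s <= t <= u /\ z = c t.
Proof.
move=> hc su hz; have d1 := hc s u; rewrite ler0_norm ?subr_le0// in d1.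
exists (s + mdist (c s) z).
have z0 := mdist_ge0 (c s) z; have z1 := mdist_ge0 z (c u).
have h : s <= s + mdist (c s) z <= u by apply/andP; split; mlra.
split => //; apply: (segment_uniq treeT hz); first exact: segment_geodesic.
by rewrite hc ler0_norm; lra.
Qed.

Lemma geodesic_opp c : geodesic_line c -> geodesic_line (c \o -%R).
Proof. by move=> hc s t /=; rewrite hc opprK addrC distrC. Qed.

Lemma geodesic_ray c : geodesic_line c -> is_ray c.
Proof. by move=> hc s t _ _. Qed.

(** All geodesic lines below come from this construction: lines between two ends,
    lines followed by a curve, axes of loxodromic elements, and lines that connect
    translates of an axis. *)
Lemma limit_line o (a b : nat -> T) :
  (forall M : R, exists N, forall n m, (N <= n)%N -> (N <= m)%N ->
    M <= mdist o (a n) + mdist o (a m) - mdist (a n) (a m)) ->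
  (forall M : R, exists N, forall n m, (N <= n)%N -> (N <= m)%N ->
    M <= mdist o (b n) + mdist o (b m) - mdist (b n) (b m)) ->
  (\forall n \near \oo, segment (a n) (b n) o) ->
  exists c, [/\ geodesic_line c, c 0 = o,
    forall t, 0 <= t -> \forall n \near \oo, segment o (b n) (c t) &
    forall t, 0 <= t -> \forall n \near \oo, segment o (a n) (c (- t))].
Proof.
move=> /limit_ray[ra [ra1 ra2 ra3]] /limit_ray[rb [rb1 rb2 rb3]] ho.
pose c t := if 0 <= t then rb t else ra (- t).
have c0 t : 0 <= t -> c t = rb t by rewrite /c => ->.
have c1 t : 0 <= t -> c (- t) = ra t.
  rewrite /c => t0; case: ifPn => [h|_]; last by rewrite opprK.
  have -> : t = 0 by lra.
  by rewrite oppr0 ra2 rb2.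
have rab s t : 0 <= s -> 0 <= t -> mdist (ra s) (rb t) = s + t.
  move=> s0 t0.
  have [n [[h1 h2] h3]] := filter_ex (filterI (filterI (ra3 _ s0) (rb3 _ t0)) ho).
  have e1 : mdist o (ra s) = s by rewrite -ra2 ra1// sub0r normrN ger0_norm.
  have e2 : mdist o (rb t) = t by rewrite -rb2 rb1// sub0r normrN ger0_norm.
  have := metric_triangle (a n) (ra s) (b n).
  have := metric_triangle (ra s) (rb t) (b n).
  have := metric_triangle (ra s) o (rb t).
  by move=> *; mlra.
exists c; split.
- move=> s t; case: (leP 0 s) => s0; case: (leP 0 t) => t0.
  + by rewrite !c0// rb1.
  + rewrite c0// -(opprK t) c1; last by rewrite oppr_ge0 ltW.
    rewrite metric_sym rab//; last by rewrite oppr_ge0 ltW.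
    by rewrite opprK ger0_norm; lra.
  + rewrite (c0 t)// -(opprK s) c1; last by rewrite oppr_ge0 ltW.
    rewrite rab//; last by rewrite oppr_ge0 ltW.
    by rewrite opprK ler0_norm; lra.
  + rewrite -{1}(opprK s) -{1}(opprK t) !c1; rewrite ?oppr_ge0 1?ltW//.
    by rewrite ra1 ?oppr_ge0 1?ltW// opprK addrC distrC.
- by rewrite c0.
- by move=> t t0; rewrite c0//; exact: rb3.
- by move=> t t0; rewrite c1//; exact: ra3.
Qed.

Lemma asymptotic_refl r : asymptotic r r.
Proof. by exists 0 => t _; rewrite mdistxx. Qed.

Lemma asymptotic_sym r p : asymptotic r p -> asymptotic p r.
Proof. by move=> [C hC]; exists C => t t0; rewrite metric_sym hC. Qed.

Lemma asymptotic_trans r p c : asymptotic r p -> asymptotic p c -> asymptotic r c.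
Proof.
move=> [C hC] [D hD]; exists (C + D) => t t0.
exact: le_trans (metric_triangle _ (p t) _) (lerD (hC _ t0) (hD _ t0)).
Qed.

Lemma bdry_of_ray r : is_ray r -> exists e : bdry T, bdry_set e r.
Proof.
move=> hr; exists (@Bdry _ T _ (ex_intro2 _ _ r hr erefl)) => /=.
by split => //; exact: asymptotic_refl.
Qed.

Lemma bdry_setP (e : bdry T) r : bdry_set e r ->
  bdry_set e = [set p | is_ray p /\ asymptotic r p].
Proof.
case: e => E [r0 hr0 hE] /=; rewrite hE => -[hr h]; apply/seteqP; split => p /= [hp h'].
  by split => //; exact: asymptotic_trans (asymptotic_sym h) h'.
by split => //; exact: asymptotic_trans h h'.
Qed.

Lemma bdry_ray (e : bdry T) r : bdry_set e r -> is_ray r.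
Proof. by move=> h; move: (h); rewrite (bdry_setP h) => -[]. Qed.

Lemma bdry_asymptotic (e : bdry T) r p : bdry_set e r -> is_ray p ->
  asymptotic r p -> bdry_set e p.
Proof. by move=> h hp a; rewrite (bdry_setP h). Qed.

Lemma asymptotic_bdry (e : bdry T) r p : bdry_set e r -> bdry_set e p ->
  asymptotic r p.
Proof. by move=> h; rewrite (bdry_setP h) => -[]. Qed.

Lemma bdry_uniq (e e' : bdry T) r : bdry_set e r -> bdry_set e' r -> e = e'.
Proof.
move=> h h'; have := bdry_setP h; rewrite -(bdry_setP h').
case: e e' {h h'} => E hE [E' hE'] /= e; subst E'.
by rewrite (Prop_irrelevance hE hE').
Qed.

Lemma bdry_has_ray (e : bdry T) : exists r, bdry_set e r.
Proof.
case: e => E [r hr hE] /=; exists r; rewrite hE.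
by split => //; exact: asymptotic_refl.
Qed.

(** Identifies the end of a ray produced by [limit_ray]. *)
Lemma asymptotic_limit r p : is_ray r -> is_ray p ->
  (forall s, 0 <= s -> \forall n \near \oo, segment (p 0) (r n%:R) (p s)) ->
  asymptotic r p.
Proof.
move=> hr hp h; exists (2 * mdist (p 0) (r 0)) => s s0.
have [n [h1 h2]] := filter_ex (filterI (h _ s0) (nbhs_infty_ger s)).
have hs : segment (r 0) (r n%:R) (r s) by apply: segment_ray => //; rewrite lexx.
have ep : mdist (p 0) (p s) = s by rewrite hp// sub0r normrN ger0_norm.
have er : mdist (r 0) (r s) = s by rewrite hr// sub0r normrN ger0_norm.
have t1 := metric_triangle (r 0) (p 0) (r s).
have t2 := metric_triangle (p 0) (r 0) (r s).
have t3 := metric_triangle (r s) (p 0) (p s).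
have z := mdist_ge0 (p 0) (r 0).
case: (segment_union treeT (p 0) hs) => h3; first by have := mdist_ge0 (r s) (p 0); mlra.
rewrite metric_sym (mdist_segment treeT h1 h3).
by have [?|?] := ger0P (mdist (p 0) (p s) - mdist (p 0) (r s)); mlra.
Qed.

Lemma ray_products r o : is_ray r -> forall M : R, exists N, forall n m,
  (N <= n)%N -> (N <= m)%N ->
  M <= mdist o (r n%:R) + mdist o (r m%:R) - mdist (r n%:R) (r m%:R).
Proof.
move=> hr M; have [N hN] := filter_ex (nbhs_infty_ger (M + 2 * mdist o (r 0))).
exists N.+1 => n m Nn Nm.
have n0 : 0 <= n%:R :> R := ler0n _ _; have m0 : 0 <= m%:R :> R := ler0n _ _.
have N1 : N%:R + 1 <= n%:R :> R by rewrite natr1 ler_nat.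
have N2 : N%:R + 1 <= m%:R :> R by rewrite natr1 ler_nat.
have := metric_triangle (r 0) o (r n%:R); have := metric_triangle (r 0) o (r m%:R).
have N0 : 0 <= N%:R :> R := ler0n _ _.
have z := mdist_ge0 o (r 0).
rewrite !hr ?lexx// !sub0r !normrN (ger0_norm n0) (ger0_norm m0).
by have [?|?] := ger0P (n%:R - m%:R : R) => *; mlra.
Qed.

Lemma ray_from (e : bdry T) o : exists r, bdry_set e r /\ r 0 = o.
Proof.
have [r hr] := bdry_has_ray e; have r1 := bdry_ray hr.
have [p [p1 p2 p3]] := limit_ray (ray_products o r1).
exists p; split => //; apply: (bdry_asymptotic hr) => //.
by apply: asymptotic_limit => //; rewrite p2.
Qed.

(** A point of [c] lies on a segment with far ends that are close to [p], and
    [segment_stable] moves these ends to [p]. *)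
Lemma line_stable c p (C : R) : geodesic_line c -> geodesic_line p ->
  (forall M, exists s, M <= s /\ exists u, mdist (c s) (p u) <= C) ->
  (forall M, exists s, s <= - M /\ exists u, mdist (c s) (p u) <= C) ->
  forall t, exists u, c t = p u.
Proof.
move=> hc hp h1 h2 t.
have [s [s1 [u su]]] := h1 (t + C + 1); have [s' [s'1 [u' su']]] := h2 (C + 1 - t).
have C0 : 0 <= C by apply: le_trans su; exact: mdist_ge0.
have ht : segment (c s') (c s) (c t) by apply: segment_geodesic => //; lra.
have hf : segment (p u') (p u) (c t).
  apply: (segment_stable treeT ht); first by rewrite hc ler0_norm; lra.
  by rewrite hc ger0_norm; lra.
by case: (leP u' u) => h; [|move/segment_sym: hf => hf; move/ltW: h => h];
  have [v [_ ->]] := geodesic_on_segment hp h hf; exists v.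
Qed.

Lemma isometry_of_reals (f : R -> R) : (forall s t, `|f s - f t| = `|s - t|) ->
  (forall t, f t = f 0 + t) \/ (forall t, f t = f 0 - t).
Proof.
move=> hf.
have h1 : f 1 = f 0 + 1 \/ f 1 = f 0 - 1.
  have := hf 1 0; rewrite subr0 normr1.
  by have [?|?] := ger0P (f 1 - f 0) => ?; [left|right]; lra.
case: h1 => h1; [left|right] => t; have := hf t 0; have := hf t 1;
  rewrite h1 subr0.
  by have [?|?] := ger0P t; have [?|?] := ger0P (t - 1);
    have [?|?] := ger0P (f t - f 0); have [?|?] := ger0P (f t - (f 0 + 1)); lra.
by have [?|?] := ger0P t; have [?|?] := ger0P (t - 1);
  have [?|?] := ger0P (f t - f 0); have [?|?] := ger0P (f t - (f 0 - 1)); lra.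
Qed.

Lemma geodesic_param c p : geodesic_line c -> geodesic_line p ->
  (forall t, exists u, c t = p u) ->
  exists a, (forall t, c t = p (a + t)) \/ (forall t, c t = p (a - t)).
Proof.
move=> hc hp /choice[f hf]; exists (f 0).
have [h|h] : (forall t, f t = f 0 + t) \/ (forall t, f t = f 0 - t).
  by apply: isometry_of_reals => s t; rewrite -hp -!hf hc.
  by left => t; rewrite hf h.
by right => t; rewrite hf h.
Qed.

(** Two rays from the same origin that represent different ends branch at some
    point, and their parts beyond it form a line. *)
Lemma geodesic_between (e e' : bdry T) : e <> e' ->
  exists c, [/\ geodesic_line c, bdry_set e (c \o -%R) & bdry_set e' c].
Proof.
move=> ee'; have [x _] : [set: T] !=set0 by case: treeT.
have [p [pe p0]] := ray_from e x; have [r [re r0]] := ray_from e' x.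
have hp := bdry_ray pe; have hr := bdry_ray re.
have [M [M0 hM]] : exists M, 0 <= M /\ r M <> p M.
  apply: contrapT => h; apply: ee'; apply: (bdry_uniq pe).
  apply: (bdry_asymptotic re) => //; exists 0 => t t0.
  suff -> : r t = p t by rewrite mdistxx.
  by apply: contrapT => h'; apply: h; exists t.
have [m [m1 m2 m3]] := median treeT x (r M) (p M).
have dr : mdist x (r M) = M by rewrite -r0 hr ?lexx// sub0r normrN ger0_norm.
have dp : mdist x (p M) = M by rewrite -p0 hp ?lexx// sub0r normrN ger0_norm.
have mr : m != r M.
  apply/eqP => e0; apply: hM; rewrite -e0; apply: (segment_uniq treeT m2).
    exact: segment_right.
  by rewrite e0 dr dp.
have mp : m != p M.
  apply/eqP => e0; apply: hM; rewrite -e0; apply/esym.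
  apply: (segment_uniq treeT m1); first exact: segment_right.
  by rewrite e0 dr dp.
have hm : \forall n \near \oo, segment (p n%:R) (r n%:R) m.
  near=> n; have Mn : M <= n%:R by near: n; exact: nbhs_infty_ger.
  have s1 : segment x (r n%:R) (r M) by rewrite -r0; apply: segment_ray; rewrite ?lexx.
  have s2 : segment x (p n%:R) (p M) by rewrite -p0; apply: segment_ray; rewrite ?lexx.
  have [_ s3] := segment_trans s1 m1; have [_ s4] := segment_trans s2 m2.
  have [s5 _] := segment_concat treeT mr (segment_sym m3) s3.
  have [s6 _] := segment_concat treeT mp (segment_sym s5) s4.
  exact: segment_sym.
have [c [c1 c2 c3 c4]] := limit_line (ray_products m hp) (ray_products m hr) hm.
exists c; split => //.
  apply: (bdry_asymptotic pe); first by apply: geodesic_ray; exact: geodesic_opp.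
  apply: asymptotic_limit => //; first by apply: geodesic_ray; exact: geodesic_opp.
  by move=> t t0; rewrite /= oppr0 c2; exact: c4.
apply: (bdry_asymptotic re); first exact: geodesic_ray.
apply: asymptotic_limit => // t t0; rewrite c2; exact: c3.
Unshelve. all: by end_near. Qed.

End Rays.

(** * The observers' topology *)

Lemma near_pinftyP (R : realType) (P : R -> Prop) :
  (\forall t \near +oo, P t) <-> exists t0, forall t, t0 <= t -> P t.
Proof.
split=> [[M [_ h]]|[t0 h]].
  by exists (M + 1) => t ht; apply: h; lra.
by exists t0; split; [exact: num_real | move=> t /ltW; exact: h].
Qed.

Section Observers.
Variables (R : realType) (T : metricType R).
Hypothesis treeT : real_tree T.
Implicit Types (x y z : T) (e : bdry T) (a b : obs T) (c p r : R -> T) (s t u M : R).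

Lemma open_half_tree x y : y != x -> open (half_tree x y).
Proof.
move=> yx; exists [set half_tree x y] => [A /= ->|]; last by rewrite bigcup_set1.
by apply: (@finI_from1 _ _ (@half_trees R T) id); exists x, y.
Qed.

(** Half-trees being a subbasis, they suffice to test convergence. *)
Lemma obs_cvg (F : set_system (obs T)) a : Filter F ->
  (forall x y, y != x -> half_tree x y a -> F (half_tree x y)) -> F --> a.
Proof.
move=> FF h A; rewrite nbhsE => -[B [[D hD <-] [C DC Ca]] BA].
apply: filterS BA _; apply: (@filterS _ _ _ C); first by move=> z Cz; exists C.
have [S hS eC] := hD _ DC; rewrite -eC /bigcap.
apply: filter_bigI => A' A'S; have aA' : A' a.
  by move: Ca; rewrite -eC; exact.
by have := hS _ A'S; rewrite inE => -[x [y [yx eA']]]; subst A'; exact: h.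
Qed.

Lemma half_tree_far c e x y : geodesic_line c -> bdry_set e c -> y != x ->
  half_tree x y (inr e) ->
  exists M, 0 < M /\ forall z, segment (c 0) z (c M) -> direction x y z.
Proof.
move=> hc ec yx /(_ c ec)/near_pinftyP[t0 ht].
have z0 := mdist_ge0 (c 0) x.
pose M := Num.max t0 (mdist (c 0) x + 1).
have M1 : mdist (c 0) x + 1 <= M by rewrite le_max lexx orbT.
have M2 : t0 <= M by rewrite le_max lexx.
exists M; split => [|z hz]; first by lra.
apply/(directionP treeT) => // h1.
have /(directionP treeT _ yx) h2 := ht M M2.
have [//|h3] := segment_union treeT (c M) h1.
have h4 := metric_triangle (c 0) x z.
have dM : mdist (c 0) (c M) = M by rewrite hc sub0r normrN ger0_norm; lra.
by have := mdist_ge0 (c M) x; mlra.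
Qed.

Lemma half_tree_end c e s u : geodesic_line c -> bdry_set e c -> s < u ->
  half_tree (c s) (c u) (inr e).
Proof.
move=> hc ec su r er; have [C hC] := asymptotic_bdry ec er.
have us : c u != c s by rewrite -mdist_gt0 hc gtr0_norm; lra.
apply/near_pinftyP; exists (`|u| + `|s| + C + 1) => t ht.
have ? := ler_norm s; have ? := ler_norm u.
have ? := normr_ge0 s; have ? := normr_ge0 u.
have C0 : 0 <= C by apply: le_trans (hC 0 (lexx _)); exact: mdist_ge0.
apply/(directionP treeT) => // h1.
have d1 : mdist (c s) (c t) = t - s by rewrite hc ler0_norm; lra.
have d2 : mdist (c u) (c t) = t - u by rewrite hc ler0_norm; lra.
have d3 : mdist (c u) (c s) = u - s by rewrite hc gtr0_norm; lra.
have d4 := hC t ltac:(lra).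
case: (segment_union treeT (c t) h1) => h2; first by mlra.
have := mdist_ge0 (c s) (r t); mlra.
Qed.

(** Closeness to a line suffices for convergence to its end, because half-trees
    absorb bounded perturbations of points that are far out. *)
Lemma cvg_to_end c e p (C : R) : geodesic_line c -> bdry_set e c ->
  (forall M, exists t0, forall t, t0 <= t -> exists s, M <= s /\
     mdist (p t) (c s) <= C) ->
  (inl (p t) : obs T) @[t --> +oo] --> (inr e : obs T).
Proof.
move=> hc ec hp; apply: obs_cvg => x y yx /(half_tree_far hc ec yx)[M [M0 hM]].
have [t0 ht] := hp (M + C + 1).
suff : \forall t \near +oo, half_tree x y (inl (p t)) by [].
apply/near_pinftyP; exists t0 => t /ht[s [s1 s2]]; apply: hM.
have C0 : 0 <= C by apply: le_trans s2; exact: mdist_ge0.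
have sM : segment (c 0) (c s) (c M) by apply: segment_geodesic => //; lra.
apply: (segment_stable treeT sM); rewrite ?mdistxx hc.
  by rewrite sub0r normrN ger0_norm; lra.
by rewrite metric_sym ger0_norm; lra.
Qed.

(** An end and any other point are separated by disjoint half-trees: the two sides
    of a point on the ray or line that joins them. *)
Lemma end_separated e b : b <> inr e -> exists x y x' y',
  [/\ y != x, y' != x', half_tree x y (inr e), half_tree x' y' b &
    forall z, direction x y z -> direction x' y' z -> False].
Proof.
case: b => [v _|e' ee'].
  have [r [er r0]] := ray_from treeT e v; have hr := bdry_ray er.
  have d01 : mdist (r 0) (r 1) = 1 by rewrite (ray_dist hr); lra.
  have d12 : mdist (r 1) (r 2) = 1 by rewrite (ray_dist hr); lra.
  have d02 : mdist (r 0) (r 2) = 2 by rewrite (ray_dist hr); lra.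
  have n1 : r 2 != r 1 by rewrite -mdist_gt0 metric_sym d12 ltr01.
  have n2 : r 0 != r 1 by rewrite -mdist_gt0 d01 ltr01.
  exists (r 1), (r 2), (r 1), (r 0); split => //.
  - move=> p ep; have [C hC] := asymptotic_bdry er ep.
    have C0 : 0 <= C by apply: le_trans (hC 0 (lexx _)); exact: mdist_ge0.
    apply/near_pinftyP; exists (C + 3) => t ht; apply/(directionP treeT) => // h1.
    have t0 : 0 <= t by lra.
    have d1 : mdist (r 1) (r t) = t - 1 by rewrite (ray_dist hr); lra.
    have d2 : mdist (r 2) (r t) = t - 2 by rewrite (ray_dist hr); lra.
    have d4 := hC t t0.
    case: (segment_union treeT (r t) h1) => h2; first by mlra.
    have := mdist_ge0 (r 1) (p t); mlra.
  - rewrite /half_tree/= -r0; apply/(directionP treeT) => // h; have := segment_eq h.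
    by move/eqP; rewrite eq_sym (negbTE n2).
  - move=> p /(directionP treeT _ n1) h1 /(directionP treeT _ n2) h2.
    have h3 : segment (r 2) (r 0) (r 1) by mlra.
    by case: (segment_union treeT p h3) => // /segment_sym.
have [|c [hc c1 c2]] := @geodesic_between _ _ treeT e' e.
  by move=> h; apply: ee'; rewrite h.
have d1 : mdist (c 0) (c 1) = 1 by rewrite (geodesic_dist hc); lra.
have d2 : mdist (c 0) (c (-1)) = 1 by rewrite metric_sym (geodesic_dist hc); lra.
have d3 : mdist (c 1) (c (-1)) = 2 by rewrite metric_sym (geodesic_dist hc); lra.
have n1 : c 1 != c 0 by rewrite -mdist_gt0 metric_sym d1 ltr01.
have n2 : c (-1) != c 0 by rewrite -mdist_gt0 metric_sym d2 ltr01.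
exists (c 0), (c 1), (c 0), (c (-1)); split => //.
- exact: half_tree_end.
- have := @half_tree_end _ _ 0 1 (geodesic_opp hc) c1 ltr01.
  by rewrite /= oppr0.
- move=> p /(directionP treeT _ n1) h1 /(directionP treeT _ n2) h2.
  have h3 : segment (c 1) (c (-1)) (c 0) by mlra.
  by case: (segment_union treeT p h3) => // /segment_sym.
Qed.

Lemma end_limit_uniq (p : R -> T) e b :
  (inl (p t) : obs T) @[t --> +oo] --> (inr e : obs T) ->
  (inl (p t) : obs T) @[t --> +oo] --> b -> b = inr e.
Proof.
move=> h1 h2; apply: contrapT => /end_separated[x [y [x' [y' [n1 n2 e1 e2 h]]]]].
have /near_pinftyP[t1 H1] := h1 _ (open_nbhs_nbhs (conj (open_half_tree n1) e1)).
have /near_pinftyP[t2 H2] := h2 _ (open_nbhs_nbhs (conj (open_half_tree n2) e2)).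
apply: (h (p (Num.max t1 t2))); first by apply: H1; rewrite le_max lexx.
by apply: H2; rewrite le_max lexx orbT.
Qed.

(** The ends that agree with that of a line beyond one of its points form a
    neighbourhood basis, among ends, of the end of that line. *)
Lemma nbhs_end c e (B : set (obs T)) : geodesic_line c -> bdry_set e c ->
  nbhs (inr e : obs T) B -> exists M, 0 < M /\ forall e',
    (forall r, bdry_set e' r -> \forall t \near +oo, segment (c 0) (r t) (c M)) ->
    B (inr e').
Proof.
move=> hc ec hB.
pose E M : set (obs T) := [set a | match a with inl p => segment (c 0) p (c M)
  | inr e' => forall r, bdry_set e' r ->
      \forall t \near +oo, segment (c 0) (r t) (c M) end].
pose F : set_system (obs T) := filter_from [set M : R | 0 < M] E.
have EM M N : 0 < M -> M <= N -> E N `<=` E M.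
  move=> M0 MN; have h : segment (c 0) (c N) (c M) by apply: segment_geodesic => //; lra.
  move=> [p|e'] /= hN; first by have [] := segment_trans hN h.
  move=> r er; apply: filterS (hN r er) => t ht.
  by have [] := segment_trans ht h.
have FF : Filter F.
  apply: filter_from_filter; first by exists 1 => /=.
  move=> M N /= M0 N0; exists (Num.max M N); first by rewrite /= lt_max M0.
  move=> a ha; split; apply: EM ha => //; by rewrite le_max lexx ?orbT.
have : F --> (inr e : obs T).
  apply: obs_cvg => x y yx /(half_tree_far hc ec yx)[M [M0 hM]].
  exists M => // -[p|e'] /=; first exact: hM.
  by move=> h r er; apply: filterS (h r er) => t; exact: hM.
by move=> /(_ _ hB)[M M0 hM]; exists M; split => // e' he'; apply: hM.
Qed.

End Observers.

(** * Curves with bounded backtracking *)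

Section Shadow.
Variables (R : realType) (T : metricType R).
Hypothesis treeT : real_tree T.
Implicit Types (x y z o : T) (c q : R -> T) (C s t u M : R).

Lemma segment_convex a b x y z : segment a b x -> segment a b y ->
  segment x y z -> segment a b z.
Proof.
move=> hx hy hz; have [h|/ltW h] := leP (mdist a x) (mdist a y).
  have [h1 _] := segment_order treeT hx hy h.
  have [h2 _] := segment_trans (segment_sym h1) (segment_sym hz).
  by have [] := segment_trans hy (segment_sym h2).
have [h1 _] := segment_order treeT hy hx h.
have [h2 _] := segment_trans (segment_sym h1) hz.
by have [] := segment_trans hx (segment_sym h2).
Qed.

Lemma segment_const_ge0 q C :
  (forall s t u, s <= t -> t <= u ->
     mdist (q s) (q t) + mdist (q t) (q u) <= mdist (q s) (q u) + 2 * C) ->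
  0 <= C.
Proof.
by move=> /(_ 0 0 0 (lexx _) (lexx _)); rewrite mdistxx => h; lra.
Qed.

(** One half of the curve follows one half of the line.  The second bound says that
    it advances along the line as it moves away from its origin. *)
Lemma shadow_side q c C :
  (forall t u, 0 <= t -> t <= u ->
     mdist (q 0) (q t) + mdist (q t) (q u) <= mdist (q 0) (q u) + 2 * C) ->
  geodesic_line c -> mdist (q 0) (c 0) <= C ->
  (forall t, 0 <= t -> \forall n \near \oo, segment (c 0) (q n%:R) (c t)) ->
  forall t, 0 <= t -> exists s, mdist (q t) (c s) <= 4 * C /\
    mdist (q 0) (q t) - 4 * C <= s.
Proof.
move=> hq hc h0 hn t t0.
have C0 : 0 <= C by apply: le_trans h0; exact: mdist_ge0.
have [hd|hd] := leP (mdist (q 0) (q t)) (2 * C).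
  exists 0; split; last by lra.
  by have := metric_triangle (q t) (q 0) (c 0); mlra.
pose S := 2 * C + mdist (q 0) (q t).
have S0 : 0 <= S by rewrite /S; lra.
have [n [n1 n2]] := filter_ex (filterI (hn S S0) (nbhs_infty_ger t)).
have [x [x1 x2 x3]] := median treeT (q 0) (q n%:R) (q t).
have b := hq t n%:R t0 n2.
have dx : mdist x (q t) <= C by mlra.
have tx := metric_triangle (q 0) x (q t).
have [h1|h1] := segment_union treeT (c 0) x1.
  by exfalso; have := mdist_ge0 x (c 0); mlra.
have t1 := metric_triangle (q 0) (c 0) x; have t2 := metric_triangle (c 0) (q 0) x.
have z := mdist_ge0 (c 0) x; have z2 := mdist_ge0 x (q t).
have xS : mdist (c 0) x <= S by rewrite /S; mlra.
exists (mdist (c 0) x); split; last by mlra.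
have e : c (mdist (c 0) x) = x.
  apply: (@segment_uniq _ _ treeT (c 0) (q n%:R)) => //.
    have [] // := segment_trans n1 (_ : segment (c 0) (c S) (c (mdist (c 0) x))).
    by apply: segment_geodesic => //; rewrite z.
  by rewrite (geodesic_dist hc) ?subr0.
by rewrite e; mlra.
Qed.

Lemma shadow_products q C o :
  (forall t u, 0 <= t -> t <= u ->
     mdist (q 0) (q t) + mdist (q t) (q u) <= mdist (q 0) (q u) + 2 * C) ->
  (forall M, exists t0, forall t, t0 <= t -> M <= mdist (q 0) (q t)) ->
  forall M : R, exists N, forall n m, (N <= n)%N -> (N <= m)%N ->
    M <= mdist o (q n%:R) + mdist o (q m%:R) - mdist (q n%:R) (q m%:R).
Proof.
move=> hq hM M; have C0 : 0 <= C.
  by have := hq 0 0 (lexx _) (lexx _); rewrite mdistxx; lra.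
have z := mdist_ge0 o (q 0); have [t0 ht] := hM (`|M| + 2 * C + 2 * mdist o (q 0)).
have ? := ler_norm M; have ? := normr_ge0 M.
have [N hN] := filter_ex (nbhs_infty_ger t0); exists N => n m Nn Nm.
wlog nm : n m Nn Nm / (n <= m)%N.
  move=> W; have [h|/ltnW h] := leqP n m; first exact: W.
  by have := W _ _ Nm Nn h; mlra.
have n0 : t0 <= n%:R by apply: le_trans hN _; rewrite ler_nat.
have b := hq n%:R m%:R (ler0n _ _) ltac:(by rewrite ler_nat).
have h1 := ht _ n0.
have := metric_triangle (q 0) o (q n%:R); have := metric_triangle (q 0) o (q m%:R).
by mlra.
Qed.

(** Bounded backtracking and properness suffice for a curve to follow a geodesic
    line; the curve [q] will be the image of a geodesic line under a
    topological representative. *)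
Lemma quasi_line_shadow q C :
  (forall s t u, s <= t -> t <= u ->
     mdist (q s) (q t) + mdist (q t) (q u) <= mdist (q s) (q u) + 2 * C) ->
  (forall M, exists t0, forall t, t0 <= t -> M <= mdist (q 0) (q t)) ->
  (forall M, exists t0, forall t, t0 <= t -> M <= mdist (q 0) (q (- t))) ->
  exists c, [/\ geodesic_line c,
    forall t, 0 <= t -> exists s, mdist (q t) (c s) <= 4 * C /\
      mdist (q 0) (q t) - 4 * C <= s &
    forall t, 0 <= t -> exists s, mdist (q (- t)) (c (- s)) <= 4 * C /\
      mdist (q 0) (q (- t)) - 4 * C <= s].
Proof.
move=> hq h1 h2; have C0 := segment_const_ge0 hq.
have hq1 t u : 0 <= t -> t <= u ->
    mdist (q 0) (q t) + mdist (q t) (q u) <= mdist (q 0) (q u) + 2 * C.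
  exact: hq.
have hq2 t u : 0 <= t -> t <= u -> mdist (q 0) (q (- t)) +
    mdist (q (- t)) (q (- u)) <= mdist (q 0) (q (- u)) + 2 * C.
  by move=> t0 tu; have := hq (- u) (- t) 0 ltac:(lra) ltac:(lra); mlra.
have [t1 ht1] := h1 (3 * C + 1); have [t2 ht2] := h2 (3 * C + 1).
have [m [[m0 m1] m2]] := filter_ex (filterI (filterI (nbhs_infty_ger (0 : R))
  (nbhs_infty_ger t1)) (nbhs_infty_ger t2)).
have {}ht1 := ht1 _ m1; have {}ht2 := ht2 _ m2.
(* [o] stays away from the ends of the segment between [q (- m)] and [q m], and so
   lies on all the longer ones. *)
have [o [o1 o2 o3]] := median treeT (q (- m%:R)) (q m%:R) (q 0).
have dqo : mdist (q 0) o <= C.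
  by have := hq (- m%:R) 0 m%:R ltac:(lra) m0; mlra.
have tr1 := metric_triangle (q 0) o (q m%:R).
have tr2 := metric_triangle (q 0) o (q (- m%:R)).
have ho : \forall n \near \oo, segment (q (- n%:R)) (q n%:R) o.
  near=> n; have mn : m%:R <= n%:R :> R.
    by rewrite ler_nat; near: n; exact: nbhs_infty_ge.
  have [x [x1 x2 x3]] := median treeT (q (- n%:R)) (q n%:R) (q m%:R).
  have [y [y1 y2 y3]] := median treeT (q (- n%:R)) (q n%:R) (q (- m%:R)).
  have bx := hq (- n%:R) m%:R n%:R ltac:(lra) mn.
  have by_ := hq (- n%:R) (- m%:R) n%:R ltac:(lra) ltac:(lra).
  apply: (segment_convex y1 x1); apply: (segment_stable treeT o1).
    by clear x1 x2 x3; mlra.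
  by clear y1 y2 y3; mlra.
have p2 := @shadow_products (q \o -%R) C o.
rewrite /= oppr0 in p2.
have [c [c1 c2 c3 c4]] := limit_line treeT (p2 hq2 h2)
  (shadow_products o hq1 h1) ho.
exists c; split => //.
  by apply: shadow_side => //; rewrite c2.
move=> t t0; have := @shadow_side (q \o -%R) (c \o -%R) C.
rewrite /= !oppr0 c2; apply => //; exact: geodesic_opp.
Unshelve. all: by end_near. Qed.

End Shadow.

(** * Bi-infinite lines as geodesic lines *)

Section Lines.
Variables (R : realType) (G : groupType) (T : gtree R G).
Implicit Types (x y z : T) (l : line T) (c : R -> T) (e : bdry T) (C s t M : R).

Lemma gtree_tree : real_tree T.
Proof. by case: (gtree_simplicial T). Qed.

Local Notation treeT := gtree_tree.

Lemma line_ext l l' : ends l = ends l' -> l = l'.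
Proof.
case: l l' => E h [E' h'] /= e; subst E'.
by rewrite (Prop_irrelevance h h').
Qed.

Lemma set2_inj (X : Type) (a b a' b' : X) : [set a; b] = [set a'; b'] ->
  (a = a' /\ b = b') \/ (a = b' /\ b = a').
Proof.
move=> E.
have ha : [set a'; b'] a by rewrite -E; left.
have hb : [set a'; b'] b by rewrite -E; right.
have ha' : [set a; b] a' by rewrite E; left.
have hb' : [set a; b] b' by rewrite E; right.
by case: ha hb ha' hb' => -> [] -> [] h1 [] h2; auto.
Qed.

Definition spans c l := geodesic_line c /\ exists e e' : bdry T,
  [/\ ends l = [set inr e; inr e'], bdry_set e (c \o -%R) & bdry_set e' c].

Lemma spans_biinfinite c l : spans c l -> biinfinite l.
Proof.
by move=> [_ [e [e' [E _ _]]]] a; rewrite E => -[] ->; [exists e|exists e'].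
Qed.

Lemma biinfinite_spans l : biinfinite l -> exists c, spans c l.
Proof.
move=> hl; have [a [b [_ _ ab E]]] := endsP l.
have [e ea] : exists e : bdry T, a = inr e by apply: hl; rewrite E; left.
have [e' eb] : exists e : bdry T, b = inr e by apply: hl; rewrite E; right.
subst a b; have [|c [c1 c2 c3]] := @geodesic_between _ _ treeT e e'.
  by move=> h; apply: ab; rewrite h.
by exists c; split => //; exists e, e'.
Qed.

Lemma geodesic_line_spans c : geodesic_line c -> exists l, spans c l.
Proof.
move=> hc.
have [e he] := bdry_of_ray (geodesic_ray (geodesic_opp hc)).
have [e' he'] := bdry_of_ray (geodesic_ray hc).
have ee : (inr e : obs T) <> inr e'.
  move=> [h]; subst e'; have [C hC] := asymptotic_bdry he he'.
  have C0 : 0 <= C by apply: le_trans (hC 0 (lexx _)); exact: mdist_ge0.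
  have := hC (C + 1) ltac:(lra); rewrite /= hc ler0_norm; lra.
pose E : set (obs T) := [set inr e; inr e'].
have hE : exists a b, [/\ bd a, bd b, a <> b & E = [set a; b]].
  by exists (inr e), (inr e').
by exists (Line hE); split => //; exists e, e'.
Qed.

Lemma spans_opp c l : spans c l -> spans (c \o -%R) l.
Proof.
move=> [hc [e [e' [E h h']]]]; split; first exact: geodesic_opp.
exists e', e; split => //; first by rewrite E setUC.
have -> : (c \o -%R) \o -%R = c by apply/funext => t /=; rewrite opprK.
exact: h'.
Qed.

Lemma geodesic_asymptotic_incl c p : geodesic_line c -> geodesic_line p ->
  asymptotic c p -> asymptotic (c \o -%R) (p \o -%R) ->
  forall t, exists u, c t = p u.
Proof.
move=> hc hp [C hC] [D hD]; apply: (@line_stable _ _ treeT _ _ (Num.max C D)) => // M.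
  exists `|M|; split; first exact: ler_norm.
  exists `|M|; apply: le_trans (hC _ (normr_ge0 M)) _; by rewrite le_max lexx.
exists (- `|M|); split; first by rewrite lerN2 ler_norm.
exists (- `|M|); apply: le_trans (hD _ (normr_ge0 M)) _.
by rewrite le_max lexx orbT.
Qed.

Lemma tight_path_spans c l : spans c l -> tight_path l = range c.
Proof.
move=> [hc [e [e' [E h h']]]]; apply/seteqP; split => [x|_ [t _ <-]]; last first.
  exists (inr e), (inr e'); split => //; exists c; split => //.
  by exists t.
move=> [a [b [E']]]; rewrite E' in E.
have [[ea eb]|[ea eb]] := set2_inj E; subst a b; move=> [p [hp h1 h2 [t ->]]].
  have [u ->] := geodesic_asymptotic_incl hp hc (asymptotic_bdry h2 h')
    (asymptotic_bdry h1 h) t; by exists u.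
have h3 : asymptotic (p \o -%R) ((c \o -%R) \o -%R).
  have -> : (c \o -%R) \o -%R = c by apply/funext => s /=; rewrite opprK.
  exact: asymptotic_bdry h1 h'.
have [u ->] := geodesic_asymptotic_incl hp (geodesic_opp hc)
  (asymptotic_bdry h2 h) h3 t.
by exists (- u).
Qed.

Lemma spans_inj c c' l l' : spans c l -> spans c' l' ->
  (forall t, exists u, c t = c' u) -> l = l'.
Proof.
move=> sl sl' h; have [hc' _] := sl'; have [hc _] := sl.
have [a [ha|ha]] := geodesic_param hc hc' h.
  move: sl sl' => [_ [e [e' [E h1 h2]]]] [_ [f [f' [F k1 k2]]]].
  apply: line_ext; rewrite E F; congr [set inr _; inr _].
    apply: (bdry_uniq h1); apply: (bdry_asymptotic k1).
      exact: geodesic_ray (geodesic_opp hc).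
    by exists `|a| => t t0; rewrite /= ha hc'; have [?|?] := ger0P a;
      rewrite ler_norml; apply/andP; split; lra.
  apply: (bdry_uniq h2); apply: (bdry_asymptotic k2); first exact: geodesic_ray.
  by exists `|a| => t t0; rewrite /= ha hc'; have [?|?] := ger0P a;
    rewrite ler_norml; apply/andP; split; lra.
move: sl sl' => [_ [e [e' [E h1 h2]]]] [_ [f [f' [F k1 k2]]]].
apply: line_ext; rewrite E F setUC; congr [set inr _; inr _].
  apply: (bdry_uniq h2); apply: (bdry_asymptotic k1); first exact: geodesic_ray.
  by exists `|a| => t t0; rewrite /= ha hc'; have [?|?] := ger0P a;
    rewrite ler_norml; apply/andP; split; lra.
apply: (bdry_uniq h1); apply: (bdry_asymptotic k2).
  exact: geodesic_ray (geodesic_opp hc).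
by exists `|a| => t t0; rewrite /= ha hc'; have [?|?] := ger0P a;
  rewrite ler_norml; apply/andP; split; lra.
Qed.

Lemma biinfinite_inj l l' : biinfinite l -> biinfinite l' ->
  tight_path l `<=` tight_path l' -> l = l'.
Proof.
move=> /biinfinite_spans[c sc] /biinfinite_spans[c' sc'].
rewrite (tight_path_spans sc) (tight_path_spans sc') => h.
apply: (spans_inj sc sc') => t.
by have [u _ <-] := h (c t) (ex_intro2 _ _ t I erefl); exists u.
Qed.

Lemma segment_tight_path l x y : biinfinite l -> tight_path l x ->
  tight_path l y -> segment x y `<=` tight_path l.
Proof.
move=> /biinfinite_spans[c sc]; rewrite (tight_path_spans sc); have [hc _] := sc.
move=> [s _ <-] [t _ <-] z hz; have [st|/ltW st] := leP s t.
  by have [u [_ ->]] := geodesic_on_segment treeT hc st hz; exists u.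
by have [u [_ ->]] := geodesic_on_segment treeT hc st (segment_sym hz); exists u.
Qed.

Lemma extends_end (f : T -> T) c c' e e' C : is_lipschitz f ->
  bdry_set e c -> geodesic_line c' -> bdry_set e' c' ->
  (forall M, exists t0, forall t, t0 <= t -> exists s, M <= s /\
     mdist (f (c t)) (c' s) <= C) ->
  extends f (inr e) (inr e').
Proof.
move=> [K hK] ec hc' ec' h r er; have [D hD] := asymptotic_bdry ec er.
apply: (@cvg_to_end _ _ treeT _ _ _ (C + `|K| * D) hc' ec') => M.
have [t0 ht] := h M; exists (Num.max t0 0) => t; rewrite ge_max => /andP[t1 t2].
have [s [s1 s2]] := ht t t1; exists s; split => //.
have h1 := metric_triangle (f (r t)) (f (c t)) (c' s).
have h2 := hK (c t) (r t).
have h3 : K * mdist (c t) (r t) <= `|K| * D.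
  apply: (@le_trans _ _ (`|K| * mdist (c t) (r t))).
    by rewrite ler_wpM2r ?mdist_ge0 ?ler_norm.
  by rewrite ler_wpM2l ?normr_ge0// hD.
mlra.
Qed.

(** Criterion to recognise the image of a line: the extension to the boundary need
    only be known up to bounded error. *)
Lemma line_map_spans (f : T -> T) c c' l l' C : is_lipschitz f ->
  spans c l -> spans c' l' ->
  (forall M, exists t0, forall t, t0 <= t -> exists s, M <= s /\
     mdist (f (c t)) (c' s) <= C) ->
  (forall M, exists t0, forall t, t0 <= t -> exists s, M <= s /\
     mdist (f (c (- t))) (c' (- s)) <= C) ->
  line_map f l l'.
Proof.
move=> hf [hc [e [e' [E h1 h2]]]] [hc' [a [a' [E' k1 k2]]]] H1 H2.
exists (inr e), (inr e'), (inr a), (inr a'); split => //.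
  exact: (extends_end (C := C) hf h1 (geodesic_opp hc') k1).
exact: (extends_end (C := C) hf h2 hc' k2).
Qed.

Lemma extends_uniq (f : T -> T) e e' b : extends f (inr e) (inr e') ->
  extends f (inr e) b -> b = inr e'.
Proof.
move=> h1 h2; have [r er] := bdry_has_ray e.
exact: (end_limit_uniq treeT (h1 r er) (h2 r er)).
Qed.

Lemma line_map_uniq (f : T -> T) l l1 l2 : biinfinite l -> biinfinite l1 ->
  line_map f l l1 -> line_map f l l2 -> l2 = l1.
Proof.
move=> bl bl1 [a [b [a1 [b1 [E E1 ha hb]]]]] [a' [b' [a2 [b2 [E' E2 ha' hb']]]]].
have [e ea] : exists e : bdry T, a = inr e by apply: bl; rewrite E; left.
have [e' eb] : exists e : bdry T, b = inr e by apply: bl; rewrite E; right.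
have [f1 ea1] : exists e : bdry T, a1 = inr e by apply: bl1; rewrite E1; left.
have [f2 eb1] : exists e : bdry T, b1 = inr e by apply: bl1; rewrite E1; right.
subst a b a1 b1; apply: line_ext; rewrite E1 E2.
rewrite E in E'; have [[? ?]|[? ?]] := set2_inj E'; subst a' b'.
  by rewrite (extends_uniq ha ha') (extends_uniq hb hb').
by rewrite (extends_uniq ha hb') (extends_uniq hb ha') setUC.
Qed.

Lemma act_lipschitz (g : G) : is_lipschitz (@act R G T g).
Proof. by exists 1 => x y; rewrite act_isom mul1r. Qed.

Lemma geodesic_act (g : G) c : geodesic_line c -> geodesic_line (act g \o c).
Proof. by move=> hc s t /=; rewrite act_isom hc. Qed.

Lemma actK (g : G) x : act g^-1%g (act g x) = x.
Proof. by rewrite -actM mulVg act1. Qed.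

Lemma actVK (g : G) x : act g (act g^-1%g x) = x.
Proof. by rewrite -actM mulgV act1. Qed.

Lemma line_map_act (g : G) c l l' : spans c l -> spans (act g \o c) l' ->
  line_map (act g) l l'.
Proof.
move=> sl sl'; apply: (@line_map_spans _ _ _ _ _ 0 (@act_lipschitz g) sl sl') => M.
  by exists M => t Mt; exists t; rewrite mdistxx.
by exists M => t Mt; exists t; rewrite mdistxx.
Qed.

Lemma line_orbitP l l' : biinfinite l -> line_orbit l l' <->
  biinfinite l' /\ exists g, tight_path l' = act g @` tight_path l.
Proof.
move=> bl; have [c sc] := biinfinite_spans bl; have [hc _] := sc.
split=> [[g hg]|[bl' [g hg]]].
  have [l1 s1] := geodesic_line_spans (geodesic_act g hc).
  have -> : l' = l1.
    exact: (line_map_uniq bl (spans_biinfinite s1) (line_map_act sc s1) hg).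
  split; first exact: spans_biinfinite s1.
  by exists g; rewrite (tight_path_spans sc) (tight_path_spans s1) image_comp.
exists g; have [l1 s1] := geodesic_line_spans (geodesic_act g hc).
have -> : l' = l1.
  apply/esym/biinfinite_inj => //; first exact: spans_biinfinite s1.
  by rewrite hg (tight_path_spans sc) (tight_path_spans s1) image_comp.
exact: (line_map_act sc s1).
Qed.

Lemma line_orbit_refl l : biinfinite l -> line_orbit l l.
Proof.
move=> bl; apply/line_orbitP => //; split => //; exists 1%g.
rewrite (_ : act 1%g = id) ?image_id//; apply/funext => x; exact: act1.
Qed.

Lemma biinfinite_translate (g : G) l : biinfinite l ->
  exists l', biinfinite l' /\ tight_path l' = act g @` tight_path l.
Proof.
move=> /biinfinite_spans[c sc]; have [hc _] := sc.
have [l1 s1] := geodesic_line_spans (geodesic_act g hc).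
exists l1; split; first exact: spans_biinfinite s1.
by rewrite (tight_path_spans sc) (tight_path_spans s1) image_comp.
Qed.

Lemma line_orbit_sym l l' : biinfinite l -> line_orbit l l' -> line_orbit l' l.
Proof.
move=> bl /(line_orbitP _ bl)[bl' [g hg]]; apply/line_orbitP => //; split => //.
exists g^-1%g; rewrite hg image_comp (_ : act _ \o act _ = id) ?image_id//.
by apply/funext => x /=; rewrite actK.
Qed.

End Lines.

(** * Neighbourhoods of bi-infinite lines *)

Section LineTopology.
Variables (R : realType) (G : groupType) (T : gtree R G).
Implicit Types (x y z : T) (l : line T) (c r : R -> T) (e : bdry T) (s t M N : R).

Local Notation treeT := (@gtree_tree R G T).

Lemma line_end_beyond c p e s M N : geodesic_line c -> geodesic_line p ->
  c 0 = p s -> c M = p (s + M) -> 0 < N -> N <= M -> bdry_set e p ->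
  forall r, bdry_set e r -> \forall t \near +oo, segment (c 0) (r t) (c N).
Proof.
move=> hc hp e0 eM N0 NM ep r er; have [C hC] := asymptotic_bdry ep er.
have C0 : 0 <= C by apply: le_trans (hC 0 (lexx _)); exact: mdist_ge0.
apply/near_pinftyP; exists (`|s| + M + C + 1) => t ht.
have ? := ler_norm s; have ? := normr_ge0 s.
have h1 : segment (c 0) (p t) (c M).
  by rewrite e0 eM; apply: segment_geodesic => //; lra.
have h2 : segment (c 0) (c M) (c N) by apply: segment_geodesic => //; lra.
have [h3 h4] := segment_trans h1 h2.
have d1 : mdist (c 0) (c N) = N by rewrite (geodesic_dist hc); lra.
have d2 : mdist (c M) (p t) = t - s - M.
  by rewrite eM (geodesic_dist hp); lra.
have d3 := hC t ltac:(lra).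
apply: (segment_stable treeT h3); first by rewrite mdistxx d1.
have := mdist_ge0 (c N) (c M).
have h6 : segment (p t) (c N) (c M).
  by have [_] := segment_order treeT h3 h1 ltac:(rewrite d1 (geodesic_dist hc); lra); exact: segment_sym.
mlra.
Qed.

(** Two pairs of ends are close as soon as the lines between them share a long
    segment, by [nbhs_end] applied on both sides. *)
Lemma nbhs_line_sub c l (W : set (line T)) : spans c l -> nbhs l W ->
  exists M, 0 < M /\ forall l', biinfinite l' -> tight_path l' (c (- M)) ->
    tight_path l' (c M) -> W l'.
Proof.
move=> [hc [e [e' [E he he']]]]; rewrite nbhsE => -[O [oO Ol] OW].
have [[A B] /= [hA hB] AB] := oO l _ _ Ol E.
have [M1 [M10 hM1]] := nbhs_end treeT (geodesic_opp hc) he hA.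
have [M2 [M20 hM2]] := nbhs_end treeT hc he' hB.
pose M := Num.max M1 M2.
have M1M : M1 <= M by rewrite le_max lexx.
have M2M : M2 <= M by rewrite le_max lexx orbT.
exists M; split; first by lra.
move=> l' bl' h1 h2; apply: OW.
have [p [s1 [sp e1 e2]]] : exists p s, [/\ spans p l', c 0 = p s & c M = p (s + M)].
  have [p sp] := biinfinite_spans bl'; have [hp _] := sp.
  move: h1 h2; rewrite (tight_path_spans sp) => -[s1 _ es1] [s2 _ es2].
  have d : mdist (p s1) (p s2) = 2 * M by rewrite es1 es2 (geodesic_dist hc); lra.
  wlog s12 : p sp hp s1 s2 es1 es2 d / s1 <= s2.
    move=> W'; have [h|/ltW h] := leP s1 s2; first exact: (W' p sp hp s1 s2).
    apply: (W' (p \o -%R) (spans_opp sp) (geodesic_opp hp) (- s1) (- s2)).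
    - by rewrite /= opprK.
    - by rewrite /= opprK.
    - by rewrite /= !opprK.
    - by rewrite lerN2.
  rewrite (geodesic_dist hp s12) in d.
  exists p, (s1 + M); split => //; last by rewrite -es2; congr p; lra.
  apply: (@segment_uniq _ _ treeT (p s1) (p s2)).
  - by rewrite es1 es2; apply: segment_geodesic => //; lra.
  - by apply: segment_geodesic => //; lra.
  - by rewrite [RHS](geodesic_dist hp) ?es1 ?(geodesic_dist hc); lra.
have [hp [f [f' [F hf hf']]]] := sp.
apply: (AB (inr f, inr f')) => //=; split => /=.
  apply: hM1; apply: (@line_end_beyond _ (p \o -%R) _ (- s1) M) => //.
  - exact: geodesic_opp.
  - exact: geodesic_opp.
  - by rewrite /= oppr0 opprK.
  - have d1 : mdist (c (- M)) (c M) = 2 * M by rewrite (geodesic_dist hc); lra.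
    move: h1; rewrite (tight_path_spans sp) => -[u _ eu] /=.
    have d2 : mdist (p u) (p (s1 + M)) = 2 * M by rewrite eu -e2.
    have d3 : mdist (p u) (p s1) = M.
      by rewrite eu -e1 (geodesic_dist hc); lra.
    rewrite -eu; congr p; rewrite hp in d2; rewrite hp in d3.
    move: d2 d3; have [?|?] := ger0P (u - (s1 + M)).
      by have [?|?] := ger0P (u - s1); lra.
    by have [?|?] := ger0P (u - s1); lra.
by apply: hM2; apply: (@line_end_beyond _ p _ s1 M).
Qed.

(** The lines with one end in each of the half-trees beyond [c s] and [c t] form an
    open set, and all of them contain the segment between these points. *)
Lemma line_nbhs c l s t : spans c l -> s <= t ->
  nbhs l [set l' | biinfinite l' -> tight_path l' (c s) /\ tight_path l' (c t)].
Proof.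
move=> sl st; have [hc [e [e' [E he he']]]] := sl.
pose H1 := half_tree (c s) (c (s - 1)); pose H2 := half_tree (c t) (c (t + 1)).
have n1 : c (s - 1) != c s by rewrite -mdist_gt0 (geodesic_dist hc); lra.
have n2 : c (t + 1) != c t by rewrite -mdist_gt0 metric_sym (geodesic_dist hc); lra.
have oH1 a : H1 a -> nbhs a H1.
  by move=> h; apply: open_nbhs_nbhs; split => //; exact: open_half_tree.
have oH2 a : H2 a -> nbhs a H2.
  by move=> h; apply: open_nbhs_nbhs; split => //; exact: open_half_tree.
pose U : set (line T) :=
  [set l' | exists a b, [/\ ends l' = [set a; b], H1 a & H2 b]].
have oU : open U.
  move=> l0 a b [a0 [b0 [E0 h1 h2]]] E1; rewrite E1 in E0.
  have [[? ?]|[? ?]] := set2_inj E0; subst a0 b0.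
    exists (H1, H2) => /=; first by split; [exact: oH1|exact: oH2].
    by move=> [q1 q2] /= [k1 k2] l1 E2; exists q1, q2.
  exists (H2, H1) => /=; first by split; [exact: oH2|exact: oH1].
  by move=> [q1 q2] /= [k1 k2] l1 E2; exists q2, q1; rewrite E2 setUC.
have Ul : U l.
  exists (inr e), (inr e'); split => //; last by apply: (half_tree_end treeT hc he'); lra.
  have := @half_tree_end R T treeT (c \o -%R) e (- s) (1 - s) (geodesic_opp hc) he ltac:(lra).
  by rewrite /= opprK opprB.
apply: filterS (open_nbhs_nbhs (conj oU Ul)) => l1 [a [b [E1 h1 h2]]] bl1.
have [p sp] := biinfinite_spans bl1; have [hp [f [f' [F hf hf']]]] := sp.
have [p1 [p2 [T1 T2 D1 D2]]] : exists p1 p2, [/\ tight_path l1 p1,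
    tight_path l1 p2, direction (c s) (c (s - 1)) p1 &
    direction (c t) (c (t + 1)) p2].
  rewrite E1 in F; rewrite (tight_path_spans sp).
  have [[? ?]|[? ?]] := set2_inj F; subst a b.
    have /near_pinftyP[t1 k1] := h1 _ hf; have /near_pinftyP[t2 k2] := h2 _ hf'.
    by exists (p (- t1)), (p t2); split; [exists (- t1)|exists t2|exact: k1|exact: k2].
  have /near_pinftyP[t1 k1] := h1 _ hf'; have /near_pinftyP[t2 k2] := h2 _ hf.
  by exists (p t1), (p (- t2)); split; [exists t1|exists (- t2)|exact: k1|exact: k2].
move: D1 D2 => /(directionP treeT _ n1) D1 /(directionP treeT _ n2) D2.
have g1 : segment (c (s - 1)) (c (t + 1)) (c s) by apply: segment_geodesic => //; lra.
have g2 : segment (c s) (c (t + 1)) (c t) by apply: segment_geodesic => //; lra.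
have [//|g3] := segment_union treeT p1 g1.
have [g4 g5] := segment_trans (segment_sym g3) (segment_sym g2).
have [//|g6] := segment_union treeT p2 g4.
have g8 : segment p1 p2 (c t) by exact: segment_sym.
have g9 : segment p1 (c t) (c s) by exact: segment_sym.
have [g10 _] := segment_trans g8 g9.
by split; apply: (segment_tight_path bl1 T1 T2).
Qed.

End LineTopology.

(** * Edges and finiteness *)

Section Edges.
Variables (R : realType) (G : groupType) (T : gtree R G).
Variables (k : nat) (Gs : 'I_k -> set G).
Hypothesis OS : outer_space T Gs.
Implicit Types (x y z u v w : T) (g h : G) (s t M : R).

Local Notation treeT := (@gtree_tree R G T).
Local Notation V := (@vertex R G T).

Lemma seq_bound (X : eqType) (r : seq X) (f : X -> R) :
  exists K, 0 <= K /\ forall a, a \in r -> f a <= K.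
Proof.
elim: r => [|a r [K [K0 hK]]]; first by exists 0.
exists (Num.max (f a) K); split; first by rewrite le_max K0 orbT.
move=> x; rewrite inE le_max => /orP[/eqP->|/hK->]; rewrite ?lexx ?orbT//.
Qed.

Lemma edge_sym u v : edge V u v -> edge V v u.
Proof.
move=> [uv Vu Vv E]; split => //; first by rewrite eq_sym.
rewrite setUC -E; congr (_ `&` _).
by apply/seteqP; split => z; exact: segment_sym.
Qed.

Lemma edge_vertex u v w : edge V u v -> segment u v w -> V w -> w = u \/ w = v.
Proof. by move=> [_ _ _ E] hw Vw; have : [set u; v] w by rewrite -E. Qed.

(** A segment has only two directions at each of its points. *)
Lemma no_three_germs (a b c e d : R) : 0 < d ->
  `|a - e| = d -> `|b - e| = d -> `|c - e| = d ->
  `|a - b| = 2 * d -> `|a - c| = 2 * d -> `|b - c| = 2 * d -> False.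
Proof.
move=> d0; have [?|?] := ger0P (a - e); have [?|?] := ger0P (b - e);
have [?|?] := ger0P (c - e); have [?|?] := ger0P (a - b);
have [?|?] := ger0P (a - c); have [?|?] := ger0P (b - c); lra.
Qed.

(** The interior of an edge has no branch points, so a path from an interior
    point either stays in the edge or runs through one of its end vertices. *)
Lemma leave_edge x y u v : ~ V x -> edge V u v -> segment u v x ->
  [\/ segment x y u, segment x y v | segment u v y].
Proof.
move=> nVx euv hx; have [uv Vu Vv _] := euv.
have [w [w1 w2 w3]] := median treeT u v y.
have [e|wu] := eqVneq w u.
  by apply: Or31; subst w; have [] := segment_trans w3 (segment_sym hx).
have [e|wv] := eqVneq w v.
  by apply: Or32; subst w; have [] := segment_trans w2 hx.
have nVw : ~ V w.
  by move=> /(edge_vertex euv w1)[] e; [rewrite e eqxx in wu|rewrite e eqxx in wv].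
apply: Or33; have [<-//|wy] := eqVneq w y.
have [_ _ /(_ w nVw)[u0 [v0 [_ sw]]]] := gtree_simplicial T.
move=> /metricType_numDomainType.nbhs_mdistP[e /= e0 he].
pose m := Num.min (mdist w u) (Num.min (mdist w v) (mdist w y)).
have m0 : 0 < m by rewrite !lt_min !mdist_gt0 wu wv wy.
have mu : m <= mdist w u by rewrite ge_min lexx.
have mv : m <= mdist w v by rewrite !ge_min lexx orbT.
have my : m <= mdist w y by rewrite !ge_min lexx !orbT.
pose d := Num.min m (e / 2).
have d0 : 0 < d by rewrite lt_min m0 divr_gt0.
have dm : d <= m by rewrite ge_min lexx.
have de : d < e by apply: (@le_lt_trans _ _ (e / 2)); [rewrite ge_min lexx orbT|lra].
have [a [a1 a2]] := @point_at _ _ treeT w u d ltac:(apply/andP; split; lra).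
have [b [b1 b2]] := @point_at _ _ treeT w v d ltac:(apply/andP; split; lra).
have [c [c1 c2]] := @point_at _ _ treeT w y d ltac:(apply/andP; split; lra).
have ab : mdist a b = 2 * d.
  have := metric_triangle u a v; have := metric_triangle a b v.
  by have := metric_triangle a w b; mlra.
have ac : mdist a c = 2 * d.
  have := metric_triangle u a y; have := metric_triangle a c y.
  by have := metric_triangle a w c; mlra.
have bc : mdist b c = 2 * d.
  have := metric_triangle v b y; have := metric_triangle b c y.
  by have := metric_triangle b w c; mlra.
have sa : segment u0 v0 a by apply: he; rewrite /= a2.
have sb : segment u0 v0 b by apply: he; rewrite /= b2.
have sc : segment u0 v0 c by apply: he; rewrite /= c2.
exfalso; apply: (@no_three_germs (mdist u0 a) (mdist u0 b) (mdist u0 c) (mdist u0 w) d) => //.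
- by rewrite -(mdist_segment treeT sa sw) metric_sym.
- by rewrite -(mdist_segment treeT sb sw) metric_sym.
- by rewrite -(mdist_segment treeT sc sw) metric_sym.
- by rewrite -(mdist_segment treeT sa sb).
- by rewrite -(mdist_segment treeT sa sc).
- by rewrite -(mdist_segment treeT sb sc).
Qed.

Lemma nonvertex_neq x u : ~ V x -> V u -> x != u.
Proof. by move=> nVx Vu; apply/eqP => e; subst. Qed.

Lemma edge_uniq x u v u' v' : ~ V x -> edge V u v -> edge V u' v' ->
  segment u v x -> segment u' v' x -> (u' = u /\ v' = v) \/ (u' = v /\ v' = u).
Proof.
move=> nVx e1 e2 h1 h2; have [uv Vu Vv _] := e1.
have [uv' Vu' Vv' _] := e2.
have K a b w : edge V a b -> segment a b x -> V w -> segment x a w -> w = a.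
  move=> eab hab Vw hw; have [_ _ Vb _] := eab.
  have [h3 _] := segment_trans hab (segment_sym hw).
  have [//|e] := edge_vertex eab h3 Vw; subst w; case: nVx.
  suff -> : x = b by [].
  by apply: mdist_positivity; have := mdist_ge0 b x; mlra.
have key a b : edge V a b -> segment a b x -> a = u \/ a = v.
  move=> eab hab; have [_ Va _ _] := eab.
  case: (leave_edge a nVx e1 h1) => h; last exact: (edge_vertex e1).
    by left; rewrite (K a b u).
  by right; rewrite (K a b v).
have h2' : segment v' u' x by exact: segment_sym.
move: uv'; case: (key _ _ e2 h2) => ->; case: (key _ _ (edge_sym e2) h2') => ->;
  rewrite ?eqxx// => _; by [left|right].
Qed.

Lemma vertex_act g v : V v <-> V (act g v).
Proof.
by split=> [|/(act_vertex g^-1%g)]; [exact: act_vertex | rewrite actK].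
Qed.

Lemma segment_actE g x y z : segment (act g x) (act g y) (act g z) <-> segment x y z.
Proof. by rewrite /segment/= !act_isom. Qed.

Lemma act_inj g : injective (@act R G T g).
Proof. exact: can_inj (@actK R G T g). Qed.

Lemma edge_act g u v : edge V u v -> edge V (act g u) (act g v).
Proof.
move=> [uv Vu Vv E]; split; rewrite -?vertex_act//.
  by apply: contraNN uv => /eqP/act_inj->.
apply/seteqP; split => [z []|z [->|->]]; last 2 first.
- by split; [exact: segment_left|rewrite -vertex_act].
- by split; [exact: segment_right|rewrite -vertex_act].
rewrite -(actVK g z) segment_actE -vertex_act => h1 h2.
by have [->|->] : [set u; v] (act g^-1%g z); [rewrite -E|left|right].
Qed.

(** Edges have trivial stabilisers and are not inverted, so only the identity
    fixes a point in the interior of an edge. *)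
Lemma fix_nonvertex g x : ~ V x -> act g x = x -> g = 1%g.
Proof.
move=> nVx gx; have [_ _ /(_ x nVx)[u [v [euv hx _]]]] := gtree_simplicial T.
have hgx : segment (act g u) (act g v) x by rewrite -gx segment_actE.
have [[H _ _ _] _ _] := OS; apply: (H _ u v euv).
rewrite image_setU !image_set1.
by have [[-> ->]|[-> ->]] := edge_uniq nVx euv (edge_act g euv) hx hgx;
  rewrite // setUC.
Qed.

Lemma nonvertex_between x y : x != y -> exists z, segment x y z /\ ~ V z.
Proof.
move=> xy; apply: contrapT => h; have d0 : 0 < mdist x y by rewrite mdist_gt0.
(* Otherwise the points at distance [mdist x y / n.+1] from [x] are infinitely many
   vertices of one segment. *)
have /choice[f hf] : forall n : nat, exists z, segment x y z /\
    mdist x z = mdist x y / n.+1%:R.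
  move=> n; apply: (point_at treeT); rewrite divr_ge0 ?mdist_ge0//=.
  by rewrite ler_pdivrMr// ler_peMr ?mdist_ge0// ler1n.
have [_ /(_ x y) fin _] := gtree_simplicial T.
have : finite_set (f @^-1` (segment x y `&` V)).
  apply: finite_preimage fin => n m _ _ e.
  have [_ e1] := hf n; have [_ e2] := hf m; rewrite e e2 in e1.
  move/mulfI: e1; rewrite gt_eqF// => /(_ isT)/invr_inj/eqP.
  by rewrite eqr_nat => /eqP[].
suff -> : f @^-1` (segment x y `&` V) = setT by exact: infinite_nat.
apply/seteqP; split => // n _ /=; have [h1 _] := hf n; split => //.
by apply: contrapT => nV; apply: h; exists (f n).
Qed.

Lemma vertex_exists : exists v, V v.
Proof.
have [x _] : [set: T] !=set0 by case: treeT.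
have [h|h] := pselect (V x); first by exists x.
have [_ _ /(_ x h)[u [v [[_ Vu _ _] _ _]]]] := gtree_simplicial T.
by exists u.
Qed.

Hypothesis FG : finitely_generated G.

(** The translates of finitely many segments cover the tree, because their union
    is convex and the action is minimal. *)
Lemma translates_cover v : exists r : seq G, forall x, exists g h,
  h \in r /\ segment v (act h v) (act g x).
Proof.
have [r0 hr0] := FG; exists (1%g :: r0).
pose S : set T := [set x | exists g h, h \in 1%g :: r0 /\ segment v (act h v) (act g x)].
have Sg g x : S x -> S (act g x).
  move=> [g' [h [hr hs]]]; exists (g' * g^-1)%g, h; split => //.
  by rewrite actM actK.
have Sseg g : segment v (act g v) `<=` S.
  have : generated [set` r0] g by rewrite hr0.
  move=> /(_ [set g | segment v (act g v) `<=` S]); apply.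
    split=> [x|a b ha hb x] /=.
      by rewrite act1 => /segment_eq->; exists 1%g, 1%g; rewrite mem_head !act1;
         split => //; exact: segment_left.
    rewrite actM => hx.
    have [/segment_sym h|/segment_sym h] := segment_union treeT (act a v) hx.
      by apply: ha; exact: segment_sym.
    rewrite -(actVK a x); apply/(Sg a).
    rewrite -(actK b (act a^-1%g x)); apply/(Sg b^-1%g)/hb.
    apply/segment_sym; rewrite -(segment_actE b^-1%g) !actK.
    by rewrite -(segment_actE a) actVK; exact: segment_sym.
  move=> g' g'r x hx; exists 1%g, g'; rewrite act1 inE; split => //.
  by rewrite [g' \in r0]g'r orbT.
have SS x y : S x -> S y -> segment x y `<=` S.
  move=> [g [h [hr hx]]] [g' [h' [hr' hy]]] z hz.
  pose p := act g^-1%g v; pose q := act g'^-1%g v.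
  have pS : segment x p `<=` S.
    move=> w; rewrite -(segment_actE g) actVK => hw.
    rewrite -(actK g w); apply: (Sg _ _); apply: (Sseg h).
    by have [] := segment_trans hx (segment_sym hw).
  have qS : segment y q `<=` S.
    move=> w; rewrite -(segment_actE g') actVK => hw.
    rewrite -(actK g' w); apply: (Sg _ _); apply: (Sseg h').
    by have [] := segment_trans hy (segment_sym hw).
  have pqS : segment p q `<=` S.
    move=> w; rewrite -(segment_actE g) actVK /q -actM => hw.
    by rewrite -(actK g w); apply: (Sg _ _); exact: Sseg hw.
  have [h1|h1] := segment_union treeT p hz; first exact: pS.
  have [h2|h2] := segment_union treeT q h1; first exact: pqS.
  by apply: qS; exact: segment_sym.
have [_ /(_ S) min _] := OS.
move=> x; suff : S x by [].
rewrite min//; exists v; exists 1%g, 1%g; rewrite mem_head act1; split => //.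
exact: segment_left.
Qed.

Lemma cobounded v : exists D, forall x, exists g, mdist v (act g x) <= D.
Proof.
have [r hr] := translates_cover v.
have [D [_ hD]] := seq_bound r (fun h => mdist v (act h v)).
exists D => x; have [g [h [h1 h2]]] := hr x; exists g.
by have := hD h h1; have := mdist_ge0 (act g x) (act h v); mlra.
Qed.

(** An interior point of each edge has a translate on one of finitely many segments
    between vertices, which then contains the translate of the whole edge; and such
    a segment has finitely many vertices. *)
Lemma finite_edge_orbits : exists r : seq T, forall u v, edge V u v ->
  exists g, act g u \in r /\ act g v \in r.
Proof.
have [v0 Vv0] := vertex_exists; have [r hr] := translates_cover v0.
have fin : finite_set (\bigcup_(h in [set` r]) (segment v0 (act h v0) `&` V)).
  apply: bigcup_finite; first exact: finite_seq.
  by move=> h _; have [_ f _] := gtree_simplicial T; exact: f.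
have /finite_seqP[q hq] := fin; exists q => u v euv; have [uv Vu Vv _] := euv.
have [x [hx nVx]] := nonvertex_between uv.
have [g [h [hr1 hg]]] := hr x; exists g.
have nVg : ~ V (act g x) by rewrite -vertex_act.
have eg := edge_act g euv; have sg : segment (act g u) (act g v) (act g x).
  by rewrite segment_actE.
have key w : V w -> segment (act g x) w (act g u) \/ segment (act g x) w (act g v).
  move=> Vw; case: (leave_edge w nVg eg sg) => [|/= ?|/=]; [by left|by right|].
  move=> hw; have [->|->] := edge_vertex eg hw Vw; [left|right]; exact: segment_right.
have inq a : V a -> segment v0 (act h v0) a -> a \in q.
  by move=> Va sa; have : [set` q] a by rewrite -hq; exists h.
have Vgu : V (act g u) by rewrite -vertex_act.
have Vgv : V (act g v) by rewrite -vertex_act.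
have n1 := nonvertex_neq nVg Vgu; have n2 := nonvertex_neq nVg Vgv.
have fact a : a != act g x -> segment (act g x) v0 a ->
    segment (act g x) (act h v0) a -> False.
  rewrite -mdist_gt0 => d0 s1 s2.
  by have := metric_triangle v0 a (act h v0); mlra.
have sub1 a : segment (act g x) v0 a -> segment v0 (act h v0) a.
  by move=> /segment_sym s1; have [] := segment_trans hg s1.
have sub2 a : segment (act g x) (act h v0) a -> segment v0 (act h v0) a.
  by move=> /segment_sym s1; have [/segment_sym] := segment_trans (segment_sym hg) s1.
have Vh : V (act h v0) by rewrite -vertex_act.
case: (key _ Vv0) => k1; case: (key _ Vh) => k2.
- by case: (fact (act g u)) => //; rewrite eq_sym.
- by split; apply: inq => //; [exact: sub1|exact: sub2].
- by split; apply: inq => //; [exact: sub2|exact: sub1].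
- by case: (fact (act g v)) => //; rewrite eq_sym.
Qed.

End Edges.

(** * Existence of topological representatives *)

Section Representatives.
Variables (R : realType) (G : groupType) (T : gtree R G).
Variables (k : nat) (Gs : 'I_k -> set G).
Hypothesis OS : outer_space T Gs.
Hypothesis FG : finitely_generated G.
Implicit Types (x y z u v w : T) (g h : G) (s t M : R) (a b : aut G).

Local Notation treeT := (@gtree_tree R G T).
Local Notation V := (@vertex R G T).

(** The condition on stabilisers for an equivariant map to be defined at [v]: the
    automorphism maps each [Gs i] to a conjugate of some [Gs j], which fixes a
    vertex. *)
Lemma fixed_by_image a v : autG Gs a -> V v ->
  exists w, forall h, act h v = v -> act (a h) w = w.
Proof.
move=> aG Vv; have [[_ ex _ triv] _ _] := OS.
have [[i [c Ec]]|h] := pselect (exists i, conjugate (Gs i) (stab v)); last first.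
  have hv : stab v = [set 1%g] by apply: triv => // i hi; apply: h; exists i.
  exists v => g gv; have : stab v g by [].
  by rewrite hv => ->; rewrite aut_one act1.
have [j [d Ed]] := aG i; have [v0 Vv0 [e Ee]] := ex j.
exists (act (a c * d * e^-1)%g v0) => g gv; have : stab v g by [].
rewrite Ec => -[x Gx <-]; have : (a @` Gs i) (a x) by exists x.
rewrite Ed => -[y Gy ey]; have : stab v0 (e * y / e)%g by rewrite Ee; exists y.
move=> e0; rewrite -{2}(e0 : act _ v0 = v0) -!actM; congr (act _ v0).
by rewrite !aut_mul aut_inverse -ey !mulgA !mulgVK.
Qed.

Lemma vertex_map a : autG Gs a -> exists f : T -> T, forall v, V v ->
  forall g, f (act g v) = act (a g) (f v).
Proof.
move=> aG; have [v0 Vv0] := vertex_exists T.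
have /choice[W hW] : forall v, exists w, V v -> forall h, act h v = v ->
    act (a h) w = w.
  move=> v; have [Vv|nV] := pselect (V v); last by exists v.
  by have [w hw] := fixed_by_image aG Vv; exists w.
pose orb v : set T := [set u | exists g, u = act g v].
(* The representative depends only on the orbit as a set, which makes it invariant. *)
pose rep v := xget v0 (orb v).
have orbE g v : orb (act g v) = orb v.
  apply/seteqP; split => u [h ->]; first by exists (h * g)%g; rewrite actM.
  by exists (h / g)%g; rewrite -actM mulgVK.
have repE g v : rep (act g v) = rep v by rewrite /rep orbE.
have /choice[c hc] : forall v, exists g, v = act g (rep v).
  move=> v; have : orb v (rep v).
    by apply: (@xgetPex _ v0 (orb v)); exists v, 1%g; rewrite act1.
  by move=> [g eg]; exists g^-1%g; rewrite eg actK.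
exists (fun v => act (a (c v)) (W (rep v))) => v Vv g.
rewrite repE -actM -aut_mul; set o := rep v.
have Vo : V o.
  by have := hc v; rewrite -/o => e; rewrite e -vertex_act in Vv.
have ho : act ((g * c v)^-1 * c (act g v))%g o = o.
  have e1 := hc (act g v); rewrite repE -/o in e1.
  have e2 : act (g * c v)%g o = act g v by rewrite actM -hc.
  by rewrite actM -e1 -e2 actK.
have e := hW _ Vo _ ho.
rewrite (aut_mul a (g * c v)^-1%g) actM aut_inverse in e.
by rewrite -{2}e actVK.
Qed.

Section Interpolation.
Variables (a : aut G) (f0 : T -> T).
Hypothesis f0E : forall v, V v -> forall g, f0 (act g v) = act (a g) (f0 v).

(** [y] is the value at [x] of the map that agrees with [f0] at vertices and is linear
    on edges.  Quantifying over all edges through [x], in both directions, makes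
    the relation equivariant by definition. *)
Let interpolates x y := (V x -> y = f0 x) /\ forall u v, edge V u v ->
  segment u v x -> segment (f0 u) (f0 v) y /\
  mdist (f0 u) y * mdist u v = mdist u x * mdist (f0 u) (f0 v).

Let interpolates_ex x : exists y, interpolates x y.
Proof.
have [Vx|nVx] := pselect (V x).
  exists (f0 x); split => // u v euv hx.
  have [->|->] := edge_vertex euv hx Vx.
    by rewrite !mdistxx !mul0r; split => //; exact: segment_left.
  by split; [exact: segment_right|rewrite mulrC].
have [_ _ /(_ x nVx)[u [v [euv hx _]]]] := gtree_simplicial T.
have [uv _ _ _] := euv; have d0 : 0 < mdist u v by rewrite mdist_gt0.
have [|y [y1 y2]] := @point_at _ _ treeT (f0 u) (f0 v)
    (mdist u x * mdist (f0 u) (f0 v) / mdist u v).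
  rewrite !mulr_ge0 ?invr_ge0 ?mdist_ge0//=.
  rewrite ler_pdivrMr// mulrC ler_wpM2l ?mdist_ge0//.
  by have := mdist_ge0 x v; mlra.
have y3 : mdist (f0 u) y * mdist u v = mdist u x * mdist (f0 u) (f0 v).
  by rewrite y2 mulfVK// gt_eqF.
exists y; split => // u' v' e' hx'.
have [[-> ->]|[-> ->]] := edge_uniq nVx euv e' hx hx'; first by [].
split; first exact: segment_sym.
have e1 : mdist (f0 v) y = mdist (f0 u) (f0 v) - mdist (f0 u) y by mlra.
have e2 : mdist v x = mdist u v - mdist u x by mlra.
by rewrite e1 e2 (metric_sym v u) (metric_sym (f0 v)) mulrBl y3; lra.
Qed.

Let interpolates_uniq x y z : interpolates x y -> interpolates x z -> y = z.
Proof.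
move=> [h1 h2] [k1 k2]; have [Vx|nVx] := pselect (V x); first by rewrite h1 ?k1.
have [_ _ /(_ x nVx)[u [v [euv hx _]]]] := gtree_simplicial T.
have [uv _ _ _] := euv; have d0 : 0 < mdist u v by rewrite mdist_gt0.
have [h3 h4] := h2 _ _ euv hx; have [k3 k4] := k2 _ _ euv hx.
apply: (segment_uniq treeT h3 k3).
by apply: (mulIf (lt0r_neq0 d0)); rewrite h4 k4.
Qed.

Let interpolates_act x y g : interpolates x y -> interpolates (act g x) (act (a g) y).
Proof.
move=> [h1 h2]; split.
  by rewrite -vertex_act => Vx; rewrite f0E// h1.
move=> u v euv hx; have e' := edge_act g^-1%g euv.
have hx' : segment (act g^-1%g u) (act g^-1%g v) x.
  by rewrite -(segment_actE g) !actVK.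
have [_ Vu Vv _] := euv.
have [] := h2 _ _ e' hx'; rewrite !f0E// act_isom => h3 h4.
have h5 w : act (a g^-1%g) w = act (a g)^-1%g w by rewrite aut_inverse.
rewrite !h5 in h3 h4; split.
  by rewrite -(segment_actE (a g)) !actVK in h3.
move: h4; rewrite act_isom -(act_isom (a g)) actVK => ->.
by rewrite -(act_isom g) actVK.
Qed.

Lemma interpolation : exists f : T -> T,
  (forall g x, f (act g x) = act (a g) (f x)) /\
  forall u v x, edge V u v -> segment u v x -> segment (f0 u) (f0 v) (f x) /\
    mdist (f0 u) (f x) * mdist u v = mdist u x * mdist (f0 u) (f0 v).
Proof.
have /choice[f hf] := interpolates_ex; exists f; split => [g x|u v x euv hx].
  apply: (@interpolates_uniq (act g x)) => //; exact: interpolates_act.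
by have [_] := hf x; exact.
Qed.

Lemma edge_stretch : exists K, 0 <= K /\ forall u v, edge V u v ->
  mdist (f0 u) (f0 v) <= K * mdist u v.
Proof.
have [r hr] := finite_edge_orbits OS FG.
have [K [K0 hK]] := seq_bound [seq (x, y) | x <- r, y <- r]
  (fun p => mdist (f0 p.1) (f0 p.2) / mdist p.1 p.2).
exists K; split => // u v euv; have [g [h1 h2]] := hr _ _ euv.
have [uv Vu Vv _] := euv.
have := hK (act g u, act g v) ltac:(by apply/allpairsP; exists (act g u, act g v)).
by rewrite /= !f0E// !act_isom ler_pdivrMr// mdist_gt0.
Qed.

End Interpolation.

(** Segments are subdivided at their finitely many vertices. *)
Lemma edgewise_lipschitz (f : T -> T) K :
  (forall u v x y, edge V u v -> segment u v x -> segment u v y ->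
     mdist (f x) (f y) <= K * mdist x y) ->
  forall x y, mdist (f x) (f y) <= K * mdist x y.
Proof.
move=> hK.
suff main n : forall x y (r : seq T), (size r <= n)%N ->
    (forall z, V z -> segment x y z -> z != x -> z != y -> z \in r) ->
    mdist (f x) (f y) <= K * mdist x y.
  move=> x y; have [_ /(_ x y)/finite_seqP[r hr] _] := gtree_simplicial T.
  apply: (main (size r) x y r) => // z Vz hz _ _.
  by have : [set` r] z by rewrite -hr.
elim: n => [|n IHn] x y r hr hin; last first.
  have [[z [Vz hz zx zy]]|h] :=
    pselect (exists z, [/\ V z, segment x y z, z != x & z != y]); last first.
    apply: (IHn x y [::]) => // z Vz hz zx zy.
    by exfalso; apply: h; exists z.
  have zr := hin z Vz hz zx zy.
  have sz : (size (rem z r) <= n)%N by rewrite size_rem// -ltnS prednK//; case: r {hin hr} zr.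
  have h1 : mdist (f x) (f z) <= K * mdist x z.
    apply: (IHn x z (rem z r)) => // w Vw hw wx wz.
    have [h1 h2] := segment_trans hz hw.
    apply: rem_mem => //; apply: hin => //; apply/eqP => e; subst w.
    by move/eqP: zy; apply; apply: segment_eq; exact: segment_sym.
  have h2 : mdist (f z) (f y) <= K * mdist z y.
    apply: (IHn z y (rem z r)) => // w Vw hw wz wy.
    have [h2 h3] := segment_trans (segment_sym hz) (segment_sym hw).
    apply: rem_mem => //; apply: hin => //; first exact: segment_sym.
    apply/eqP => e; subst w; move/eqP: zx; apply; apply: segment_eq.
    exact: segment_sym.
  have -> : mdist x y = mdist x z + mdist z y by [].
  by rewrite mulrDr (le_trans (metric_triangle _ (f z) _))// lerD.
have {hr}r0 : r = [::] by case: r hr {hin}.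
subst r; have [->|xy] := eqVneq x y; first by rewrite !mdistxx mulr0.
have inner z : V z -> segment x y z -> z = x \/ z = y.
  move=> Vz hz; have [|zx] := eqVneq z x; first by left.
  have [|zy] := eqVneq z y; first by right.
  by have := hin z Vz hz zx zy.
have [Vx|nVx] := pselect (V x).
  have [Vy|nVy] := pselect (V y).
    apply: (hK x y) => //; last 2 first.
    - exact: segment_left.
    - exact: segment_right.
    split => //; apply/seteqP; split => [z [h1 h2]|z [->|->]].
    + exact: inner.
    + by split => //; exact: segment_left.
    + by split => //; exact: segment_right.
  have [_ _ /(_ y nVy)[u [v [euv hy _]]]] := gtree_simplicial T.
  have [_ Vu Vv _] := euv; apply: (hK u v) => //.
  case: (leave_edge x nVy euv hy) => // /segment_sym h.
    by have [<-|e] := inner u Vu h; [exact: segment_left|case: nVy; rewrite -e].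
  by have [<-|e] := inner v Vv h; [exact: segment_right|case: nVy; rewrite -e].
have [_ _ /(_ x nVx)[u [v [euv hx _]]]] := gtree_simplicial T.
have [_ Vu Vv _] := euv; apply: (hK u v) => //.
case: (leave_edge y nVx euv hx) => // h.
  by have [e|<-] := inner u Vu h; [case: nVx; rewrite -e|exact: segment_left].
by have [e|<-] := inner v Vv h; [case: nVx; rewrite -e|exact: segment_right].
Qed.

Lemma representative_exists (Phi : out G) : outG Gs Phi ->
  exists f, @topological_representative R G T Phi f.
Proof.
move=> [a aG aPhi]; have [f0 hf0] := vertex_map aG.
have [f [f1 f2]] := interpolation hf0; have [K [K0 hK]] := edge_stretch hf0.
exists f; split; last by exists a.
exists K; apply: edgewise_lipschitz => u v x y euv hx hy.
have [x1 x2] := f2 _ _ _ euv hx; have [y1 y2] := f2 _ _ _ euv hy.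
have [uv _ _ _] := euv; have d0 : 0 < mdist u v by rewrite mdist_gt0.
rewrite (mdist_segment treeT x1 y1) (mdist_segment treeT hx hy).
rewrite -(ler_pM2r d0) -{1}(gtr0_norm d0) -normrM mulrBl x2 y2 -mulrBl normrM.
rewrite (ger0_norm (mdist_ge0 (f0 u) (f0 v))) -mulrA mulrCA.
by rewrite ler_wpM2l ?normr_ge0// hK.
Qed.

End Representatives.

(** * The action on bi-infinite lines *)

Section OutAction.
Variables (R : realType) (G : groupType) (T : gtree R G).
Variables (k : nat) (Gs : 'I_k -> set G).
Hypothesis OS : outer_space T Gs.
Hypothesis FG : finitely_generated G.
Implicit Types (x y z u v w : T) (g h : G) (s t M C D K : R) (a b : aut G).
Implicit Types (Phi Psi Theta : out G) (f : T -> T) (l : line T) (c : R -> T).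

Local Notation treeT := (@gtree_tree R G T).
Local Notation rep := (@topological_representative R G T).

Lemma lipschitz_bound f : is_lipschitz f -> exists K, 0 <= K /\
  forall x y, mdist (f x) (f y) <= K * mdist x y.
Proof.
move=> [K hK]; exists `|K|; split => // x y.
by apply: le_trans (hK x y) _; rewrite ler_wpM2r ?mdist_ge0 ?ler_norm.
Qed.

(** The distance between the two images of a point is invariant under translation,
    and every point has a translate in a bounded set. *)
Lemma equivariant_close f f' a : is_lipschitz f -> is_lipschitz f' ->
  (forall g x, f (act g x) = act (a g) (f x)) ->
  (forall g x, f' (act g x) = act (a g) (f' x)) ->
  exists C, forall x, mdist (f x) (f' x) <= C.
Proof.
move=> /lipschitz_bound[K [K0 hK]] /lipschitz_bound[K' [K'0 hK']] e e'.
have [v Vv] := vertex_exists T; have [D hD] := cobounded OS FG v.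
exists (K * D + mdist (f v) (f' v) + K' * D) => x; have [g hg] := hD x.
rewrite -(act_isom (a g)) -e -e'.
have h1 : mdist (f v) (f (act g x)) <= K * D.
  by apply: le_trans (hK _ _) _; rewrite ler_wpM2l.
have h2 : mdist (f' v) (f' (act g x)) <= K' * D.
  by apply: le_trans (hK' _ _) _; rewrite ler_wpM2l.
have := metric_triangle (f (act g x)) (f v) (f' (act g x)).
have := metric_triangle (f v) (f' v) (f' (act g x)).
by mlra.
Qed.

Lemma out_set_inn Phi a b : out_set Phi a -> out_set Phi b ->
  exists d, b = (a * inn d)%g.
Proof.
have [a0 E] := out_coset Phi; rewrite E => -[g _ <-] [h _ <-].
exists (g^-1 * h)%g; rewrite -mulgA -innM; congr (_ * inn _)%g.
by rewrite mulgA mulgV mul1g.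
Qed.

(** Automorphisms in the same class differ by an inner one, which a translation of the
    target compensates. *)
Lemma representative_close Phi f f' : rep Phi f -> rep Phi f' ->
  exists g C, forall x, mdist (f' x) (act g (f x)) <= C.
Proof.
move=> [lf [a Pa ea]] [lf' [a' Pa' ea']].
have [c Ec] := out_set_inn Pa Pa'.
have lc : is_lipschitz (act (a c)^-1%g \o f').
  by have [K hK] := lf'; exists K => x y /=; rewrite act_isom.
have [|C hC] := equivariant_close lf lc ea.
  move=> g x /=; rewrite ea' -!actM; congr act; rewrite Ec /=.
  by rewrite !aut_mul aut_inverse !mulgA mulVg mul1g.
exists (a c), C => x; have := hC x.
by rewrite -(act_isom (a c)) /= actVK metric_sym.
Qed.

Lemma representative_comp Phi Psi f f' : rep Phi f -> rep Psi f' ->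
  rep (Phi * Psi)%g (f \o f').
Proof.
move=> [lf [a Pa ea]] [lf' [a' Pa' ea']]; split.
  have [K [K0 hK]] := lipschitz_bound lf; have [K' hK'] := lf'.
  exists (K * K') => x y /=; apply: le_trans (hK _ _) _.
  by rewrite -mulrA ler_wpM2l.
exists (a * a')%g; first by exists a => //; exists a'.
by move=> g x /=; rewrite ea' ea.
Qed.

Lemma representative_act g : rep 1%g (act g).
Proof.
split; first exact: act_lipschitz.
exists (inn g); first by exists g => //; rewrite mul1g.
by move=> h x; rewrite -!actM /= mulgVK.
Qed.

Variable H : set (out G).
Hypothesis subH : subgroup H.
Hypothesis HG : H `<=` outG Gs.

(** Composing with a representative of the inverse gives a map at bounded distance
    from a translation. *)
Lemma expanding Phi f : H Phi -> rep Phi f -> exists K B, [/\ 0 <= K, 0 <= B &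
  forall x y, mdist x y <= K * mdist (f x) (f y) + B].
Proof.
move=> HP rf; have [f' rf'] := representative_exists OS FG (HG (subgroupV subH HP)).
have := representative_comp rf' rf; rewrite mulVg => r1.
have [g [C hC]] := representative_close (representative_act 1%g) r1.
have [K [K0 hK]] := lipschitz_bound rf'.1.
have C0 : 0 <= C.
  by have [v _] := vertex_exists T; apply: le_trans (hC v); exact: mdist_ge0.
exists K, (2 * C); split => //; first by lra.
move=> x y; have h1 := hC x; have h2 := hC y; rewrite /= !act1 in h1 h2.
rewrite -(act_isom g x y); have h3 := hK (f x) (f y).
have := metric_triangle (act g x) (f' (f x)) (act g y).
have := metric_triangle (f' (f x)) (f' (f y)) (act g y).
by mlra.
Qed.

(** Bounded cancellation: the image of a point of a segment [x, y] stays close to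
    the segment between the images of [x] and [y], because points with the same
    image are at bounded distance. *)
Lemma bounded_cancellation Phi f : H Phi -> rep Phi f -> exists C, forall x y z,
  segment x y z -> mdist (f x) (f z) + mdist (f z) (f y) <= mdist (f x) (f y) + 2 * C.
Proof.
move=> HP rf; have [K [B [K0 B0 hB]]] := expanding HP rf.
have [K' [K'0 hK']] := lipschitz_bound rf.1.
exists (K' * B) => x y z hz.
have [p [p1 p2 p3]] := median treeT (f x) (f y) (f z).
have [z1 z1s z1p] := lipschitz_cross treeT rf.1 p2.
have [z2 z2s z2p] := lipschitz_cross treeT rf.1 p3.
have := hB z1 z2; rewrite z1p z2p mdistxx mulr0 add0r => h1.
have h2 : mdist z1 z <= B.
  have := metric_triangle x z1 y; have := metric_triangle z1 z2 y.
  by have := mdist_ge0 z z2; mlra.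
have h3 : mdist p (f z) <= K' * B.
  by rewrite -z1p; apply: le_trans (hK' _ _) _; rewrite ler_wpM2l.
by mlra.
Qed.

(** The image of [c] under [f] stays within [C] of [c'] and goes to both of its ends.
    The constant matters: for continuity it has to be the same for all lines. *)
Definition shadows C f c c' := [/\
  forall t, exists s, mdist (f (c t)) (c' s) <= C,
  forall M, exists t0, forall t, t0 <= t -> exists s, M <= s /\
    mdist (f (c t)) (c' s) <= C &
  forall M, exists t0, forall t, t0 <= t -> exists s, M <= s /\
    mdist (f (c (- t))) (c' (- s)) <= C].

Lemma image_shadow Phi f : H Phi -> rep Phi f -> exists C, forall c,
  geodesic_line c -> exists c', geodesic_line c' /\ shadows C f c c'.
Proof.
move=> HP rf; have [K [B [K0 B0 hB]]] := expanding HP rf.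
have [C hC] := bounded_cancellation HP rf; exists (4 * C) => c hc.
have far M t t' : K * `|M| + B + 1 <= mdist (c t) (c t') ->
    M <= mdist (f (c t)) (f (c t')).
  move=> h; have := hB (c t) (c t') => h1; apply: le_trans (ler_norm M) _.
  rewrite leNgt; apply/negP => /ltW h2.
  by have := ler_wpM2l K0 h2; lra.
have [|M|M|c' [c'1 c'2 c'3]] := @quasi_line_shadow _ _ treeT (f \o c) C.
- by move=> s t u st tu; apply: hC; apply: segment_geodesic => //; rewrite st.
- exists (K * `|M| + B + 1) => t ht; apply: far; apply: le_trans ht _.
  by rewrite hc sub0r normrN ler_norm.
- exists (K * `|M| + B + 1) => t ht; apply: far; apply: le_trans ht _.
  by rewrite hc sub0r normrN normrN ler_norm.
exists c'; split => //; split => [t|M|M].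
- have [t0|/ltW t0] := leP 0 t; first by have [s [h _]] := c'2 t t0; exists s.
  have := c'3 (- t); rewrite oppr_ge0 opprK => /(_ t0)[s [h _]].
  by exists (- s).
- exists (Num.max 0 (K * `|M + 4 * C| + B + 1)) => t.
  rewrite ge_max => /andP[t0 t1]; have [s [h1 h2]] := c'2 t t0; exists s; split => //.
  have := far (M + 4 * C) 0 t; rewrite hc sub0r normrN (ger0_norm t0) => /(_ t1).
  by move=> h3; rewrite /= in h2; lra.
- exists (Num.max 0 (K * `|M + 4 * C| + B + 1)) => t.
  rewrite ge_max => /andP[t0 t1]; have [s [h1 h2]] := c'3 t t0; exists s; split => //.
  have := far (M + 4 * C) 0 (- t); rewrite hc sub0r opprK (ger0_norm t0) => /(_ t1).
  by move=> h3; rewrite /= in h2; lra.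
Qed.

Lemma shadow_line_uniq C D f c c' c'' l' l'' : shadows C f c c' ->
  spans c' l' -> spans c'' l'' ->
  (forall t, exists s, mdist (f (c t)) (c'' s) <= D) -> l' = l''.
Proof.
move=> [_ h1 h2] s' s'' hD; apply: (spans_inj s' s'').
have [hc' _] := s'; have [hc'' _] := s''.
apply: (@line_stable _ _ treeT c' c'' (C + D)) => // M.
  have [t0 ht] := h1 M; have [s [Ms hs]] := ht t0 (lexx _); have [u hu] := hD t0.
  exists s; split => //; exists u.
  by have := metric_triangle (c' s) (f (c t0)) (c'' u); mlra.
have [t0 ht] := h2 M; have [s [Ms hs]] := ht t0 (lexx _); have [u hu] := hD (- t0).
exists (- s); split; first by rewrite lerN2.
exists u.
by have := metric_triangle (c' (- s)) (f (c (- t0))) (c'' u); mlra.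
Qed.

(** The line that the image curve follows is the image in the sense of [line_map],
    and the only one since limits at the boundary are unique. *)
Lemma line_map_shadow Phi f : H Phi -> rep Phi f -> exists C, forall c l,
  spans c l -> exists c' l', [/\ spans c' l', shadows C f c c', line_map f l l' &
    forall l1, line_map f l l1 -> l1 = l'].
Proof.
move=> HP rf; have [C hC] := image_shadow HP rf; exists C => c l sc.
have [hc _] := sc; have [c' [hc' sh]] := hC _ hc.
have [l' sc'] := geodesic_line_spans hc'; have [_ h1 h2] := sh.
have lm := line_map_spans rf.1 sc sc' h1 h2.
exists c', l'; split => // l1; apply: line_map_uniq => //.
  exact: spans_biinfinite sc.
exact: spans_biinfinite sc'.
Qed.

Lemma out_map_total Phi l : H Phi -> biinfinite l -> exists l',
  biinfinite l' /\ out_map Phi l l'.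
Proof.
move=> HP /biinfinite_spans[c sc].
have [f rf] := representative_exists OS FG (HG HP).
have [C hC] := line_map_shadow HP rf; have [c' [l' [sc' _ lm _]]] := hC _ _ sc.
by exists l'; split; [exact: spans_biinfinite sc'|exists f].
Qed.

Lemma out_map_biinfinite Phi l l' : H Phi -> biinfinite l -> out_map Phi l l' ->
  biinfinite l'.
Proof.
move=> HP /biinfinite_spans[c sc] [f rf lm].
have [C hC] := line_map_shadow HP rf; have [c' [l1 [sc' _ _ u]]] := hC _ _ sc.
by rewrite (u _ lm); exact: spans_biinfinite sc'.
Qed.

Lemma out_map_comp Phi Psi l l' l'' : H Phi -> H Psi -> biinfinite l ->
  out_map Phi l l' -> out_map Psi l' l'' -> out_map (Psi * Phi)%g l l''.
Proof.
move=> HP HP' /biinfinite_spans[c sc] [f rf lm] [f' rf' lm'].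
have [C hC] := line_map_shadow HP rf; have [c1 [l1 [s1 sh1 _ u1]]] := hC _ _ sc.
have e1 := u1 _ lm; subst l1.
have [C' hC'] := line_map_shadow HP' rf'; have [c2 [l2 [s2 sh2 _ u2]]] := hC' _ _ s1.
have e2 := u2 _ lm'; subst l2.
have r3 := representative_comp rf' rf; exists (f' \o f) => //.
have [C3 hC3] := line_map_shadow (subgroupM subH HP' HP) r3.
have [c3 [l3 [s3 sh3 lm3 _]]] := hC3 _ _ sc.
suff <- : l3 = l'' by [].
have [K [K0 hK]] := lipschitz_bound rf'.1.
apply: (@shadow_line_uniq _ (K * C + C') _ _ _ _ _ _ sh3 s3 s2) => t.
have [h1 _ _] := sh1; have [h2 _ _] := sh2.
have [s hs] := h1 t; have [s' hs'] := h2 s; exists s' => /=.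
have := ler_wpM2l K0 hs; have := hK (f (c t)) (c1 s).
by have := metric_triangle (f' (f (c t))) (f' (c1 s)) (c2 s'); mlra.
Qed.

Lemma out_map1 l l' : biinfinite l -> out_map 1%g l l' <-> line_orbit l l'.
Proof.
move=> bl; split; last by move=> [g hg]; exists (act g) => //; exact: representative_act.
have [c sc] := biinfinite_spans bl; have [hc _] := sc; move=> [f rf lm].
have H1 : H 1%g by case: subH.
have [C hC] := line_map_shadow H1 rf; have [c1 [l1 [s1 sh1 _ u1]]] := hC _ _ sc.
have e1 := u1 _ lm; subst l1.
have [g [D hD]] := representative_close (representative_act 1%g) rf.
have [l2 s2] := geodesic_line_spans (geodesic_act g hc).
exists g; suff -> : l' = l2 by exact: (line_map_act sc s2).
apply: (@shadow_line_uniq _ D _ _ _ _ _ _ sh1 s1 s2) => t; exists t.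
by have := hD (c t); rewrite /= act1.
Qed.

Lemma out_map_inv Phi l l' : H Phi -> biinfinite l -> out_map Phi l l' ->
  out_map Phi^-1%g l' l.
Proof.
move=> HP bl m; have bl' := out_map_biinfinite HP bl m.
have [l1 [bl1 m1]] := out_map_total (subgroupV subH HP) bl'.
have := out_map_comp HP (subgroupV subH HP) bl m m1; rewrite mulVg => /(out_map1 _ bl) o.
have /(out_map1 _ bl1) m2 := line_orbit_sym bl o.
have H1 : H 1%g by case: subH.
by have := out_map_comp (subgroupV subH HP) H1 bl' m1 m2; rewrite mul1g.
Qed.

Lemma out_map_factor Phi Psi l l'' : H Phi -> H Psi -> biinfinite l ->
  out_map (Psi * Phi)%g l l'' -> exists l', [/\ biinfinite l', out_map Phi l l' &
    out_map Psi l' l''].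
Proof.
move=> HP HP' bl m; have [l' [bl' m']] := out_map_total HP bl.
exists l'; split => //; have m1 := out_map_inv HP bl m'.
have := out_map_comp (subgroupV subH HP) (subgroupM subH HP' HP) bl' m1 m.
by rewrite mulgK.
Qed.

(** The neighbourhoods of a bi-infinite line modulo [G]: the line [l] contains a
    translate of the segment between [x] and [y]. *)
Definition crosses l x y := exists g, tight_path l (act g x) /\ tight_path l (act g y).

(** If the far points [x'] and [y'] of [l] have images that are near points of [l'']
    well beyond [x] and [y], then the image of any line through [x'] and [y'] runs
    close to those points too, hence through [x] and [y] by [segment_stable]. *)
Lemma out_map_continuous Phi l l'' x y : H Phi -> biinfinite l ->
  out_map Phi l l'' -> tight_path l'' x -> tight_path l'' y ->
  exists x' y', [/\ tight_path l x', tight_path l y' & forall l1 l2,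
    biinfinite l1 -> crosses l1 x' y' -> out_map Phi l1 l2 -> crosses l2 x y].
Proof.
move=> HP bl [f rf lm]; have [c sc] := biinfinite_spans bl.
have [C hC] := line_map_shadow HP rf; have [c1 [l1 [s1 sh1 _ u1]]] := hC _ _ sc.
have e1 := u1 _ lm; subst l1; have [hc1 _] := s1.
rewrite (tight_path_spans s1) => -[sx _ ex] [sy _ ey].
have [_ h1 h2] := sh1; pose M := `|sx| + `|sy| + 2 * C + 1.
have [t1 /(_ _ (lexx _))[r1 [Mr1 hr1]]] := h1 M.
have [t2 /(_ _ (lexx _))[r2 [Mr2 hr2]]] := h2 M.
exists (c (- t2)), (c t1).
have tc t : tight_path l (c t) by rewrite (tight_path_spans sc); exists t.
split => // l1 l2 bl1 [g [gx gy]] [f2 rf2 lm2].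
have [p sp] := biinfinite_spans bl1.
have [p1 [m1 [q1 k1 lm1 _]]] := hC _ _ sp.
have [C2 hC2] := line_map_shadow HP rf2.
have [p2 [m2 [q2 k2 _ u2]]] := hC2 _ _ sp; have e2 := u2 _ lm2; subst m2.
have [h [D hD]] := representative_close rf rf2.
have [hp1 _] := q1.
have [l3 q3] := geodesic_line_spans (geodesic_act h hp1).
have e3 : l2 = l3.
  apply: (@shadow_line_uniq _ (D + C) _ _ _ _ _ _ k2 q2 q3) => t.
  have [k11 _ _] := k1; have [s hs] := k11 t; exists s => /=.
  rewrite -(act_isom h) in hs; have := hD (p t).
  by have := metric_triangle (f2 (p t)) (act h (f (p t))) (act h (p1 s)); mlra.
have [a Pa ea] := rf.2.
have near t : tight_path l1 (act g (c t)) -> exists s,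
    mdist (f (c t)) (act (a g)^-1%g (p1 s)) <= C.
  rewrite (tight_path_spans sp) => -[u _ eu]; have [k11 _ _] := k1.
  have [s hs] := k11 u; exists s.
  by rewrite -(act_isom (a g)) actVK -ea -eu.
have [v1 hv1] := near _ gx; have [v2 hv2] := near _ gy.
have key s : `|s| <= `|sx| + `|sy| -> tight_path l2 (act (h * a g)%g (c1 s)).
  move=> hs; have ns1 := ler_norm s; have ns2 := ler_norm (- s); rewrite normrN in ns2.
  have C0 : 0 <= C by apply: le_trans hr1; exact: mdist_ge0.
  have S : segment (c1 (- r2)) (c1 r1) (c1 s).
    by apply: segment_geodesic => //; rewrite /M in Mr1 Mr2; lra.
  have S' : segment (act (a g)^-1%g (p1 v1)) (act (a g)^-1%g (p1 v2)) (c1 s).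
    apply: (segment_stable treeT S).
      have := metric_triangle (c1 (- r2)) (f (c (- t2))) (act (a g)^-1%g (p1 v1)).
      rewrite (geodesic_dist hc1); rewrite /M in Mr1 Mr2; last by lra.
      by mlra.
    have := metric_triangle (c1 r1) (f (c t1)) (act (a g)^-1%g (p1 v2)).
    rewrite (metric_sym (c1 r1) (c1 s)) (geodesic_dist hc1); rewrite /M in Mr1 Mr2; last by lra.
    by mlra.
  have S2 : segment (p1 v1) (p1 v2) (act (a g) (c1 s)).
    by rewrite -(segment_actE (a g)^-1%g) actK.
  have q : tight_path m1 (act (a g) (c1 s)).
    apply: (segment_tight_path (spans_biinfinite q1) _ _ S2);
      rewrite (tight_path_spans q1); first by exists v1.
    by exists v2.
  move: q; rewrite e3 (tight_path_spans q1) (tight_path_spans q3) => -[w _ ew].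
  by exists w => //; rewrite actM -ew.
exists (h * a g)%g; rewrite -ex -ey; split; apply: key.
  by rewrite lerDl.
by rewrite lerDr.
Qed.

End OutAction.

(** * Axes of loxodromic elements *)

Section Axes.
Variables (R : realType) (G : groupType) (T : gtree R G).
Variables (k : nat) (Gs : 'I_k -> set G).
Hypothesis OS : outer_space T Gs.
Implicit Types (x y z u v w o : T) (g h : G) (s t M D : R) (l : line T).
Implicit Types (c al be : R -> T).

Local Notation treeT := (@gtree_tree R G T).
Local Notation V := (@vertex R G T).

(** The elements without fixed points, which are the ones with an axis. *)
Definition loxodromic g := forall x, act g x <> x.

Definition translates g al (tau : R) :=
  geodesic_line al /\ forall t, act g (al t) = al (t + tau).

Lemma translates_opp g al tau : translates g al tau -> translates g^-1%g (al \o -%R) tau.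
Proof.
move=> [ha hg]; split; first exact: geodesic_opp.
by move=> t /=; apply: (@act_inj R G T g); rewrite actVK hg; congr al; lra.
Qed.

Lemma translates_act h g al tau : translates g al tau ->
  translates (h * g / h)%g (act h \o al) tau.
Proof.
move=> [ha hg]; split; first exact: geodesic_act.
by move=> t /=; rewrite -actM mulgVK actM hg.
Qed.

Lemma translates_exp g al tau n : translates g al tau ->
  translates (g ^+ n)%g al (n%:R * tau).
Proof.
move=> [ha hg]; split => // t.
elim: n t => [|n IH] t; first by rewrite expg0 act1 mul0r addr0.
by rewrite expgSr actM hg IH; congr al; rewrite -natr1; lra.
Qed.

(** A point where [g] moves along a local geodesic: on the segment from [x] to
    [act g x], one takes away at both ends what cancels with the next segment.  If
    half of the segment cancels, its midpoint is fixed. *)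
Lemma loxodromic_local g : loxodromic g -> exists z, segment z (act g (act g z)) (act g z).
Proof.
move=> hg; have [x _] : [set: T] !=set0 by case: treeT.
have [d ed] : exists d, mdist x (act g x) = d by exists (mdist x (act g x)).
have d0 : 0 < d by rewrite -ed mdist_gt0; apply/eqP => e; apply: (hg x).
have dg : mdist (act g x) (act g (act g x)) = d by rewrite act_isom.
have [w [w1 w2 w3]] := median treeT (act g x) x (act g (act g x)).
have [p ep] : exists p, mdist (act g x) w = p by exists (mdist (act g x) w).
have p0 : 0 <= p by rewrite -ep mdist_ge0.
have [hw|hw] := leP (d / 2) p.
  have [m [m1 m2]] := @point_at _ _ treeT (act g x) x (d / 2)
    ltac:(rewrite metric_sym ed; apply/andP; split; lra).
  case: (hg m).
  have gm1 : mdist (act g x) (act g m) = d / 2 by rewrite act_isom; mlra.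
  have gm2 : segment (act g x) (act g (act g x)) (act g m).
    by rewrite segment_actE; exact: segment_sym.
  have [h1 _] := segment_order treeT m1 w1 ltac:(rewrite m2 ep; exact: hw).
  have [h2 _] := segment_order treeT gm2 w2 ltac:(rewrite gm1 ep; exact: hw).
  by apply: (segment_uniq treeT h2 h1); rewrite gm1 m2.
have [z [z1 z2]] := @point_at _ _ treeT x (act g x) p
  ltac:(rewrite ed; apply/andP; split; lra).
have gz : act g z = w.
  apply: (segment_uniq treeT _ w2); first by rewrite segment_actE.
  by rewrite act_isom z2.
exists z; rewrite gz.
have [w' ew'] : exists w', act g w = w' by exists (act g w).
rewrite ew'.
have e1 : mdist (act g (act g x)) w' = p by rewrite -ew' act_isom.
have s1 : segment (act g (act g x)) (act g x) w' by rewrite -ew' segment_actE.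
have e2 : mdist (act g (act g x)) w = d - p by mlra.
have e3 : mdist x w = d - p by mlra.
have dw' : mdist w w' = d - 2 * p.
  rewrite (mdist_segment treeT (segment_sym w2) s1) e1 e2 ger0_norm; lra.
have dzw : mdist z w = d - 2 * p.
  rewrite (mdist_segment treeT z1 (segment_sym w1)) z2 e3 ler0_norm; lra.
have e5 : mdist x (act g (act g x)) = 2 * d - 2 * p by mlra.
have := metric_triangle x z (act g (act g x)).
have := metric_triangle z w' (act g (act g x)).
have := metric_triangle z w w'.
by move=> *; mlra.
Qed.

Lemma half_axis h z (tau : R) (r : R -> T) : mdist z (act h z) = tau ->
  (forall n, segment z (act (h ^+ n.+1)%g z) (act h z)) -> is_ray r -> r 0 = z ->
  (forall t, 0 <= t -> \forall n \near \oo, segment z (act (h ^+ n)%g z) (r t)) ->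
  forall t, 0 <= t -> act h (r t) = r (t + tau).
Proof.
move=> dz hz hr r0 hn t t0; have tau0 : 0 <= tau by rewrite -dz mdist_ge0.
have t1 : 0 <= t + tau by lra.
have [N1 _ h1] := hn t t0; have [N2 _ h2] := hn _ t1.
pose n := maxn N1 N2.
have s1 : segment z (act (h ^+ n)%g z) (r t) by apply: h1; exact: leq_maxl.
have s2 : segment z (act (h ^+ n.+1)%g z) (r (t + tau)).
  by apply: h2; apply: leqW; exact: leq_maxr.
have s3 : segment (act h z) (act (h ^+ n.+1)%g z) (act h (r t)).
  by rewrite expgS actM segment_actE.
have dt s : 0 <= s -> mdist z (r s) = s by move=> s0; rewrite -r0 (ray_dist hr)// subr0.
have e1 : mdist (act h z) (act h (r t)) = t by rewrite act_isom dt.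
have h3 := hz n; have [h4 h5] := segment_trans (segment_sym h3) (segment_sym s3).
apply: (segment_uniq treeT _ s2); first exact: segment_sym.
rewrite dt//; have := metric_triangle z (act h z) (act (h ^+ n.+1)%g z).
by mlra.
Qed.

Lemma loxodromic_axis g : loxodromic g -> exists al tau, 0 < tau /\ translates g al tau.
Proof.
move=> hg; have [z hz] := loxodromic_local hg; pose tau := mdist z (act g z).
have tau0 : 0 < tau by rewrite mdist_gt0; apply/eqP => e; apply: (hg z).
have step n : segment z (act (g ^+ n.+1)%g z) (act (g ^+ n)%g z).
  elim: n => [|n IH]; first by rewrite expg0 act1; exact: segment_left.
  have h : segment (act (g ^+ n)%g z) (act (g ^+ n.+2)%g z) (act (g ^+ n.+1)%g z).
    by rewrite (expgSr g n.+1) (expgSr g n) -mulgA !actM segment_actE.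
  have n1 : act (g ^+ n)%g z != act (g ^+ n.+1)%g z.
    apply/eqP; rewrite expgSr actM => /act_inj e; exact: (hg z).
  by have [] := segment_concat treeT n1 IH h.
have dn n : mdist z (act (g ^+ n)%g z) = n%:R * tau.
  elim: n => [|n IH]; first by rewrite expg0 act1 mdistxx mul0r.
  rewrite -(step n) IH expgSr actM act_isom -/tau -natr1; lra.
have dnm n m : (n <= m)%N ->
    mdist (act (g ^+ n)%g z) (act (g ^+ m)%g z) = (m%:R - n%:R) * tau.
  by move=> nm; rewrite -{1}(subnKC nm) expgnDr actM act_isom dn natrB.
have dV n : mdist z (act (g^-1 ^+ n)%g z) = n%:R * tau.
  by rewrite -(act_isom (g ^+ n)%g) -actM expVgn mulgV act1 metric_sym dn.
have dVnm n m : (n <= m)%N ->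
    mdist (act (g^-1 ^+ n)%g z) (act (g^-1 ^+ m)%g z) = (m%:R - n%:R) * tau.
  by move=> nm; rewrite -{1}(subnKC nm) expgnDr actM act_isom dV natrB.
have far (q : nat -> T) : (forall n, mdist z (q n) = n%:R * tau) ->
    (forall n m, (n <= m)%N -> mdist (q n) (q m) = (m%:R - n%:R) * tau) ->
    forall M, exists N, forall n m, (N <= n)%N -> (N <= m)%N ->
    M <= mdist z (q n) + mdist z (q m) - mdist (q n) (q m).
  move=> q1 q2 M; have [N hN] := filter_ex (nbhs_infty_ger (`|M| / tau)).
  exists N => n m Nn Nm; wlog nm : n m Nn Nm / (n <= m)%N.
    move=> W; have [h|/ltnW h] := leqP n m; first exact: W.
    by have := W _ _ Nm Nn h; mlra.
  rewrite !q1 q2//; have h : N%:R <= n%:R :> R by rewrite ler_nat.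
  have h1 : `|M| <= n%:R * tau by rewrite -ler_pdivrMr//; exact: le_trans h.
  have := ler_norm M; have := normr_ge0 M; lra.
have ho : \forall n \near \oo, segment (act (g^-1 ^+ n)%g z) (act (g ^+ n)%g z) z.
  apply: nearW => n; rewrite /segment/= dn metric_sym dV.
  rewrite -(act_isom (g ^+ n)%g (act _ z)) -!actM expVgn mulgV act1.
  by rewrite -expgnDr dn natrD; lra.
have [c [hc c0 cp cn]] := limit_line treeT (far _ dV dVnm) (far _ dn dnm) ho.
exists c, tau; split => //; split => //.
have pos t : 0 <= t -> act g (c t) = c (t + tau).
  apply: (@half_axis g z tau c) => //.
  elim=> [|n IH]; first by rewrite expg1; exact: segment_right.
  by have [] := segment_trans (step n.+1) IH.
have neg t : 0 <= t -> act g^-1%g (c (- t)) = c (- (t + tau)).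
  apply: (@half_axis g^-1%g z tau (c \o -%R)) => //=.
  - by rewrite -(act_isom g) actVK metric_sym.
  - elim=> [|n IH]; first by rewrite expg1; exact: segment_right.
    have h : segment z (act (g^-1 ^+ n.+2)%g z) (act (g^-1 ^+ n.+1)%g z).
      by rewrite /segment/= !dV dVnm//; lra.
    by have [] := segment_trans h IH.
  - exact: geodesic_ray (geodesic_opp hc).
  - by rewrite oppr0.
move=> t; have [t0|/ltW t0] := leP 0 t; first exact: pos.
have [t1|/ltW t1] := leP (- tau) t; last first.
  have := neg (- t - tau) ltac:(lra); rewrite subrK opprK => e.
  by rewrite -e actVK; congr c; lra.
have e1 : act g (c (- tau)) = c 0.
  by have := neg 0 (lexx _); rewrite oppr0 add0r => <-; rewrite actVK.
have e2 : act g (c 0) = c tau by rewrite pos// add0r.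
have s1 : segment (c 0) (c tau) (act g (c t)).
  by rewrite -e1 -e2 segment_actE; apply: segment_geodesic => //; rewrite t1 t0.
apply: (segment_uniq treeT s1); first by apply: segment_geodesic => //; lra.
by rewrite -e1 act_isom e1 !(geodesic_dist hc); lra.
Qed.

(** By minimality no half-tree misses an orbit: the points whose orbit avoids the
    part of the tree beyond [y] as seen from [x] form an invariant convex set. *)
Lemma orbit_beyond x y z : exists h, segment x (act h z) y.
Proof.
apply: contrapT => hn; pose S : set T := [set p | forall h, ~ segment x (act h p) y].
have [_ /(_ S) min _] := OS.
suff : S y by move=> /(_ 1%g); rewrite act1; apply; exact: segment_right.
rewrite min//; first by exists z => h hz; apply: hn; exists h.
  move=> p q Sp Sq w hw h; apply: (segment_avoid treeT _ (Sp h) (Sq h)).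
  by rewrite segment_actE.
by move=> g p Sp h; rewrite -actM; exact: Sp.
Qed.

(** One of the two halves of a line through a point beyond [y] stays beyond [y], the
    remaining part of the tree being convex. *)
Lemma ray_beyond x y al : geodesic_line al -> exists h be,
  (be = al \/ be = al \o -%R) /\ forall t, 0 <= t -> segment x (act h (be t)) y.
Proof.
move=> ha; have [h hh] := orbit_beyond x y (al 0); exists h.
have [H|H] := pselect (forall t, 0 <= t -> segment x (act h (al t)) y).
  by exists al; split => //; left.
exists (al \o -%R); split; first by right.
move=> t t0; apply: contrapT => /= h1; apply: H => s s0; apply: contrapT => h2.
have h3 : segment (act h (al (- t))) (act h (al s)) (act h (al 0)).
  by rewrite segment_actE; apply: segment_geodesic => //; lra.
exact: (segment_avoid treeT h3 h1 h2 hh).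
Qed.

(** The rays beyond [x] and beyond [y] on translates of [al], provided by
    [ray_beyond], are joined through the segment. *)
Lemma connecting_line x y al : x != y -> geodesic_line al -> exists c,
  [/\ geodesic_line c, range c x, range c y & exists D h h',
    (forall t, D <= t -> exists u : R, c t = act h (al u)) /\
    (forall t, t <= - D -> exists u : R, c t = act h' (al u))].
Proof.
move=> xy ha.
have [h [be [ebe hb]]] := ray_beyond x y ha.
have [h' [be' [ebe' hb']]] := ray_beyond y x ha.
have hbe : geodesic_line (act h \o be).
  by apply: geodesic_act; case: ebe => ->; last exact: geodesic_opp.
have hbe' : geodesic_line (act h' \o be').
  by apply: geodesic_act; case: ebe' => ->; last exact: geodesic_opp.
have ho : \forall n \near \oo, segment (act h' (be' n%:R)) (act h (be n%:R)) y.
  apply: nearW => n.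
  have s1 := hb n%:R (ler0n _ _); have s2 := hb' n%:R (ler0n _ _).
  by have [] := segment_concat treeT xy (segment_sym s2) s1.
have [c [hc c0 cp cn]] := limit_line treeT
  (ray_products y (geodesic_ray hbe')) (ray_products y (geodesic_ray hbe)) ho.
have on (q : R -> T) (r : R -> T) (hq : geodesic_line q) (hr : is_ray r) :
    r 0 = y -> (forall t, 0 <= t -> \forall n \near \oo, segment y (q n%:R) (r t)) ->
    forall t, mdist y (q 0) + 1 <= t -> exists u : R, r t = q u.
  move=> r0 hn t ht; have t0 : 0 <= t by have := mdist_ge0 y (q 0); lra.
  have [n sn] := filter_ex (hn t t0).
  have dt : mdist y (r t) = t by rewrite -r0 (ray_dist hr)// subr0.
  case: (segment_union treeT (q 0) sn) => s1.
    by exfalso; have := mdist_ge0 (r t) (q 0); mlra.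
  by have [u [_ ->]] := geodesic_on_segment treeT hq (ler0n _ n) s1; exists u.
have par (f : R -> T) b : b = al \/ b = al \o -%R -> forall g (u : R), exists u' : R,
    act g (b u) = act g (al u').
  by case=> -> g u; [exists u|exists (- u)].
exists c; split => //.
- exists (- mdist x y) => //.
  have [n sn] := filter_ex (cn _ (mdist_ge0 x y)).
  apply: (segment_uniq treeT sn (hb' n%:R (ler0n _ _))).
  rewrite -c0 metric_sym (geodesic_dist hc); last by rewrite oppr_le0 mdist_ge0.
  by rewrite c0 sub0r opprK metric_sym.
- by exists 0.
- pose D := Num.max (mdist y (act h (be 0)) + 1) (mdist y (act h' (be' 0)) + 1).
  exists D, h, h'; split => t ht.
    have [||u ->] := on _ c hbe (geodesic_ray hc) c0 _ t; [exact: cp | |exact: par].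
    by apply: le_trans ht; rewrite le_max lexx.
  have [|||u] := on _ (c \o -%R) hbe' (geodesic_ray (geodesic_opp hc)) _ _ (- t).
  + by rewrite /= oppr0.
  + exact: cn.
  + apply: (@le_trans _ _ D); last by rewrite lerNr.
    by rewrite le_max lexx orbT.
  + by rewrite /= opprK => ->; exact: par.
Qed.

End Axes.

(** * Lines determined by a segment *)

Section Overlaps.
Variables (R : realType) (G : groupType) (T : gtree R G).
Variables (k : nat) (Gs : 'I_k -> set G).
Hypothesis OS : outer_space T Gs.
Implicit Types (x y z : T) (g h : G) (s t u v w M D lam tau : R) (l : line T).
Implicit Types (c al be : R -> T).

Local Notation treeT := (@gtree_tree R G T).
Local Notation V := (@vertex R G T).

(** The condition that fails for generic lines: modulo [G] the lines that cross the
    segment between [x] and [y] have all segments of [l] in common. *)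
Definition determines l x y := forall l', biinfinite l' -> crosses l' x y ->
  forall p q, tight_path l p -> tight_path l q -> crosses l' p q.

(** A line through the segment whose ends follow translates of [al] crosses every
    long segment of [l], and the part of it off the translates of [al] has bounded
    length. *)
Lemma determined_overlap l x y al : x != y -> determines l x y ->
  geodesic_line al -> exists D, 0 <= D /\ forall M p q, 0 <= M ->
    tight_path l p -> tight_path l q -> 2 * M + 2 * D <= mdist p q ->
    exists p' q' h u u', [/\ segment p q p', segment p q q', M <= mdist p' q',
      p' = act h (al u) & q' = act h (al u')].
Proof.
move=> xy det ha.
have [c [hc [sx _ ex] [sy _ ey] [D0 [h1 [h2 [H1 H2]]]]]] := connecting_line OS xy ha.
pose D := Num.max 0 D0; have D00 : 0 <= D by rewrite le_max lexx.
have DD : D0 <= D by rewrite le_max lexx orbT.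
exists D; split => // M p q M0 lp lq dpq.
have [l' sl'] := geodesic_line_spans hc.
have cr : crosses l' x y.
  by exists 1%g; rewrite !act1 (tight_path_spans sl'); split; [exists sx|exists sy].
have [g [gp gq]] := det _ (spans_biinfinite sl') cr _ _ lp lq.
move: gp gq; rewrite (tight_path_spans sl') => -[s _ es] [t _ et].
clear det lp lq; wlog st : p q s t es et dpq / s <= t.
  move=> W; have [st|/ltW st] := leP s t; first exact: (W p q s t).
  have [|p' [q' [h [u [u' [k1 k2 k3 k4 k5]]]]]] := W q p t s et es _ st.
    by rewrite metric_sym.
  by exists p', q', h, u, u'; split => //; exact: segment_sym.
have dst : mdist p q = t - s by rewrite -(act_isom g) -es -et (geodesic_dist hc).
have sub r : s <= r <= t -> segment p q (act g^-1%g (c r)).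
  by move=> rI; rewrite -(segment_actE g) actVK -es -et; exact: segment_geodesic.
have fin r r' h : s <= r -> r <= r' -> r' <= t -> M <= r' - r ->
    (exists u : R, c r = act h (al u)) -> (exists u : R, c r' = act h (al u)) ->
    exists p' q' h u u', [/\ segment p q p', segment p q q', M <= mdist p' q',
      p' = act h (al u) & q' = act h (al u')].
  move=> sr rr' r't hM [u hu] [u' hu'].
  exists (act g^-1%g (c r)), (act g^-1%g (c r')), (g^-1 * h)%g, u, u'; split.
  - by apply: sub; lra.
  - by apply: sub; lra.
  - by rewrite act_isom (geodesic_dist hc).
  - by rewrite hu actM.
  - by rewrite hu' actM.
have [h|h] := leP (D + M) t.
  by apply: (fin (t - M) t h1); [lra|lra|lra|lra|apply: H1; lra|apply: H1; lra].
by apply: (fin s (s + M) h2); [lra|lra|lra|lra|apply: H2; lra|apply: H2; lra].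
Qed.

(** On the first unit of the common part both products act as the translation by
    [tau + tau'], and fixing a point inside an edge forces the commutator to be
    trivial. *)
Lemma axes_commute g g' al be tau tau' s u :
  translates g al tau -> translates g' be tau' -> 0 <= tau -> 0 <= tau' ->
  (forall v, 0 <= v <= tau + tau' + 1 -> al (s + v) = be (u + v)) -> commute g g'.
Proof.
move=> [ha hg] [hb hg'] t0 t0' e.
have n1 : al s != al (s + 1).
  by rewrite -mdist_gt0 (geodesic_dist ha); lra.
have [z [hz nVz]] := nonvertex_between n1.
have s1 : s <= s + 1 by lra.
have [r [rI ez]] := geodesic_on_segment treeT ha s1 hz.
have /fix_nonvertex : act ((g' * g)^-1 * (g * g'))%g z = z.
  rewrite !actM; apply: (@act_inj R G T (g' * g)%g); rewrite actVK actM ez.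
  have e0 := e (r - s) ltac:(lra); have e1 := e (r - s + tau') ltac:(lra).
  have e2 := e (r - s + tau) ltac:(lra).
  have e3 := e (r - s + tau + tau') ltac:(lra).
  have E1 : al r = be (u + (r - s)) by rewrite -e0; congr al; lra.
  rewrite {1}E1 hg'.
  rewrite (_ : u + (r - s) + tau' = u + (r - s + tau')); last by lra.
  rewrite -e1 !hg (_ : r + tau = s + (r - s + tau)); last by lra.
  rewrite e2 hg' (_ : u + (r - s + tau) + tau' = u + (r - s + tau + tau')); last by lra.
  by rewrite -e3; congr al; lra.
move=> /(_ _ _ OS nVz) E; rewrite /commute.
by apply: (@mulgI _ (g' * g)^-1%g); rewrite E mulVg.
Qed.

(** Up to inversion of the element, its axis may be traversed in the direction of a
    given segment. *)
Lemma orient_axis g be tau u u' : translates g be tau -> exists g' be' w,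
  [/\ g' = g \/ g' = g^-1%g, translates g' be' tau, be' w = be u &
      be' (w + mdist (be u) (be u')) = be u'].
Proof.
move=> tr; have [hb _] := tr; have [uu|/ltW uu] := leP u u'.
  exists g, be, u; split => //; first by left.
  by rewrite (geodesic_dist hb uu); congr be; lra.
exists g^-1%g, (be \o -%R), (- u); split => //; first by right.
- exact: translates_opp.
- by rewrite /= opprK.
- by rewrite /= metric_sym (geodesic_dist hb uu); congr be; lra.
Qed.

(** A long segment of [l] has a long part on a translate of the axis of [g1], and this
    part, being on [l], has a long part on a translate of the axis of [g2]. *)
Lemma determined_commute l x y g1 g2 : x != y -> biinfinite l -> determines l x y ->
  loxodromic T g1 -> loxodromic T g2 -> exists h, commute (h * g1 / h)%g g2.
Proof.
move=> xy /biinfinite_spans[c sc] det lx1 lx2; have [hc _] := sc.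
have [al1 [t1 [t10 tr1]]] := loxodromic_axis lx1.
have [al2 [t2 [t20 tr2]]] := loxodromic_axis lx2.
have [ha1 _] := tr1; have [ha2 _] := tr2.
have [D1 [D10 ov1]] := determined_overlap xy det ha1.
have [D2 [D20 ov2]] := determined_overlap xy det ha2.
(* [M] is the overlap that [axes_commute] asks for. *)
pose M := t1 + t2 + 1; pose L := 2 * (2 * M + 2 * D2) + 2 * D1.
have M0 : 0 <= M by rewrite /M; lra.
have L0 : 0 <= L by rewrite /L; lra.
have lc t : tight_path l (c t) by rewrite (tight_path_spans sc); exists t.
have [||p' [q' [h1 [u1 [u1' [s1 s1' d1 e1 e1']]]]]] :=
  ov1 (2 * M + 2 * D2) (c 0) (c L) _ (lc _) (lc _).
- by lra.
- by rewrite (geodesic_dist hc L0) /L; lra.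
have bl := spans_biinfinite sc.
have lp' := segment_tight_path bl (lc 0) (lc L) s1.
have lq' := segment_tight_path bl (lc 0) (lc L) s1'.
have [p [q [h2 [u2 [u2' [s2 s2' d2 e2 e2']]]]]] := ov2 M p' q' M0 lp' lq' d1.
have hb1 := geodesic_act h1 ha1.
have on z : segment p' q' z -> exists w, z = act h1 (al1 w).
  move=> hz; rewrite e1 e1' in hz; have [uu|/ltW uu] := leP u1 u1'.
    by have [w [_ ->]] := geodesic_on_segment treeT hb1 uu hz; exists w.
  by have [w [_ ->]] := geodesic_on_segment treeT hb1 uu (segment_sym hz); exists w.
have [w1 ew1] := on p s2; have [w1' ew1'] := on q s2'.
have [k1 [b1 [v1 [ek1 T1 f1 f1']]]] := orient_axis w1 w1' (translates_act h1 tr1).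
have [k2 [b2 [v2 [ek2 T2 f2 f2']]]] := orient_axis u2 u2' (translates_act h2 tr2).
rewrite /= -ew1 -ew1' in f1 f1'; rewrite /= -e2 -e2' in f2 f2'.
have cm : commute k1 k2.
  apply: (@axes_commute k1 k2 b1 b2 t1 t2 v1 v2) => //; try exact: ltW.
  move=> v vI; have [hb1' _] := T1; have [hb2 _] := T2.
  have vd : v <= mdist p q by rewrite /M in d2; lra.
  apply: (@segment_uniq _ _ treeT p q).
  - by rewrite -f1 -f1'; apply: segment_geodesic => //; lra.
  - by rewrite -f2 -f2'; apply: segment_geodesic => //; lra.
  - by rewrite -{1}f1 -f2 !geodesic_dist//; lra.
have cm' : commute (h1 * g1 / h1)%g (h2 * g2 / h2)%g.
  have V1 (a b : G) : commute a b -> commute a^-1%g b.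
    by move=> h; apply/commute_sym/commuteV/commute_sym.
  case: ek1 cm => ->; case: ek2 => -> //.
  - by move=> /commuteV; rewrite invgK.
  - by move=> /V1; rewrite invgK.
  - by move=> /V1; rewrite invgK => /commuteV; rewrite invgK.
exists (h2^-1 * h1)%g; move: cm'; set X := (h1 * g1 / h1)%g => cm'.
have -> : (h2^-1 * h1 * g1 / (h2^-1 * h1))%g = (h2^-1 * X * h2)%g.
  by rewrite /X invgM invgK !mulgA.
rewrite /commute; transitivity (h2^-1 * (X * (h2 * g2 / h2)) * h2)%g.
  by rewrite !mulgA mulgVK.
by rewrite cm' !mulgA mulVg mul1g.
Qed.

(** An element that commutes with [g] maps the axis of [g] to a line at bounded
    distance, hence to itself, and cannot reverse it. *)
Lemma centralizer_translates g h al tau : translates g al tau -> 0 < tau ->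
  commute g h -> exists lam, translates h al lam.
Proof.
move=> tr t0 cm; have [ha hg] := tr; have hh := geodesic_act h ha.
have on : forall t, exists u, act h (al t) = al u.
  apply: (@line_stable _ _ treeT _ _ (mdist (act h (al 0)) (al 0)) hh ha) => M.
    have [n hn] := filter_ex (nbhs_infty_ger (M / tau)).
    exists (n%:R * tau); split; first by rewrite -ler_pdivrMr.
    exists (n%:R * tau); have [_ gn] := translates_exp n tr.
    rewrite /= -(add0r (n%:R * tau)) -gn -actM (commuteX n (commute_sym cm)).
    by rewrite actM act_isom.
  have [n hn] := filter_ex (nbhs_infty_ger (M / tau)).
  exists (- (n%:R * tau)); split; first by rewrite lerN2 -ler_pdivrMr.
  exists (- (n%:R * tau)); have [_ gn] := translates_exp n (translates_opp tr).
  have := gn 0; rewrite /= add0r oppr0 => <-.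
  have cm2 := commuteX n (commuteV (commute_sym cm)).
  by rewrite /= -actM cm2 actM act_isom.
have [a [ha'|ha']] := geodesic_param hh ha on; exists a; split => // t.
  by have := ha' t => /= ->; rewrite addrC.
exfalso; have := ha' (0 + tau); rewrite /= -hg -actM -cm actM.
have -> : act h (al 0) = al a by have := ha' 0; rewrite subr0.
rewrite hg => /(congr1 (mdist (al (a + tau)))).
by rewrite mdistxx metric_sym (geodesic_dist ha); lra.
Qed.

Lemma translates_inj g h al lam : translates g al lam -> translates h al lam -> g = h.
Proof.
move=> [ha hg] [_ hh].
have n1 : al 0 != al 1 by rewrite -mdist_gt0 (geodesic_dist ha); lra.
have [z [hz nVz]] := nonvertex_between n1.
have [r [_ ez]] := geodesic_on_segment treeT ha ler01 hz.
have E : (h^-1 * g)%g = 1%g.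
  by apply: (fix_nonvertex OS nVz); rewrite actM ez hg -hh actK.
by apply: (@mulgI _ h^-1%g); rewrite E mulVg.
Qed.

Lemma translates_mul g h al lam mu : translates g al lam -> translates h al mu ->
  translates (g * h)%g al (lam + mu).
Proof.
move=> [ha hg] [_ hh]; split => // t; rewrite actM hh hg; congr al; lra.
Qed.

Lemma translates_inv g al lam : translates g al lam -> translates g^-1%g al (- lam).
Proof.
move=> [ha hg]; split => // t; apply: (@act_inj R G T g); rewrite actVK hg.
by congr al; lra.
Qed.

Lemma vertex_on_line al : geodesic_line al -> exists t, V (al t).
Proof.
move=> ha; have [h|h] := pselect (V (al 0)); first by exists 0.
have [_ _ /(_ _ h)[u [v [euv hx _]]]] := gtree_simplicial T.
have [_ Vu Vv _] := euv; pose L := mdist u v + 1.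
have L0 : 0 <= L by rewrite /L; have := mdist_ge0 u v; lra.
case: (leave_edge (al L) h euv hx) => hL.
- by have [t [_ et]] := geodesic_on_segment treeT ha L0 hL; exists t; rewrite -et.
- by have [t [_ et]] := geodesic_on_segment treeT ha L0 hL; exists t; rewrite -et.
exfalso; have d : mdist (al 0) (al L) = L by rewrite (geodesic_dist ha)// subr0.
have := mdist_segment treeT hx hL; rewrite d /L.
have := mdist_ge0 u (al 0); have := mdist_ge0 (al 0) v.
have := mdist_ge0 u (al L); have := mdist_ge0 (al L) v.
by have [?|?] := ger0P (mdist u (al 0) - mdist u (al L)) => *; mlra.
Qed.

Lemma finite_min (r : seq R) (P : R -> Prop) : (forall t, P t -> t \in r) ->
  (exists t, P t) -> exists m, P m /\ forall t, P t -> m <= t.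
Proof.
elim: r P => [|a r IH] P Pr [t Pt]; first by have := Pr t Pt.
have [[b [Pb ba]]|h] := pselect (exists b, P b /\ b != a); last first.
  have all_a b : P b -> b = a.
    by move=> Pb; apply/eqP/negP => /negP ba; apply: h; exists b.
  by exists t; split => // b Pb; rewrite (all_a _ Pb) (all_a _ Pt).
have [||m [[Pm ma] hm]] := IH (fun b => P b /\ b != a).
- by move=> b0 [/Pr]; rewrite inE => /orP[->|].
- by exists b.
have [Pa|nPa] := pselect (P a); last first.
  exists m; split => // b0 Pb0; apply: hm; split => //.
  by apply/eqP => e; subst.
have [am|/ltW ma'] := leP a m.
  exists a; split => // b0 Pb0; have [->//|n] := eqVneq b0 a.
  exact: le_trans am (hm _ (conj Pb0 n)).
exists m; split => // b0 Pb0; have [->//|n] := eqVneq b0 a.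
exact: hm.
Qed.

(** Translation lengths along an axis are discrete, since translations permute
    the vertices of the axis; hence the centraliser is cyclic. *)
Lemma centralizer_cyclic g al tau : translates g al tau -> 0 < tau ->
  exists (c : G) lam, [/\ 0 < lam, translates c al lam & forall h, commute g h ->
    exists n, h = (c ^+ n)%g \/ h = (c ^- n)%g].
Proof.
move=> tr t0; have [ha _] := tr; have [s0 Vs0] := vertex_on_line ha.
have [_ /(_ (al s0) (al (s0 + tau)))/finite_seqP[q hq] _] := gtree_simplicial T.
pose P lam := 0 < lam <= tau /\ exists h, commute g h /\ translates h al lam.
have [||m [[mI [c [cm trc]]] hm]] := @finite_min [seq mdist (al s0) z | z <- q] P.
- move=> lam [lI [h [_ [_ hh]]]]; apply/mapP; exists (al (s0 + lam)).
    suff : [set` q] (al (s0 + lam)) by [].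
    rewrite -hq; split; first by apply: segment_geodesic => //; lra.
    by rewrite -hh -vertex_act.
  by rewrite (geodesic_dist ha); lra.
- by exists tau; split; [rewrite t0 lexx | exists g; split].
have m0 : 0 < m by case/andP: mI.
have key h lam : 0 <= lam -> commute g h -> translates h al lam ->
    exists n, h = (c ^+ n)%g.
  move=> l0 ch trh; pose n := Num.Def.trunc (lam / m).
  have /andP[n1 n2] : n%:R <= lam / m < n.+1%:R by apply: truncn_itv; rewrite divr_ge0// ltW.
  rewrite ler_pdivlMr// in n1; rewrite ltr_pdivrMr// -natr1 mulrDl mul1r in n2.
  have tr' := translates_mul trh (translates_inv (translates_exp n trc)).
  exists n; have [e|e] := eqVneq lam (n%:R * m).
    by rewrite e in trh; exact: translates_inj trh (translates_exp n trc).
  have /hm : P (lam - n%:R * m).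
    split.
      apply/andP; split; last first.
        by case/andP: mI => _; apply: le_trans; rewrite lerBlDl ltW.
      by rewrite subr_gt0 lt_neqAle eq_sym e.
    exists (h * (c ^+ n)^-1)%g; split => //.
    by apply: commuteM => //; apply/commuteV/commuteX.
  by rewrite lerBrDl leNgt n2.
exists c, m; split => // h ch; have [lam trh] := centralizer_translates tr t0 ch.
have [l0|/ltW l0] := leP 0 lam.
  by have [n ->] := key _ _ l0 ch trh; exists n; left.
have [||n e] := key h^-1%g (- lam) _ _ (translates_inv trh).
- by rewrite oppr_ge0.
- exact: commuteV.
by exists n; right; rewrite -e invgK.
Qed.

(** Conjugation does not change the growth of distances along powers. *)
Lemma translation_conj_pow (c : G) h al lam m : translates c al lam -> 0 < lam ->
  (h * c / h)%g = (c ^+ m)%g \/ (h * c / h)%g = (c ^- m)%g -> m = 1%N.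
Proof.
move=> tr l0 E; have [ha _] := tr.
have dn n : mdist (al 0) (act (c ^+ n)%g (al 0)) = n%:R * lam.
  have [_ ->] := translates_exp n tr; rewrite add0r (geodesic_dist ha) ?subr0//.
  by rewrite mulr_ge0// ltW.
have dV n : mdist (al 0) (act (c ^- n)%g (al 0)) = n%:R * lam.
  by rewrite -(act_isom (c ^+ n)%g) actVK metric_sym dn.
pose e := mdist (al 0) (act h^-1%g (al 0)).
have d1 n : mdist (act h^-1%g (al 0)) (act (c ^+ n)%g (act h^-1%g (al 0)))
    = (n * m)%:R * lam.
  rewrite -(act_isom h) actVK -!actM -conjXgn.
  by case: E => ->; rewrite ?expVgn -expgnA mulnC ?dn ?dV.
have bound n : n%:R * lam <= (n * m)%:R * lam + 2 * e /\
    (n * m)%:R * lam <= n%:R * lam + 2 * e.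
  rewrite -d1 -dn /e; set p := act h^-1%g (al 0).
  have e1 : mdist (act (c ^+ n)%g (al 0)) (act (c ^+ n)%g p) = mdist (al 0) p.
    by rewrite act_isom.
  have := metric_triangle (al 0) p (act (c ^+ n)%g (al 0)).
  have := metric_triangle p (act (c ^+ n)%g p) (act (c ^+ n)%g (al 0)).
  have := metric_triangle p (al 0) (act (c ^+ n)%g p).
  have := metric_triangle (al 0) (act (c ^+ n)%g (al 0)) (act (c ^+ n)%g p).
  by move=> *; split; mlra.
have [n hn] := filter_ex (nbhs_infty_ger ((2 * e + 1) / lam)).
rewrite ler_pdivrMr// in hn.
have [b1 b2] := bound n; rewrite natrM in b1 b2.
have [m0|m1] := leqP m 0%N.
  exfalso; move: b1; rewrite leqn0 in m0; rewrite (eqP m0) mulr0 mul0r => b1.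
  by clear m0 E; lra.
have [m2|m2] := leqP 2%N m; last by apply/eqP; rewrite eqn_leq m1 -ltnS m2.
exfalso; have h2 : 2 <= m%:R :> R by rewrite (ler_nat _ 2).
have nl : 0 <= n%:R * lam by rewrite mulr_ge0// ltW.
by have := ler_wpM2l nl h2; clear E m1 m2 => ?; lra.
Qed.

Lemma determined_root l x y : x != y -> biinfinite l -> determines l x y ->
  (exists g, loxodromic T g) -> exists (c : G) al lam, [/\ 0 < lam, translates c al lam &
    forall g, loxodromic T g -> exists h n,
      (h * g / h)%g = (c ^+ n)%g \/ (h * g / h)%g = (c ^- n)%g].
Proof.
move=> xy bl det [g0 lx0]; have [al [tau [t0 tr]]] := loxodromic_axis lx0.
have [c [lam [l0 trc hc]]] := centralizer_cyclic tr t0.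
exists c, al, lam; split => // g lx.
have [h /commute_sym/hc[n E]] := determined_commute xy bl det lx lx0.
by exists h, n.
Qed.

End Overlaps.

(** * Translation lengths and exponential growth *)

Section TranslationLength.
Variables (R : realType) (G : groupType) (k : nat) (Gs : 'I_k -> set G).
Implicit Types (g h c b : G) (n m : nat).

(** The nontrivial elements with a fixed point are the nontrivial conjugates of
    elements of the [Gs i], whatever the tree. *)
Lemma fixed_point_transfer (T T' : gtree R G) g : outer_space T Gs ->
  outer_space T' Gs -> (exists x : T, act g x = x) -> exists x : T', act g x = x.
Proof.
move=> OS OS' [x gx].
have triv : g = 1%g -> exists x : T', act g x = x.
  by move=> ->; have [v _] := vertex_exists T'; exists v; exact: act1.
have [Vx|nVx] := pselect (vertex x); last exact/triv/(fix_nonvertex OS nVx gx).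
have [[_ _ _ tr] _ _] := OS; have [[_ ex _ _] _ _] := OS'.
have [[i [c Ec]]|hn] := pselect (exists i, conjugate (Gs i) (stab x)); last first.
  apply: triv; have E : stab x = [set 1%g] by apply: tr => // i hi; apply: hn; exists i.
  by have : stab x g := gx; rewrite E.
have [v' Vv' [e Ee]] := ex i.
have : stab x g := gx; rewrite Ec => -[y Gy ey].
have : stab v' (e * y / e)%g by rewrite Ee; exists y.
move=> hy; exists (act (c / e)%g v').
rewrite -{2}(hy : act _ v' = v') -!actM; congr (act _ v').
by rewrite -ey !mulgA !mulgVK.
Qed.

Lemma translation_length_conj (T : gtree R G) g h :
  translation_length T (h * g / h)%g = translation_length T g.
Proof.
congr inf; apply/seteqP; split => _ [x _ <-].
  exists (act h^-1%g x) => //; rewrite -(act_isom h) actVK; congr mdist.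
  by rewrite -!actM.
exists (act h x) => //; rewrite -(act_isom h x); congr mdist.
by rewrite -!actM mulgVK.
Qed.

Lemma translation_length_inv (T : gtree R G) g :
  translation_length T g^-1%g = translation_length T g.
Proof.
congr inf; apply/seteqP; split => _ [x _ <-]; exists x => //.
  by rewrite -(act_isom g x (act g^-1%g x)) actVK metric_sym.
by rewrite -(act_isom g x (act g^-1%g x)) actVK metric_sym.
Qed.

Lemma translation_length_fixed (T : gtree R G) g (x : T) : act g x = x ->
  translation_length T g <= 0.
Proof.
move=> gx; apply: ge_inf; last by exists x => //; rewrite gx mdistxx.
by exists 0 => _ [y _ <-]; exact: mdist_ge0.
Qed.

Definition conj_pow c n b := exists h,
  (h * b / h)%g = (c ^+ n)%g \/ (h * b / h)%g = (c ^- n)%g.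

Lemma conj_pow_inv c n b : conj_pow c n b -> conj_pow c n b^-1%g.
Proof.
have E h : (h * b^-1 / h)%g = ((h * b / h)^-1)%g by rewrite !invgM invgK mulgA.
by move=> [h [e|e]]; exists h; rewrite E e; [right|left; rewrite invgK].
Qed.

Lemma conj_pow_exp c n b m : conj_pow c n b -> conj_pow c (n * m) (b ^+ m)%g.
Proof.
move=> [h [e|e]]; exists h; rewrite -conjXgn e expgnA ?expVgn; first by left.
by right.
Qed.

Lemma conj_pow_conj c n b h : conj_pow c n b <-> conj_pow c n (h * b / h)%g.
Proof.
split=> -[h' hb]; [exists (h' / h)%g | exists (h' * h)%g].
  by rewrite invgM invgK !mulgA !mulgVK.
by move: hb; rewrite invgM !mulgA.
Qed.

Lemma conj_pow_trans c n m b d : conj_pow c n d -> conj_pow d m b ->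
  conj_pow c (n * m) b.
Proof.
move=> /(conj_pow_exp m) hd [h hb]; apply/(conj_pow_conj _ _ _ h).
by case: hb => ->; last exact: conj_pow_inv.
Qed.

Lemma aut_conj_pow (a : aut G) c n b : conj_pow c n b -> conj_pow (a c) n (a b).
Proof.
move=> [h hb]; exists (a h); rewrite -!aut_inverse -!aut_mul.
by case: hb => ->; [left|right]; rewrite ?aut_inverse aut_exp.
Qed.

Lemma translation_length_conj_pow (T : gtree R G) c n b : conj_pow c n b ->
  translation_length T b = translation_length T (c ^+ n)%g.
Proof.
move=> [h hb]; rewrite -(translation_length_conj T b h).
by case: hb => ->//; rewrite translation_length_inv.
Qed.

Lemma exponential_unbounded (c0 lam L : R) n0 : 0 < c0 -> 1 < lam ->
  exists n, L < c0 * lam ^+ (n + n0).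
Proof.
move=> c00 l1.
have B n : n%:R * (lam - 1) <= lam ^+ n.
  elim: n => [|n IH]; first by rewrite mul0r.
  rewrite exprS -natr1 mulrDl mul1r.
  have : 1 <= lam ^+ n by rewrite exprn_ege1// ltW.
  by nra.
have [n hn] := filter_ex (nbhs_infty_gtr (L / c0 / (lam - 1))).
have l2 : 0 < lam - 1 by rewrite subr_gt0.
exists n; rewrite mulrC -ltr_pdivrMr//.
rewrite ltr_pdivrMr// in hn; apply: lt_le_trans hn _; apply: le_trans (B n) _.
by rewrite ler_eXn2l// leq_addr.
Qed.

End TranslationLength.

Section Strictness.
Variables (R : realType) (G : groupType) (T : gtree R G).
Variables (k : nat) (Gs : 'I_k -> set G).
Hypothesis OS : outer_space T Gs.
Hypothesis FG : finitely_generated G.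
Variable H : set (out G).
Hypothesis subH : subgroup H.
Hypothesis HG : H `<=` outG Gs.
Implicit Types (x y : T) (g h : G) (a : aut G) (Phi : out G) (l : line T).

Lemma aut_fixed_point Phi a g : H Phi -> out_set Phi a ->
  (exists x : T, act g x = x) -> exists x : T, act (a g) x = x.
Proof.
move=> HP Pa [x gx].
have [f [_ [a' Pa' ea]]] := representative_exists OS FG (HG HP).
have [d ->] := out_set_inn Pa' Pa; exists (f (act d x)).
by rewrite /= -ea -actM mulgVK actM gx.
Qed.

Lemma aut_loxodromic Phi a g : H Phi -> out_set Phi a -> loxodromic T g ->
  loxodromic T (a g).
Proof.
move=> HP Pa lx x e.
have Pa' : out_set Phi^-1%g a^-1%g by exists a.
have [|y hy] := aut_fixed_point (g := a g) (subgroupV subH HP) Pa'; first by exists x.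
by apply: (lx y); move: hy; have [K _] := aut_invK a; rewrite (K g).
Qed.

Lemma translates_loxodromic g al (lam : R) : @translates R G T g al lam -> 0 < lam ->
  loxodromic T g.
Proof.
move=> tr l0 x e; have [ha _] := tr.
have [n hn] := filter_ex (nbhs_infty_gtr (2 * mdist (al 0) x / lam)).
rewrite ltr_pdivrMr// in hn.
have gx : act (g ^+ n)%g x = x.
  by elim: n {hn} => [|n IH]; rewrite ?expg0 ?act1// expgS actM IH.
have [_ /(_ 0) gn] := translates_exp n tr; rewrite add0r in gn.
have d1 : mdist (al 0) (al (n%:R * lam)) = n%:R * lam.
  by rewrite (geodesic_dist ha) ?subr0// mulr_ge0// ltW.
have d2 : mdist x (al (n%:R * lam)) = mdist x (al 0) by rewrite -gn -{1}gx act_isom.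
have := metric_triangle (al 0) x (al (n%:R * lam)).
clear e gx gn tr; mlra.
Qed.

(** Otherwise all loxodromic elements are conjugate to powers of one element [c], up
    to inversion.  An automorphism [a] and its inverse send [c] to conjugates of powers
    of it, whose exponents have product 1; so [a] preserves the class of [c] up to
    inversion, and translation lengths do not grow under its iterates. *)
Lemma not_determined Phi l x y : exponential_growth R Gs Phi -> H Phi ->
  x != y -> biinfinite l -> ~ determines l x y.
Proof.
move=> [T' [OS' [g [a [Pa [c0 [lam [c00 lam1 [N _ hN]]]]]]]]] HP xy bl det.
pose b n := iter n a g.
have lx n : (N <= n)%N -> loxodromic T (b n).
  move=> Nn x0 e; have [x1 e1] := fixed_point_transfer OS OS' (ex_intro _ x0 e).
  have := le_trans (hN n Nn) (translation_length_fixed e1).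
  by rewrite leNgt mulr_gt0// exprn_gt0// (lt_trans ltr01).
have [|c [al [mu [mu0 tr root]]]] := determined_root OS xy bl det.
  by exists (b N); exact: lx.
have lc := translates_loxodromic tr mu0.
have Pa' : out_set Phi^-1%g a^-1%g by exists a.
have [h1 [i e1]] := root _ (aut_loxodromic HP Pa lc).
have [h2 [j e2]] := root _ (aut_loxodromic (subgroupV subH HP) Pa' lc).
have ci : conj_pow c i (a c) by exists h1.
have cj : conj_pow (a c) j c.
  have : conj_pow c j (a^-1%g c) by exists h2.
  move/(aut_conj_pow a); have [_ K] := aut_invK a; by rewrite (K c).
have [h3 e3] := conj_pow_trans ci cj.
have /eqP ij := translation_conj_pow tr mu0 e3.
have i1 : i = 1%N by move: ij; rewrite muln_eq1 => /andP[/eqP].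
subst i; have [h4 [M e4]] := root _ (lx N (leqnn N)).
have bn n : conj_pow c M (b (n + N)%N).
  elim: n => [|n IH]; first by rewrite add0n; exists h4.
  by rewrite addSn /b /=; have := conj_pow_trans ci (aut_conj_pow a IH); rewrite mul1n.
have [n] := exponential_unbounded (translation_length T' (c ^+ M)%g) N c00 lam1.
rewrite ltNge => /negP; apply; rewrite -(translation_length_conj_pow T' (bn n)).
by apply: hN; rewrite /= leq_addl.
Qed.

End Strictness.

(** * Ping-pong *)

Section PingPong.
Variables (Gam : groupType) (X : Type) (K : set Gam).
Variables (op : Gam -> set X -> set X) (good : set X -> Prop).
Hypothesis subK : subgroup K.
Hypothesis op_mono : forall g A B, A `<=` B -> op g A `<=` op g B.
Hypothesis opM : forall g h A, K g -> K h -> good A -> op (g * h)%g A = op g (op h A).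
Hypothesis op1 : forall A, good A -> op 1%g A = A.
Hypothesis op_good : forall g A, K g -> good A -> good (op g A).
Variables (P Psi : Gam) (U : bool -> set X).
Hypotheses (KP : K P) (KPsi : K Psi) (goodU : forall b, good (U b)).

Definition signed (g : Gam) (b : bool) := if b then g else g^-1%g.

Local Notation p := (signed P).

Hypothesis attract : forall b, op (p b) (U b) `<=` U b.
Hypothesis strict : forall b, ~ U b `<=` op (p b) (U b).
Hypothesis hit : forall s b b', exists n j,
  op (p b' ^+ n * signed Psi s * p b ^+ j)%g (U b) `<=` U b'.

Let K_inv g : K g -> K g^-1%g. Proof. exact: subgroupV. Qed.

Let K_mul g h : K g -> K h -> K (g * h)%g. Proof. exact: subgroupM. Qed.

Let K_exp g n : K g -> K (g ^+ n)%g. Proof. exact: subgroupX. Qed.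

Let K_signed g b : K g -> K (signed g b).
Proof. by case: b => //=; exact: K_inv. Qed.

Let Kp b : K (p b). Proof. exact: K_signed. Qed.

Ltac closed := try (solve [repeat first [done | apply: K_mul | apply: K_exp |
  apply: K_signed | apply: K_inv | apply: op_good]]).

Let opV g A B : K g -> good A -> good B -> op g A `<=` op g B -> A `<=` B.
Proof.
move=> Kg gA gB /(op_mono (g := g^-1%g)).
by rewrite -!opM ?mulVg ?op1//; closed.
Qed.

Let nested b n m : (n <= m)%N -> op (p b ^+ m)%g (U b) `<=` op (p b ^+ n)%g (U b).
Proof.
move=> /subnKC<-; elim: (m - n)%N => [|i IH]; first by rewrite addn0.
rewrite addnS expgSr opM//; closed.
by apply: subset_trans IH; exact: op_mono.
Qed.

Let nested_strict b n : ~ op (p b ^+ n)%g (U b) `<=` op (p b ^+ n.+1)%g (U b).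
Proof.
rewrite expgSr opM//; closed.
by move=> /opV h; apply: (@strict b); apply: h; closed.
Qed.

Let uniform_hit : exists J, forall s b b' n j, (J <= n)%N -> (J <= j)%N ->
  op (p b' ^+ n * signed Psi s)%g (op (p b ^+ j)%g (U b)) `<=`
  op (p b' ^+ (n - J))%g (U b').
Proof.
have /choice[f hf] : forall t : bool * bool * bool, exists i, exists n j,
    (n <= i)%N /\ (j <= i)%N /\
    op (p t.2 ^+ n * signed Psi t.1.1 * p t.1.2 ^+ j)%g (U t.1.2) `<=` U t.2.
  move=> [[s b] b']; have [n [j h]] := hit s b b'.
  by exists (maxn n j), n, j; rewrite leq_maxl leq_maxr.
exists (\max_t f t) => s b b' n j Jn Jj.
have [n0 [j0 [h1 [h2 h3]]]] := hf (s, b, b'); rewrite /= in h1 h2 h3.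
have fJ : (f (s, b, b') <= \max_t f t)%N by exact: leq_bigmax.
have n0J := leq_trans h1 fJ; have j0J := leq_trans h2 fJ.
have Ks := K_signed s KPsi.
have -> : (p b' ^+ n * signed Psi s = p b' ^+ (n - n0) * (p b' ^+ n0 * signed Psi s))%g.
  by rewrite mulgA -expgnDr subnK// (leq_trans n0J).
rewrite opM//; closed.
apply: (@subset_trans _ (op (p b' ^+ (n - n0)) (U b'))); last first.
  by apply: nested; exact: leq_sub2l.
apply: op_mono; apply: subset_trans h3.
rewrite [X in _ `<=` X]opM//; closed.
by apply: op_mono; apply: nested; exact: leq_trans Jj.
Qed.

(** Large powers of [P] and of its conjugate by [Psi] play ping-pong: the first
    player moves the sets of the second, which are the translates by [Psi], into
    its own, and conversely.  The attracting sets of one player need not be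
    disjoint from one another, so that a trivial word is excluded by the strict
    nesting [strict] instead of by disjointness. *)
Lemma ping_pong : exists F : set Gam, F `<=` K /\ free_of_rank 2 F.
Proof.
have [J hJ] := uniform_hit.
pose V b := op (p b ^+ J)%g (U b).
pose N := (J + J).+1.
have gV b : good (V b) by closed.
have shrink s b b' n : (N <= n)%N ->
    op (p b' ^+ n * signed Psi s)%g (V b) `<=` op (p b') (V b').
  move=> Nn; have Jn : (J <= n)%N.
    by apply: leq_trans Nn; rewrite /N -addSn leq_addl.
  apply: (subset_trans (hJ s b b' n J Jn (leqnn J))).
  rewrite /V -opM//; closed.
  rewrite -expgS; apply: nested; rewrite leq_subRL// addnS; exact: Nn.
have strictV b : ~ V b `<=` op (p b) (V b).
  rewrite /V -opM//; closed.
  by rewrite -expgS; exact: nested_strict.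
have decV b : op (p b) (V b) `<=` V b.
  rewrite /V -opM//; closed.
  by rewrite -expgS; apply: nested.
pose A := (P ^+ N)%g.
(* The players are [x ord0 = A] and its conjugate [x ord_max] by [Psi]; [W i] are the
   sets of player [i] and [q i] is the small power by which they shrink. *)
pose c (i : 'I_2) : Gam := if i == ord0 then 1%g else Psi.
pose x (i : 'I_2) := (c i * A / c i)%g.
pose q i b := (c i * p b / c i)%g.
pose W i b := op (c i) (V b).
have Kc i : K (c i) by rewrite /c; case: ifP => _ //; case: subK.
have KA : K A by closed.
have Kx i : K (x i) by rewrite /x /q; closed.
have Kq i b : K (q i b) by rewrite /x /q; closed.
have gW i b : good (W i b) by rewrite /W; closed.
have qW i b : op (q i b) (W i b) = op (c i) (op (p b) (V b)).
  by rewrite /W -!opM//; closed; rewrite /q mulgVK.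
have strictW i b : ~ W i b `<=` op (q i b) (W i b).
  by rewrite qW => /opV h; apply: (@strictV b); apply: h; closed.
have decW i b : op (q i b) (W i b) `<=` W i b.
  by rewrite qW; apply: op_mono; exact: decV.
have xpow i n b : signed (x i ^+ n)%g b = (c i * p b ^+ (N * n) / c i)%g.
  rewrite /x conjXgn /A -expgnA; case: b => //=.
  by rewrite !invgM invgK expVgn mulgA.
have K_pow i n b : K (signed (x i ^+ n)%g b) by closed.
have move_pow i i' n b' b : (0 < n)%N -> i != i' ->
    op (signed (x i ^+ n)%g b') (W i' b) `<=` op (q i b') (W i b').
  move=> n0 ii'; rewrite qW xpow.
  have Nn : (N <= N * n)%N by rewrite leq_pmulr.
  have [s es] : exists s, ((c i)^-1 * c i')%g = signed Psi s.
    have [e|e] : i = ord0 \/ i = ord_max.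
    - by case: i {ii'} => [[|[|]]] // h; [left|right]; exact: val_inj.
    - have -> : i' = ord_max.
        by subst i; case: i' ii' => [[|[|]]] // h _; exact: val_inj.
      by exists true; rewrite e /c /= invg1 mul1g.
    - have -> : i' = ord0.
        by subst i; case: i' ii' => [[|[|]]] // h _; exact: val_inj.
      by exists false; rewrite e /c /= mulg1.
  have Kn : K (p b' ^+ (N * n))%g by closed.
  rewrite /W -opM//; last by rewrite /x /q; closed.
  rewrite -!mulgA es opM//; closed.
  by apply: op_mono; exact: shrink.
have x_inf i n : (0 < n)%N -> (x i ^+ n)%g != 1%g.
  move=> n0; apply/eqP => e; apply: (@strictW i true).
  have := xpow i n true; rewrite /= e => e'.
  have e2 : (P ^+ (N * n))%g = 1%g.
    apply: (@mulgI _ (c i)); apply: (@mulIg _ (c i)^-1%g).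
    by rewrite -e' mulg1 mulgV.
  rewrite qW; apply: op_mono; rewrite -{1}(op1 (gV true)) -e2.
  rewrite -(prednK (_ : 0 < N * n)%N); last by rewrite muln_gt0.
  rewrite expgS opM//; closed; apply: op_mono => /=.
  elim: (N * n).-1 => [|j IH]; first by rewrite op1.
  rewrite expgSr opM//; closed.
  by apply: subset_trans IH; apply: op_mono; exact: (decV true).
have letter (u : 'I_2 * Gam) : generated [set x u.1] u.2 -> u.2 != 1%g ->
    exists n b, (0 < n)%N /\ u.2 = signed (x u.1 ^+ n)%g b.
  move=> /generated_cyclic[n hn] u1.
  have n0 : (0 < n)%N.
    by rewrite lt0n; apply: contraNN u1 => /eqP e; move: hn; rewrite e expg0 invg1 => -[]->.
  by case: hn => e; [exists n, true|exists n, false].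
pose lett (u : 'I_2 * Gam) := generated [set x u.1] u.2 /\ u.2 != 1%g.
pose alt := fun u v : 'I_2 * Gam => u.1 != v.1.
have Klett u : lett u -> K u.2.
  by move=> [h1 h2]; have [n [b [_ ->]]] := letter u h1 h2.
(* A reduced word moves the sets of the player who does not own its last letter into
   the shrunk sets of the owner of its first letter. *)
have word u w i' : (forall v, v \in u :: w -> lett v) -> path alt u w ->
    (last u w).1 != i' -> K (\prod_(v <- u :: w) v.2)%g /\ exists b', forall b,
    op (\prod_(v <- u :: w) v.2)%g (W i' b) `<=` op (q u.1 b') (W u.1 b').
  elim: w u => [|v w IH] u hw /=.
    move=> _ hi; rewrite big_seq1; have [h1 h2] := hw u (mem_head _ _).
    have [n [b' [n0 e]]] := letter u h1 h2.
    split; first by apply: Klett.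
    by exists b' => b; rewrite e; exact: move_pow.
  move=> /andP[uv pw] hl.
  have [|Kw [b1 hb1]] := IH v _ pw hl.
    by move=> y yw; apply: hw; rewrite inE yw orbT.
  have lu := hw u (mem_head _ _); have [h1 h2] := lu.
  have [n [b' [n0 e]]] := letter u h1 h2.
  rewrite big_cons; split; first by apply: K_mul => //; exact: Klett.
  exists b' => b; rewrite opM//; last exact: Klett.
  apply: (@subset_trans _ (op u.2 (W v.1 b1))).
    by apply: op_mono; apply: subset_trans (hb1 b) (decW _ _).
  by rewrite e; exact: move_pow.
have word_neq u w : (forall v, v \in u :: w -> lett v) -> path alt u w ->
    (last u w).1 != u.1 -> (\prod_(v <- u :: w) v.2)%g != 1%g.
  move=> hw pw lw; apply/eqP => e; have [_ [b' hb']] := word u w u.1 hw pw lw.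
  by apply: (@strictW u.1 b'); have := hb' b'; rewrite e op1.
exists (generated (\bigcup_i generated [set x i])); split.
  move=> g; apply; first exact: subK.
  by move=> y [i _]; apply; [exact: subK|move=> _ ->].
exists x; split => [i m m0|]; first exact: x_inf.
split => [i|//|w w0 hw sw]; first exact: generated_subgroup.
case: w w0 hw sw => // u w _ hw; rewrite [sorted _ _]/= => sw.
have hw' v : v \in u :: w -> lett v by move=> /hw[].
have [e|ne] := eqVneq (last u w).1 u.1; last exact: word_neq.
apply/eqP => e1.
(* A word that begins and ends with the same player is lengthened to the word
   [w y w y^-1], which is trivial with it and ends with the other player. *)
pose j : 'I_2 := if u.1 == ord0 then ord_max else ord0.
have ju : j != u.1.
  by rewrite /j; case: ifP => [/eqP->|/negbT] //; rewrite eq_sym.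
pose y := (j, x j); pose y' := (j, (x j)^-1%g).
have ly : lett y.
  split; first by apply: generated_incl.
  by have := @x_inf j 1%N isT; rewrite expg1.
have ly' : lett y'.
  split; last by rewrite /= -(inj_eq (@invg_inj _)) invgK invg1; case: ly.
  have [h1 hM] := generated_subgroup [set x j].
  by rewrite /= -[_^-1%g]mul1g; apply: hM => //; exact: generated_incl.
have e2 : (\prod_(v <- u :: (w ++ y :: u :: rcons w y')) v.2)%g = 1%g.
  have -> : u :: (w ++ y :: u :: rcons w y') = (u :: w) ++ [:: y] ++ (u :: w) ++ [:: y'].
    by rewrite /= cats1.
  by rewrite !big_cat /= e1 !big_seq1 mul1g mul1g /= mulgV.
suff : (\prod_(v <- u :: (w ++ y :: u :: rcons w y')) v.2)%g != 1%g by rewrite e2 eqxx.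
apply: word_neq.
- move=> v; rewrite inE mem_cat inE inE mem_rcons inE.
  case/or4P=> [/eqP->|vw|/eqP->//|]; first by apply: hw'; exact: mem_head.
    by apply: hw'; rewrite inE vw orbT.
  by case/or3P => [/eqP->|/eqP->//|vw]; apply: hw'; rewrite inE ?eqxx ?vw ?orbT.
- by rewrite cat_path sw /= rcons_path sw /alt /= e ju eq_sym ju.
- by rewrite last_cat /= last_rcons.
Qed.

End PingPong.

(** * Attracting neighbourhoods *)

Section Assembly.
Variables (R : realType) (G : groupType) (T : gtree R G).
Variables (k : nat) (Gs : 'I_k -> set G) (pr : nat).
Hypothesis OS : outer_space T Gs.
Hypothesis FG : finitely_generated G.
Variable H : set (out G).
Hypothesis subH : subgroup H.
Hypothesis HG : H `<=` outG Gs.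
Implicit Types (x y z : T) (g h : G) (Phi Psi Theta : out G) (l : line T).
Implicit Types (A B U W : set (line T)).

Local Notation treeT := (@gtree_tree R G T).

(** The sets of lines on which outer automorphisms act as a group. *)
Definition saturated A := A `<=` @biinfinite R G T /\ line_invariant A.

Lemma out_image_mono Theta A B : A `<=` B -> out_image Theta A `<=` out_image Theta B.
Proof. by move=> AB l [l0 /AB Bl0 m]; exists l0. Qed.

Lemma out_imageM Theta Phi A : H Theta -> H Phi -> saturated A ->
  out_image (Theta * Phi)%g A = out_image Theta (out_image Phi A).
Proof.
move=> HT HP [bA _]; apply/seteqP; split => [l [l0 Al0 m]|l [l1 [l0 Al0 m0] m1]].
  have [l1 [bl1 m1 m2]] := out_map_factor OS FG subH HG HP HT (bA _ Al0) m.
  by exists l1 => //; exists l0.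
by exists l0 => //; apply: (out_map_comp OS FG subH HG HP HT (bA _ Al0) m0 m1).
Qed.

Lemma out_image1 A : saturated A -> out_image 1%g A = A.
Proof.
move=> [bA iA]; apply/seteqP; split => [l [l0 Al0]|l Al].
  move/(out_map1 OS FG subH HG _ (bA _ Al0)) => o; exact: iA Al0 _ o.
exists l => //; apply/(out_map1 OS FG subH HG _ (bA _ Al)).
exact/line_orbit_refl/bA.
Qed.

Lemma out_image_saturated Theta A : H Theta -> saturated A ->
  saturated (out_image Theta A).
Proof.
move=> HT [bA iA]; split => [l [l0 Al0 m]|l [l0 Al0 m] l' o].
  exact: (out_map_biinfinite OS FG subH HG HT (bA _ Al0) m).
have bl := out_map_biinfinite OS FG subH HG HT (bA _ Al0) m.
have H1 : H 1%g by case: subH.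
move/(out_map1 OS FG subH HG _ bl): o => m1; exists l0 => //.
by have := out_map_comp OS FG subH HG HT H1 (bA _ Al0) m m1; rewrite mul1g.
Qed.

Lemma line_map_biinfinite (f : T -> T) l l' : line_map f l l' -> biinfinite l' ->
  biinfinite l.
Proof.
move=> [a0 [b0 [a1 [b1 [E E' e1 e2]]]]] bl' a la.
have inf c c' : extends f c c' -> ends l' c' -> exists e : bdry T, c = inr e.
  case: c => [v|e _ _]; last by exists e.
  by move=> /= -> /bl'[e].
rewrite E in la; case: la => ->.
  by apply: (inf a0 a1) => //; rewrite E'; left.
by apply: (inf b0 b1) => //; rewrite E'; right.
Qed.

Lemma crosses_invariant x y : line_invariant
  [set l : line T | biinfinite l -> crosses l x y].
Proof.
move=> l hl l' o bl'; have bl : biinfinite l.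
  by have [g hg] := o; exact: line_map_biinfinite hg bl'.
have /(line_orbitP _ bl)[_ [g eg]] := o; have [h [hx hy]] := hl bl.
exists (g * h)%g; rewrite eg !actM; split; first by exists (act h x).
by exists (act h y).
Qed.

Lemma nbhs_through l x y : biinfinite l -> tight_path l x -> tight_path l y ->
  nbhs l [set l' | biinfinite l' -> tight_path l' x /\ tight_path l' y].
Proof.
move=> /biinfinite_spans[c sc]; rewrite (tight_path_spans sc).
move=> [s _ <-] [t _ <-]; have [st|/ltW st] := leP s t; first exact: line_nbhs.
by apply: filterS (line_nbhs sc st) => l' h /h[].
Qed.

(** What ping-pong needs from an attracting neighbourhood: its images under the
    powers of [q] and the sets of lines crossing a segment of [l] are cofinal in
    one another. *)
Record attracting (q : out G) l U := Attracting {
  att_sat : saturated U;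
  att_incl : out_image q U `<=` U;
  att_base : forall x y, tight_path l x -> tight_path l y ->
    exists j, forall l', out_image (q ^+ j)%g U l' -> crosses l' x y;
  att_nbhs : exists x y, [/\ tight_path l x, tight_path l y, x != y &
    forall l', biinfinite l' -> crosses l' x y -> U l'] }.

(** Only the bi-infinite lines of the neighbourhood are kept.  Passing to a power of
    the automorphism keeps the images cofinal, as they are nested. *)
Lemma attracting_from_neighbourhood Theta l U0 r : H Theta -> biinfinite l ->
  attracting_neighbourhood Theta l U0 -> (0 < r)%N ->
  exists U, attracting (Theta ^+ r)%g l U.
Proof.
move=> HT bl [inv sub nb base] r0; have [c sc] := biinfinite_spans bl.
have [hc _] := sc; pose U := U0 `&` @biinfinite R G T; exists U.
have satU : saturated U.
  split => [l0 []//|l0 [U0l0 bl0] l1 o].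
  by split; [exact: (inv _ U0l0) | have /(line_orbitP _ bl0)[] := o].
have subU : out_image Theta U `<=` U.
  move=> l1 [l0 [U0l0 bl0] m]; split; first by apply: sub; exists l0.
  exact: (out_map_biinfinite OS FG subH HG HT bl0 m).
have HE n : H (Theta ^+ n)%g by exact: subgroupX.
have dec n m : (n <= m)%N -> out_image (Theta ^+ m)%g U `<=` out_image (Theta ^+ n)%g U.
  move=> /subnKC<-; elim: (m - n)%N => [|i IH]; first by rewrite addn0.
  rewrite addnS expgSr out_imageM//; apply: subset_trans IH.
  exact: out_image_mono.
have nb0 : exists M : R, 0 < M /\ forall l', biinfinite l' ->
    tight_path l' (c (- M)) -> tight_path l' (c M) -> U l'.
  have [M [M0 hM]] := nbhs_line_sub sc (nb 0%N); exists M; split => // l' bl' h1 h2.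
  have [l0 U0l0 m] := hM l' bl' h1 h2; have bl0 : biinfinite l0.
    by have [f _ lm] := m; exact: line_map_biinfinite lm bl'.
  have Ul0 : U l0 by [].
  rewrite -[U](out_image1 satU) -(expg0 Theta); exists l0 => //.
split => //.
- move=> l1; have := dec 1%N r r0; rewrite expg1 => d /d; exact: subU.
- move=> x y lx ly.
  have [j hj] : exists j, out_image (Theta ^+ j)%g U0 `<=`
      [set l' | biinfinite l' -> crosses l' x y].
    apply: base; first exact: crosses_invariant.
    apply: filterS (nbhs_through bl lx ly) => l' h /h[h1 h2].
    by exists 1%g; rewrite !act1.
  exists j => l' hl'; have jr : (j <= r * j)%N by rewrite leq_pmull.
  rewrite -expgnA in hl'; have [l0 [U0l0 bl0] m] := dec _ _ jr _ hl'.
  apply: hj; first by exists l0.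
  exact: (out_map_biinfinite OS FG subH HG (HE j) bl0 m).
- have [M [M0 hM]] := nb0; exists (c (- M)), (c M).
  have tc t : tight_path l (c t) by rewrite (tight_path_spans sc); exists t.
  split => //; first by rewrite -mdist_gt0 (geodesic_dist hc); lra.
  move=> l' bl' [g [h1 h2]]; have [l2 [bl2 e2]] := biinfinite_translate g^-1%g bl'.
  have o : line_orbit l2 l'.
    apply: line_orbit_sym => //; apply/line_orbitP => //; split => //.
    by exists g^-1%g.
  apply: (satU.2 l2 _ l' o); apply: hM => //; rewrite e2.
    by exists (act g (c (- M))) => //; rewrite actK.
  by exists (act g (c M)) => //; rewrite actK.
Qed.

(** If the images of [U] do not shrink, each line in [U] crosses all segments of [l],
    while [U] contains all lines that cross one of them. *)
Lemma attracting_strict Phi q l U : exponential_growth R Gs Phi -> H Phi -> H q ->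
  biinfinite l -> attracting q l U -> ~ U `<=` out_image q U.
Proof.
move=> EG HP Hq bl [sat incl base [x [y [lx ly xy nb]]]] h.
have all n : U `<=` out_image (q ^+ n)%g U.
  elim: n => [|n IH]; first by rewrite expg0 out_image1.
  apply: (subset_trans IH); rewrite expgSr out_imageM//; last exact: subgroupX.
  exact: out_image_mono.
apply: (not_determined OS FG subH HG EG HP xy bl) => l' bl' cr p p' lp lp'.
have [j hj] := base p p' lp lp'; apply: hj; apply: all; exact: nb.
Qed.

Lemma crosses_orbit l x y g : crosses l (act g x) (act g y) -> crosses l x y.
Proof. by move=> [h [hx hy]]; exists (h * g)%g; rewrite !actM. Qed.

(** The orbit of any generic line of a lamination accumulates on every other one,
    so attraction to one of them is attraction to all of them. *)
Lemma attracted_crosses Phi l1 l x y (L : set (line T)) : generic Gs pr Phi L l ->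
  tight_path l x -> tight_path l y -> weakly_attracted_lam Gs pr Phi l1 L ->
  exists N, forall n, (N <= n)%N -> exists l2,
    out_map (Phi ^+ n)%g l1 l2 /\ crosses l2 x y.
Proof.
move=> [EL [bl _] _ _] lx ly [l' [EL' [bl' _] _ _] [u hu cv]].
have cl : closure (line_orbit l') l.
  by rewrite -EL' EL; apply: subset_closure; exact: line_orbit_refl.
have [l0 [o h0]] := cl _ (nbhs_through bl lx ly).
have /(line_orbitP _ bl')[bl0 [g eg]] := o; have [] := h0 bl0.
rewrite eg => -[x' l'x ex] [y' l'y ey].
have [N _ hN] := cv _ _ (segment_tight_path bl' l'x l'y).
exists N => n /hN[h [z [z' [h1 h2]]]]; exists (u n); split; first exact: hu.
have [a /h1 la ea] := h2 _ (segment_left x' y').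
have [b /h1 lb eb] := h2 _ (segment_right x' y').
exists (g * h)^-1%g; by rewrite -ex -ey -ea -eb -!(actM g h) !actK.
Qed.

(** Weak attraction moves the image of [l] under [Theta] into the neighbourhood [U'],
    and continuity does the same for all lines near [l]. *)
Lemma hit_neighbourhood Phi Phi' Theta q' l l' U U' (L' : set (line T)) r :
  H Phi' -> H Theta -> H Phi -> biinfinite l -> attracting Phi l U ->
  generic Gs pr Phi' L' l' -> attracting q' l' U' -> q' = (Phi' ^+ r)%g ->
  (0 < r)%N ->
  (forall l1, out_map Theta l l1 -> weakly_attracted_lam Gs pr Phi' l1 L') ->
  exists n j, out_image (q' ^+ n * Theta * Phi ^+ j)%g U `<=` U'.
Proof.
move=> HP' HT HP bl [satU _ base _] gen' [satU' _ _ [x [y [lx ly _ nb]]]] eq' r0 wa.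
have [l1 [bl1 m1]] := out_map_total OS FG subH HG HT bl.
have [N hN] := attracted_crosses gen' lx ly (wa _ m1).
have [l2 [m2 [g [gx gy]]]] := hN (r * N)%N ltac:(by rewrite leq_pmull).
have Hq n : H (q' ^+ n)%g by rewrite eq'; do 2!apply: subgroupX => //.
rewrite expgnA -eq' in m2.
have m3 := out_map_comp OS FG subH HG HT (Hq N) bl m1 m2.
have HqT := subgroupM subH (Hq N) HT.
have [x' [y' [lx' ly' cont]]] := out_map_continuous OS FG subH HG HqT bl m3 gx gy.
have [j hj] := base _ _ lx' ly'; exists N, j => l4.
have HPj : H (Phi ^+ j)%g by exact: subgroupX.
rewrite out_imageM// => -[l3 Ul3 m4].
have satj := out_image_saturated HPj satU.
have bl3 : biinfinite l3 := satj.1 _ Ul3.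
apply: nb; first exact: (out_map_biinfinite OS FG subH HG HqT bl3 m4).
exact/crosses_orbit/(cont l3 l4 bl3 (hj _ Ul3) m4).
Qed.

End Assembly.

(** * Free subgroups *)

Theorem theorem3p1 (R : realType) (G : groupType) (k p : nat)
    (Gs : 'I_k -> set G) (T : gtree R G) (Phi : out G)
    (Lp Lm : set (line T)) (H : set (out G)) :
  finitely_generated G ->
  free_product_decomposition Gs p ->
  outer_space T Gs ->
  outG Gs Phi ->
  exponential_growth R Gs Phi ->
  attracting_lamination Gs p Phi Lp ->
  attracting_lamination Gs p (Phi^-1)%g Lm ->
  paired Gs p Lp Lm ->
  out_image Phi Lp = Lp ->
  out_image Phi Lm = Lm ->
  subgroup H ->
  H `<=` outG Gs ->
  H Phi ->
  (exists Psi : out G,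
    [/\ H Psi,
        exponential_growth R Gs Psi &
        forall (Psi' : out G) (l : line T),
          Psi' = Psi \/ Psi' = (Psi^-1)%g ->
          generic_image Gs p Psi' Phi Lp l \/
          generic_image Gs p Psi' (Phi^-1)%g Lm l ->
          weakly_attracted_lam Gs p Phi l Lp /\
          weakly_attracted_lam Gs p (Phi^-1)%g l Lm]) ->
  exists K : set (out G), K `<=` H /\ free_of_rank 2 K.
Proof.
move=> FG _ OS _ EG [lp gp] [lm gm] _ _ _ subH HG HP [Psi [HPsi _ hit]].
pose L b := if b then Lp else Lm; pose l b := if b then lp else lm.
have gen b : generic Gs p (signed Phi b) (L b) (l b) by case: b.
have bl b : biinfinite (l b) by have [_ [] ] := gen b.
have Hs (Theta : out G) b : H Theta -> H (signed Theta b).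
  by case: b => //=; exact: subgroupV.
have /choice[m hm] : forall b, exists m, (0 < m)%N /\ exists U,
    attracting_neighbourhood (signed Phi b ^+ m)%g (l b) U.
  by move=> b; have [_ _ h _] := gen b.
(* A common power of the two automorphisms for which the neighbourhoods are
   attracting. *)
pose P := (Phi ^+ (m true * m false))%g.
have eP b : signed P b = ((signed Phi b ^+ m b) ^+ m (~~ b))%g.
  by case: b; rewrite /= -expgnA // /P mulnC expVgn.
have m0 b : (0 < m b)%N by have [] := hm b.
have /choice[U hU] : forall b, exists U, attracting (signed P b) (l b) U.
  move=> b; rewrite eP; have [_ [U0 hU0]] := hm b.
  apply: (attracting_from_neighbourhood OS FG subH HG _ (bl b) hU0 (m0 _)).
  by apply: subgroupX => //; exact: Hs.
have HPP : H P by exact: subgroupX.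
apply: (@ping_pong _ _ H (@out_image R G T) (@saturated R G T) subH _ _ _ _ P Psi U) => //.
- exact: out_image_mono.
- by move=> *; exact: (out_imageM OS FG subH HG).
- by move=> *; exact: (out_image1 OS FG subH HG).
- by move=> *; exact: (out_image_saturated OS FG subH HG).
- by move=> b; have [] := hU b.
- by move=> b; have [] := hU b.
- by move=> b; exact: (attracting_strict OS FG subH HG EG HP (Hs _ b HPP) (bl b) (hU b)).
move=> s b b'.
apply: (hit_neighbourhood OS FG subH HG (Hs _ b' HP) (Hs _ s HPsi) (Hs _ b HPP)
  (bl b) (hU b) (gen b') (hU b') (_ : _ = (_ ^+ (m b' * m (~~ b')))%g)).
- by rewrite eP expgnA.
- by rewrite muln_gt0 !m0.
move=> l1 m1.
have [] := hit (signed Psi s) l1; first by case: s {m1}; [left|right].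
  by case: b {hU} m1 => m1; [left|right]; [exists lp|exists lm].
by case: b'.
Qed.
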